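(* Let $N\ge1$, $p\in(1,\infty)$, $s\in(0,1)$, and let $\Omega\subset\mathbb{R}^N$ be a bounded open set. Suppose that $\lim_{k\to s^-}\lambda_k=\lambda_s$. Then, up to passing to a subsequence $\{k_j\}$ as $k$ tends to $s$ from below, there exists a function $u\in\widetilde W^{s,p}(\Omega)$ such that $$\lim_{k_j\to s^-}[u_{k_j}-u]_{\widetilde W^{k_j,p}(\Omega)}=0 .$$ If $u\in\widetilde W^{s,p}_0(\Omega)$, then $u=u_s$. In any case $\|u\|_{L^p(\Omega)}=1$ and $$\lambda_s=\int_{\mathbb{R}^N}\int_{\mathbb{R}^N}\frac{|u(x)-u(y)|^p}{|x-y|^{N+sp}}\,dx\,dy .$$
   Context: For $\sigma\in(0,1)$ put $[u]_{\widetilde W^{\sigma,p}(\Omega)}:=\left(\int_{\mathbb{R}^N}\int_{\mathbb{R}^N}\frac{|u(x)-u(y)|^p}{|x-y|^{N+\sigma p}}\,dx\,dy\right)^{1/p}$. The space $\widetilde W^{\sigma,p}_0(\Omega)$ is the completion of $C_0^\infty(\Omega)$ (functions extended by $0$ to $\mathbb{R}^N$) with respect to this norm. The larger space $\widetilde W^{\sigma,p}(\Omega)$ is the completion, under the $W^{\sigma,p}(\mathbb{R}^N)$ norm, of $C^{0,\infty}(\Omega):=\{u\in C^\infty(\Omega): u=0 \text{ on } \mathbb{R}^N\setminus\Omega\}$. The first $(\sigma,p)$-eigenvalue is $$\lambda_\sigma:=\min\left\{[u]^p_{\widetilde W^{\sigma,p}(\Omega)}:\ u\in\widetilde W^{\sigma,p}_0(\Omega),\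 \|u\|_{L^p(\Omega)}=1,\ u\ge 0\right\},$$ and $u_\sigma$ denotes the (unique) minimizer, i.e. the nonnegative first $(\sigma,p)$-eigenfunction normalized by $\|u_\sigma\|_{L^p(\Omega)}=1$. No regularity of $\partial\Omega$ is assumed. *)

(* Defs.v *)
From HB Require Import structures.
From mathcomp Require Import all_boot all_order all_algebra.
From mathcomp Require Import all_classical all_reals all_analysis.

Set Implicit Arguments.
Unset Strict Implicit.
Unset Printing Implicit Defensive.

Import Order.TTheory GRing.Theory Num.Theory.
Import numFieldNormedType.Exports.

Local Open Scope classical_set_scope.
Local Open Scope ring_scope.

(** Mathematical Components / MathComp-Analysis.  The space R^N is ['rV[R]_N],
    with the topology of the library (its norm is the max norm, so the
    Euclidean norm is defined below). *)

(** As the library does for [n.-tuple T], ['rV[R]_n] carries the product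
    sigma-algebra, generated by the coordinates; for real coordinates this is
    the Borel sigma-algebra. *)
Section measurable_rV.
Context {R : realType} {n : nat}.

Let coors : 'I_n -> 'rV[R]_n -> measurableTypeR R := fun i v => v ord0 i.

Let rV_set0 : g_sigma_preimage coors set0.
Proof. exact: sigma_algebra0. Qed.

Let rV_setC A : g_sigma_preimage coors A -> g_sigma_preimage coors (~` A).
Proof. exact: sigma_algebraC. Qed.

Let rV_bigcup (F : _^nat) : (forall i, g_sigma_preimage coors (F i)) ->
  g_sigma_preimage coors (\bigcup_i (F i)).
Proof. exact: sigma_algebra_bigcup. Qed.

HB.instance Definition _ := @isMeasurable.Build
  (measure_tuple_display default_measure_display)
  'rV[R]_n (g_sigma_preimage coors) rV_set0 rV_setC rV_bigcup.

Lemma measurable_coord (i : 'I_n) :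
  measurable_fun [set: 'rV[R]_n] (fun v => v ord0 i : measurableTypeR R).
Proof.
move=> _ Y mY; rewrite setTI; apply: sub_sigma_algebra => /=.
rewrite -bigcup_seq/=; exists i => /=; first by rewrite mem_index_enum.
by exists Y => //; rewrite setTI.
Qed.

Lemma measurable_fun_coordP d (T : measurableType d) (f : T -> 'rV[R]_n) :
  (forall i, measurable_fun [set: T] (fun x => f x ord0 i : measurableTypeR R)) ->
  measurable_fun [set: T] f.
Proof.
move=> mf _ A mA.
have : @preimage_set_system T 'rV[R]_n setT f (g_sigma_preimage coors)
    (setT `&` f @^-1` A) by exists A.
rewrite -g_sigma_preimageE; apply: smallest_sub.
  exact: sigma_algebra_measurable.
move=> B [C]; rewrite -bigcup_seq /= => -[i _ [D mD <-]] <-.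
by rewrite setTI; exact: mf.
Qed.

End measurable_rV.

Section lebesgue_measure_rV.
Context {R : realType}.

Definition rV_cons n (xv : measurableTypeR R * 'rV[R]_n) : 'rV[R]_n.+1 :=
  row_mx (xv.1)%:M xv.2.

Definition rV_uncons n (w : 'rV[R]_n.+1) : measurableTypeR R * 'rV[R]_n :=
  (w ord0 ord0, \row_j w ord0 (lift ord0 j)).

Lemma rV_cons0 n xv : @rV_cons n xv ord0 ord0 = xv.1.
Proof.
rewrite /rV_cons (_ : (ord0 : 'I_n.+1) = lshift n (ord0 : 'I_1)); last exact/val_inj.
by rewrite (@row_mxEl _ 1 1 n) mxE mulr1n.
Qed.

Lemma rV_consS n xv j : @rV_cons n xv ord0 (lift ord0 j) = xv.2 ord0 j.
Proof.
rewrite /rV_cons (_ : lift ord0 j = rshift 1 j); last exact/val_inj.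
by rewrite (@row_mxEr _ 1 1 n).
Qed.

Lemma rV_consK n : cancel (@rV_cons n) (@rV_uncons n).
Proof.
move=> [x v]; rewrite /rV_uncons rV_cons0; congr pair.
by apply/rowP => j; rewrite mxE rV_consS.
Qed.

Lemma rV_unconsK n : cancel (@rV_uncons n) (@rV_cons n).
Proof.
move=> w; apply/rowP => i; case: (unliftP ord0 i) => [j|] ->.
  by rewrite rV_consS mxE.
by rewrite rV_cons0.
Qed.

Lemma measurable_rV_cons n :
  measurable_fun [set: measurableTypeR R * 'rV[R]_n] (@rV_cons n).
Proof.
apply: measurable_fun_coordP => i; case: (unliftP ord0 i) => [j|] ->.
  under eq_fun do rewrite rV_consS.
  by apply: (@measurableT_comp _ _ _ _ _ _ (fun v : 'rV[R]_n => v ord0 j));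
    [exact: measurable_coord|exact: measurable_snd].
under eq_fun do rewrite rV_cons0.
exact: measurable_fst.
Qed.

Lemma measurable_rV_uncons n : measurable_fun [set: 'rV[R]_n.+1] (@rV_uncons n).
Proof.
apply: measurable_fun_pair; first exact: measurable_coord.
apply: measurable_fun_coordP => i.
under eq_fun do rewrite mxE.
exact: measurable_coord.
Qed.

Section cons_measure.
Local Open Scope ereal_scope.
Context {n : nat} (mu : {sigma_finite_measure set 'rV[R]_n -> \bar R}).

Let nu := [the {measure set _ -> \bar R} of @lebesgue_measure R \x mu].

Definition cons_measure : set 'rV[R]_n.+1 -> \bar R :=
  pushforward nu (@rV_cons n).

Let cons_measure0 : cons_measure set0 = 0.
Proof. by rewrite /cons_measure /pushforward preimage_set0 measure0. Qed.

Let cons_measure_ge0 A : 0 <= cons_measure A.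
Proof. exact: (measure_ge0 nu). Qed.

Let cons_measure_sigma_additive : semi_sigma_additive cons_measure.
Proof.
move=> F mF tF mUF; rewrite /cons_measure /pushforward preimage_bigcup.
apply: (@measure_semi_sigma_additive _ _ _ nu).
- by move=> k; rewrite -[X in measurable X]setTI; exact: measurable_rV_cons.
- apply/trivIsetP => /= i j _ _ ij; rewrite -preimage_setI.
  by move/trivIsetP : tF => /(_ _ _ _ _ ij) ->//; rewrite preimage_set0.
- rewrite -preimage_bigcup -[X in measurable X]setTI.
  exact: measurable_rV_cons.
Qed.

HB.instance Definition _ := isMeasure.Build _ _ _ cons_measure
  cons_measure0 cons_measure_ge0 cons_measure_sigma_additive.

Let cons_measure_sigma_finite : sigma_finite setT cons_measure.
Proof.
have /sigma_finiteP[F [TF ndF Foo]] := sigma_finiteT (@lebesgue_measure R).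
have /sigma_finiteP[G [TG ndG Goo]] := sigma_finiteT mu.
exists (fun k => @rV_uncons n @^-1` (F k `*` G k)).
  rewrite -preimage_bigcup (_ : \bigcup_i _ = setT) ?preimage_setT//.
  rewrite -subTset => -[x y] _.
  have [k _ Fkx] : (\bigcup_i F i) x by rewrite -TF.
  have [l _ Gly] : (\bigcup_i G i) y by rewrite -TG.
  exists (maxn k l) => //; split.
  - by move: x Fkx; exact/subsetPset/ndF/leq_maxl.
  - by move: y Gly; exact/subsetPset/ndG/leq_maxr.
move=> k; have [? ?] := Foo k; have [? ?] := Goo k; split.
  rewrite -[X in measurable X]setTI; apply: measurable_rV_uncons => //.
  exact: measurableX.
rewrite /cons_measure /pushforward -comp_preimage.
rewrite (_ : _ \o _ = id) ?preimage_id; last exact/funext/rV_consK.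
by rewrite [ltLHS]product_measure1E// lte_mul_pinfty// ge0_fin_numE.
Qed.

HB.instance Definition _ := Measure_isSigmaFinite.Build _ _ _ cons_measure
  cons_measure_sigma_finite.

End cons_measure.

Fixpoint lebesgue_rV n : {sigma_finite_measure set 'rV[R]_n -> \bar R} :=
  if n is m.+1 then @cons_measure m (lebesgue_rV m) else \d_(0 : 'rV[R]_0).

End lebesgue_measure_rV.
Arguments lebesgue_rV R n : clear implicits.

Lemma lebesgue_rV_box (R : realType) n (a b : 'I_n -> R) :
  (forall i, a i <= b i) ->
  lebesgue_rV R n [set v | forall i, a i <= v ord0 i <= b i] =
  (\prod_i (b i - a i))%:E.
Proof.
elim: n a b => [|n IH] a b ab.
  by rewrite big_ord0 /= diracE mem_set// => -[].
rewrite big_ord_recl.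
transitivity ((@lebesgue_measure R \x lebesgue_rV R n)%E (`[a ord0, b ord0] `*`
  [set v : 'rV[R]_n |
    forall i, a (lift ord0 i) <= v ord0 i <= b (lift ord0 i)])).
  rewrite [LHS]/= /cons_measure /pushforward; congr (_ _).
  apply/seteqP; split => [[x v] /= h|[x v] /= [h1 h2] i].
    split; first by have := h ord0; rewrite rV_cons0 in_itv.
    by move=> i; have := h (lift ord0 i); rewrite rV_consS.
  case: (unliftP ord0 i) => [j|] ->; first by rewrite rV_consS.
  by rewrite rV_cons0; move: h1; rewrite in_itv.
rewrite [LHS]product_measure1E//.
- rewrite IH; last by move=> i; exact: ab.
  rewrite EFinM; congr (_ * _)%E; rewrite [LHS]lebesgue_measure_itv/= lte_fin.
  by have := ab ord0; rewrite le_eqVlt => /predU1P[->|->]; rewrite ?ltxx ?subrr.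
- rewrite [X in measurable X](_ : _ = \bigcap_(i in [set: 'I_n])
    (fun v : 'rV[R]_n => v ord0 i : measurableTypeR R) @^-1`
      `[a (lift ord0 i), b (lift ord0 i)]); last first.
    apply/seteqP; split => v /= h i; first by move=> _ /=; rewrite in_itv/=.
    by have /= := h i Logic.I; rewrite in_itv.
  apply: fin_bigcap_measurable => // i _.
  rewrite -[X in measurable X]setTI.
  exact: measurable_coord.
Qed.

Section fractional_sobolev.
Context {R : realType} {N : nat}.
Implicit Types (u phi : 'rV[R]_N -> R) (Omega : set 'rV[R]_N) (sigma p : R).

Local Notation mu := (lebesgue_rV R N).

Definition partials (l : seq 'I_N) phi : 'rV[R]_N -> R :=
  foldr (fun i g => 'D_(delta_mx ord0 i) g) phi l.

(** [D] is meant to be open. *)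
Definition smooth_on (D : set 'rV[R]_N) phi :=
  forall (l : seq 'I_N) (x : 'rV[R]_N), D x ->
    {for x, continuous (partials l phi)} /\
    forall i, derivable (partials l phi) x (delta_mx ord0 i).

Definition support_fun phi := closure [set x | phi x != 0].

(** [C_0^oo(Omega)], extended by 0 *)
Definition smooth_compact Omega phi :=
  [/\ smooth_on setT phi, compact (support_fun phi) &
      support_fun phi `<=` Omega].

(** [C^{0,oo}(Omega)]: nothing is required across the boundary of [Omega] *)
Definition smooth_zero_outside Omega phi :=
  smooth_on Omega phi /\ (forall x, ~ Omega x -> phi x = 0).

Definition enorm (x : 'rV[R]_N) : R := Num.sqrt (\sum_i x ord0 i ^+ 2).

Local Open Scope ereal_scope.

(** On the diagonal the integrand is [0], as [0 `^ _ = 0] and [x / 0 = 0]. *)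
Definition gagliardo_energy sigma p u : \bar R :=
  \int[mu]_x \int[mu]_y
    (`|u x - u y| `^ p / enorm (x - y) `^ (N%:R + sigma * p))%:E.

Definition gagliardo sigma p u : \bar R := gagliardo_energy sigma p u `^ p^-1.

Definition Lp_norm p (D : set 'rV[R]_N) u : \bar R :=
  'N[mu]_(p%:E)[(EFin \o u) \_ D].

Definition sobolev_norm sigma p u : \bar R :=
  (Lp_norm p setT u `^ p + gagliardo_energy sigma p u) `^ p^-1.

(** Elements of the completions are represented by Borel functions on R^N, up
    to equality almost everywhere. *)

(** Completion of [C_0^oo(Omega)] for [gagliardo sigma p].  For bounded [Omega]
    this seminorm is a complete norm on the functions of finite seminorm that
    vanish almost everywhere outside [Omega] (Poincare inequality), so the
    completion is the closure of [C_0^oo(Omega)] there. *)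
Definition W0 sigma p Omega u :=
  [/\ measurable_fun setT u,
      {ae mu, forall x, ~ Omega x -> u x = 0%R} &
      exists phi : nat -> 'rV[R]_N -> R,
        (forall n, smooth_compact Omega (phi n)) /\
        gagliardo sigma p (phi n \- u)%R @[n --> \oo] --> 0].

(** Completion of [C^{0,oo}(Omega)] for the norm of [W^{sigma,p}(R^N)], i.e.
    closure in [W^{sigma,p}(R^N)] of the functions of finite norm. *)
Definition Wtilde sigma p Omega u :=
  measurable_fun setT u /\
  exists phi : nat -> 'rV[R]_N -> R,
    (forall n, smooth_zero_outside Omega (phi n) /\
               sobolev_norm sigma p (phi n) < +oo) /\
    sobolev_norm sigma p (phi n \- u)%R @[n --> \oo] --> 0.

Definition admissible sigma p Omega u :=
  [/\ W0 sigma p Omega u, Lp_norm p Omega u = 1 &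
      {ae mu, forall x, (0 <= u x)%R}].

Definition lambda1 sigma p Omega : \bar R :=
  ereal_inf [set gagliardo sigma p u `^ p | u in admissible sigma p Omega].

Definition first_eigenfunction sigma p Omega u :=
  admissible sigma p Omega u /\ gagliardo sigma p u `^ p = lambda1 sigma p Omega.

End fractional_sobolev.

(* Main.v *)
Require Import Defs.
From mathcomp Require Import all_boot all_order all_algebra.
From mathcomp Require Import all_classical all_reals all_analysis.
From mathcomp Require Import measurable_realfun.
From mathcomp Require Import ring lra.
Import Order.TTheory GRing.Theory Num.Theory.
Import numFieldNormedType.Exports.
Set Implicit Arguments.
Unset Strict Implicit.
Unset Printing Implicit Defensive.
Local Open Scope classical_set_scope.
Local Open Scope ring_scope.

(** Write E_k(u) for the Gagliardo energy of exponent k, the p-th power of the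
    seminorm, and let u_k be the first eigenfunction, so that E_k(u_k) is the
    eigenvalue lambda_k.  The idea is that the energies of the u_k stay bounded
    as k increases to s, so that a subsequence converges, and that the
    continuity of the eigenvalue from the left forbids any loss of energy in
    the limit.

    Compactness.  Splitting the double integral at |x - y| = d gives
    E_sigma(w) <= d^((k - sigma) p) E_k(w) + C(d, sigma) ||w||_p^p for
    sigma <= k [energy_split].  Hence all u_k with k close to s have bounded
    energy at one fixed exponent, and [rellich_kolmogorov] extracts a
    subsequence that converges in L^p and almost everywhere to some u with
    ||u||_p = 1.

    No loss of energy.  Fatou's lemma gives E_s(u) <= lambda_s.  For sigma < s
    the splitting, with d small, gives E_sigma(u_k - u) -> 0; so u lies in
    W0^sigma and is a competitor there, whence lambda_sigma <= E_sigma(u).  As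
    sigma increases to s, E_sigma(u) tends to E_s(u) by dominated convergence
    and lambda_sigma tends to lambda_s, so E_s(u) = lambda_s
    [limit_eigenfunction].  In general this does not place u in W0^s, since the
    argument stops short of the exponent s.

    Strong convergence.  The energies E_k(u_k) = lambda_k and E_k(u) both tend to
    E_s(u), and u_k -> u almost everywhere.  A Scheffe argument with moving
    exponents, based on the generalised dominated convergence theorem of Pratt,
    gives E_k(u_k - u) -> 0 [energy_scheffe].

    Membership in Wtilde^s.  Every function of finite W^{s,p} norm that vanishes
    outside Omega is a limit of functions smooth inside Omega, whatever the
    boundary [meyers_serrin].  The function is cut into layers by the distance
    to the complement, each layer is mollified at its own scale, and the pieces
    are added up.  Convergence of the mollifications is again a Scheffe
    argument: Jensen's inequality shows that mollification does not increase
    the energy [energy_moll_le], and Fatou's lemma bounds it from below.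

    Uniqueness.  If u lies in W0^s then u and u_s are both minimisers.  The mean
    ((u^p + v^p) / 2)^(1/p) of two minimisers is again a competitor of unit norm,
    and its energy is at most the mean of the energies (hidden convexity,
    [pmean_diff]); equality forces u(x) v(y) = v(x) u(y) for almost all (x, y),
    and the normalisation turns proportionality into equality. *)

(** * Subsequences, powers and limits under the integral sign *)

(** The step at which [P j] starts to hold depends on [j], so the indices are
    chosen recursively, each beyond the previous one. *)
Lemma increasing_extraction (P : nat -> nat -> Prop) :
  (forall j, \forall n \near \oo, P j n) ->
  exists phi : nat -> nat, {homo phi : m n / (m < n)%N} /\ forall j, P j (phi j).
Proof.
move=> nP.
have /choice[g gP] : forall jm : nat * nat, exists n, (jm.2 < n)%N /\ P jm.1 n.
  move=> [j m] /=; have [n0 _ h] := nP j; exists (maxn n0 m.+1); split.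
    by rewrite leq_max ltnSn orbT.
  by apply: h; rewrite /= leq_maxl.
pose phi := fix phi j := if j is j'.+1 then g (j, phi j') else g (0%N, 0%N).
exists phi; split; last by case=> [|j]; [exact: (gP (0, 0)%N).2|exact: (gP (_, _)).2].
apply: homo_ltn; first exact: ltn_trans.
by move=> j; exact: (gP (j.+1, phi j)).1.
Qed.

Lemma extraction_ge (phi : nat -> nat) :
  {homo phi : m n / (m < n)%N} -> forall n, (n <= phi n)%N.
Proof.
move=> h; elim=> [//|n ih]; exact: leq_ltn_trans ih (h _ _ (ltnSn n)).
Qed.

Lemma cvg_extraction (phi : nat -> nat) :
  {homo phi : m n / (m < n)%N} -> phi @ \oo --> \oo.
Proof.
move=> h A [N _ AN]; exists N => // n /= Nn.
by apply: AN => /=; exact: leq_trans Nn (extraction_ge h n).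
Qed.

Section powR_tools.
Context {R : realType}.
Implicit Types a b p : R.

Lemma powR_normD_le p a b : 0 <= p ->
  `|a + b| `^ p <= 2 `^ p * (`|a| `^ p + `|b| `^ p).
Proof.
move=> p0; wlog ab : a b / `|a| <= `|b|.
  move=> h; have [|/ltW] := leP `|a| `|b|; first exact: h.
  by move=> /h; rewrite addrC [X in 2 `^ p * X]addrC.
have -> : 2 `^ p * (`|a| `^ p + `|b| `^ p) = 2 `^ p * `|a| `^ p + (2 * `|b|) `^ p.
  by rewrite mulrDr (powRM p _ (normr_ge0 b)).
apply: (@le_trans _ _ ((2 * `|b|) `^ p)).
  apply: ge0_ler_powR => //; rewrite ?nnegrE ?mulr_ge0//.
  by rewrite (le_trans (ler_normD _ _))// mulr_natl mulr2n lerD2r.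
by rewrite lerDr mulr_ge0// powR_ge0.
Qed.

Lemma powR_normB_le p a b : 0 <= p ->
  `|a - b| `^ p <= 2 `^ p * (`|a| `^ p + `|b| `^ p).
Proof. by move=> p0; rewrite -[X in _ + X `^ _]normrN; exact: powR_normD_le. Qed.

Lemma norm_powR_lt p a e : 0 < p -> 0 < e -> `|a| < e `^ p^-1 -> `|a| `^ p < e.
Proof.
move=> p0 e0 h; have -> : e = (e `^ p^-1) `^ p.
  by rewrite -powRrM mulVf ?gt_eqF// powRr1// ltW.
by apply: gt0_ltr_powR => //; rewrite nnegrE ?powR_ge0.
Qed.

Lemma powRK p a : p != 0 -> 0 <= a -> (a `^ p) `^ p^-1 = a.
Proof. by move=> p0 a0; rewrite -powRrM mulfV// powRr1. Qed.

Lemma powRVK p a : p != 0 -> 0 <= a -> (a `^ p^-1) `^ p = a.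
Proof. by move=> p0 a0; rewrite -powRrM mulVf// powRr1. Qed.

Lemma continuous_norm_powR p : 0 < p -> continuous (fun a : R => `|a| `^ p).
Proof.
move=> p0 a; have [->|a0] := eqVneq a 0.
  apply/cvgrPdist_lt => e e0; rewrite /= normr0 powR0 ?gt_eqF//.
  near=> b; rewrite sub0r normrN ger0_norm ?powR_ge0//.
  apply: norm_powR_lt => //; near: b.
  have /cvgrPdist_lt/(_ (e `^ p^-1)) := @cvg_id _ (nbhs (0:R)).
  by rewrite powR_gt0// => /(_ isT); apply: filterS => b; rewrite sub0r normrN.
apply: (@continuous_comp _ _ _ (fun a => `|a|) (fun a => a `^ p)).
  exact: norm_continuous.
apply: differentiable_continuous; apply/derivable1_diffP.
by apply: derivable_powR; rewrite in_itv/= andbT normr_gt0.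
Unshelve. all: by end_near. Qed.

Lemma cvg_norm_powR p (T : Type) (F : set_system T) (FF : Filter F) (f : T -> R) l :
  0 < p -> f x @[x --> F] --> l -> `|f x| `^ p @[x --> F] --> `|l| `^ p.
Proof.
move=> p0 fl; apply: (@cvg_comp _ _ _ f (fun a : R => `|a| `^ p) F (nbhs l)) => //.
exact: continuous_norm_powR.
Qed.

Lemma cvg_norm_powR0 p (T : Type) (F : set_system T) (FF : Filter F) (f : T -> R) :
  0 < p -> `|f x| `^ p @[x --> F] --> 0 -> f x @[x --> F] --> 0.
Proof.
move=> p0 /cvgrPdist_lt h; apply/cvgrPdist_lt => e e0.
have := h (e `^ p); rewrite powR_gt0// => /(_ isT); apply: filterS => t.
rewrite !sub0r !normrN [`|_ `^ _|]ger0_norm ?powR_ge0//.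
rewrite !ltNge; apply: contra => ?.
by apply: ge0_ler_powR; rewrite ?nnegrE// ltW.
Qed.

End powR_tools.

(** Testing smallness with real bounds avoids splitting finite and infinite
    values. *)
Lemma ge0_cvge0P {R : realType} {I : Type} (F : set_system I) (FF : Filter F)
    (u : I -> \bar R) : (forall i, 0 <= u i)%E ->
  u @ F --> 0%E <-> forall e : R, 0 < e -> \forall i \near F, (u i < e%:E)%E.
Proof.
move=> u0; split=> [h e e0|h].
  have : nbhs (0 : \bar R)%E [set y | (y < e%:E)%E].
    by apply: open_nbhs_nbhs; split; [exact: open_ereal_lt_ereal|rewrite /= lte_fin].
  by move=> /h.
have ufin e : 0 < e -> \forall i \near F, u i \is a fin_num /\ fine (u i) < e.
  move=> /h; apply: filterS => i hi.
  have ui : u i \is a fin_num by rewrite ge0_fin_numE// (lt_trans hi)// ltry.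
  by split => //; rewrite -lte_fin fineK.
apply/fine_cvgP; split; first by apply: filterS (ufin 1 ltr01) => i [].
apply/cvgrPdist_lt => e /ufin; apply: filterS => i [_ hi] /=.
by rewrite sub0r normrN ger0_norm// fine_ge0.
Qed.

Section ge0_integral_tools.
Local Open Scope ereal_scope.
Context d (T : measurableType d) (R : realType) (mu : {measure set T -> \bar R}).
Implicit Types f g : T -> R.

Lemma int_ge0 f : (forall x, (0 <= f x)%R) -> 0 <= \int[mu]_x (f x)%:E.
Proof. by move=> f0; apply: integral_ge0 => x _; rewrite lee_fin. Qed.

Lemma int_le f g : (forall x, (0 <= f x)%R) ->
  measurable_fun setT f -> measurable_fun setT g ->
  (forall x, (f x <= g x)%R) -> \int[mu]_x (f x)%:E <= \int[mu]_x (g x)%:E.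
Proof.
move=> f0 mf mg fg; apply: ge0_le_integral => //.
- by move=> x _; rewrite lee_fin.
- exact/measurable_EFinP.
- exact/measurable_EFinP.
- by move=> x _; rewrite lee_fin.
Qed.

Lemma int_ae_le f g : (forall x, (0 <= f x)%R) -> (forall x, (0 <= g x)%R) ->
  measurable_fun setT f -> measurable_fun setT g ->
  {ae mu, forall x, (f x <= g x)%R} -> \int[mu]_x (f x)%:E <= \int[mu]_x (g x)%:E.
Proof.
move=> f0 g0 mf mg fg; apply: ae_ge0_le_integral => //.
- by move=> x _; rewrite lee_fin.
- exact/measurable_EFinP.
- by move=> x _; rewrite lee_fin.
- exact/measurable_EFinP.
- by apply: filterS fg => x h _; rewrite lee_fin.
Qed.

Lemma int_ae_eq f g : (forall x, (0 <= f x)%R) -> (forall x, (0 <= g x)%R) ->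
  measurable_fun setT f -> measurable_fun setT g ->
  {ae mu, forall x, (f x = g x)%R} -> \int[mu]_x (f x)%:E = \int[mu]_x (g x)%:E.
Proof.
move=> f0 g0 mf mg fg; apply: ge0_ae_eq_integral => //.
- exact/measurable_EFinP.
- exact/measurable_EFinP.
- by move=> x _; rewrite lee_fin.
- by move=> x _; rewrite lee_fin.
- by apply: filterS fg => x ->.
Qed.

Lemma intD f g : (forall x, (0 <= f x)%R) -> (forall x, (0 <= g x)%R) ->
  measurable_fun setT f -> measurable_fun setT g ->
  \int[mu]_x (f x + g x)%:E = \int[mu]_x (f x)%:E + \int[mu]_x (g x)%:E.
Proof.
move=> f0 g0 mf mg; under eq_integral do rewrite EFinD.
rewrite ge0_integralD//.
- by move=> x _; rewrite lee_fin.
- exact/measurable_EFinP.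
- by move=> x _; rewrite lee_fin.
- exact/measurable_EFinP.
Qed.

Lemma intZ (c : R) f : (0 <= c)%R -> (forall x, (0 <= f x)%R) ->
  measurable_fun setT f ->
  \int[mu]_x (c * f x)%:E = c%:E * \int[mu]_x (f x)%:E.
Proof.
move=> c0 f0 mf; under eq_integral do rewrite EFinM.
rewrite ge0_integralZl//.
- exact/measurable_EFinP.
- by move=> x _; rewrite lee_fin.
Qed.

(** The sum of all the functions has finite integral, hence is finite almost
    everywhere, and the terms of a convergent series tend to zero. *)
Lemma ae_cvg0_of_int_le_geometric (f : nat -> T -> R) :
  (forall n, measurable_fun setT (f n)) -> (forall n x, (0 <= f n x)%R) ->
  (forall n, \int[mu]_x (f n x)%:E <= (2^-1 ^+ n)%:E) ->
  {ae mu, forall x, f n x @[n --> \oo] --> 0%R}.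
Proof.
move=> mf f0 hf.
have mf' n : measurable_fun setT (fun x => (f n x)%:E) by exact/measurable_EFinP.
have S2 : \int[mu]_x (\sum_(n <oo) (f n x)%:E) <= 2%:E.
  rewrite integral_nneseries//; last by move=> n x _; rewrite lee_fin.
  apply: lime_le.
    by apply: is_cvg_nneseries => n _ _; apply: int_ge0 => x; exact: f0.
  near=> n; rewrite big_mkord.
  apply: (@le_trans _ _ (\sum_(i < n) (2^-1 ^+ i)%:E)); first exact: lee_sum.
  rewrite sumEFin lee_fin.
  suff -> : (\sum_(i < n) 2^-1 ^+ i = 2 - 2 * 2^-1 ^+ n :> R)%R.
    by rewrite gerBl mulr_ge0// exprn_ge0.
  elim: (n) => [|m ih]; first by rewrite big_ord0 expr0; lra.
  by rewrite big_ord_recr/= ih exprS; lra.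
have : mu.-integrable setT (fun x => \sum_(n <oo) (f n x)%:E).
  apply/integrableP; split.
    by apply: ge0_emeasurable_sum => // n x _ _; rewrite lee_fin.
  apply: (le_lt_trans _ (ltry 2)); apply: le_trans S2.
  rewrite le_eqVlt; apply/orP; left; apply/eqP; apply: eq_integral => x _.
  by rewrite gee0_abs//; apply: nneseries_ge0 => n _ _; rewrite lee_fin.
move=> /integrable_ae -/(_ measurableT); apply: filterS => x /(_ Logic.I) xfin.
apply: cvg_series_cvg_0.
apply: nondecreasing_is_cvgn.
  by apply: nondecreasing_series => n _ _.
exists (fine (\sum_(n <oo) (f n x)%:E)) => _ [n _ <-].
rewrite -lee_fin fineK// /series/= -sumEFin.
by apply: (@nneseries_lim_ge _ (fun n => (f n x)%:E) xpredT 0%N n) => i _ _; rewrite lee_fin.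
Unshelve. all: by end_near. Qed.

Lemma cvg0_int_subseq_ae (f : nat -> T -> R) :
  (forall n, measurable_fun setT (f n)) -> (forall n x, (0 <= f n x)%R) ->
  \int[mu]_x (f n x)%:E @[n --> \oo] --> 0 ->
  exists phi : nat -> nat, {homo phi : m n / (m < n)%N} /\
    {ae mu, forall x, f (phi n) x @[n --> \oo] --> 0%R}.
Proof.
move=> mf f0 h.
have [j|phi [hphi phiP]] := @increasing_extraction
    (fun j n => \int[mu]_x (f n x)%:E <= (2^-1 ^+ j)%:E).
  have /ge0_cvge0P/(_ (2^-1 ^+ j)%R) := h; rewrite exprn_gt0// => /(_ _ isT) hj.
  by apply: filterS (hj _) => [n /ltW|n] //; apply: int_ge0 => x; exact: f0.
exists phi; split => //; apply: (@ae_cvg0_of_int_le_geometric (f \o phi)) => //=.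
Qed.

End ge0_integral_tools.

Section fatou_tools.
Local Open Scope ereal_scope.
Context d (T : measurableType d) (R : realType) (mu : {measure set T -> \bar R}).

(** Fatou's lemma in the form used throughout: any level strictly below the
    integral of the limit is eventually passed. Since no lower limit of
    integrals appears, the statement combines directly with filters. *)
Lemma fatou_ae_lt (f : nat -> T -> R) (g : T -> R) (c : \bar R) :
  (forall n, measurable_fun setT (f n)) -> measurable_fun setT g ->
  (forall n x, (0 <= f n x)%R) -> (forall x, (0 <= g x)%R) ->
  {ae mu, forall x, f n x @[n --> \oo] --> g x} ->
  c < \int[mu]_x (g x)%:E -> \forall n \near \oo, c < \int[mu]_x (f n x)%:E.
Proof.
move=> mf mg f0 g0 fg cg.
have mf' n : measurable_fun setT (fun x => (f n x)%:E) by exact/measurable_EFinP.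
have gE : \int[mu]_x (g x)%:E = \int[mu]_x limn_einf (fun n => (f n x)%:E).
  apply: ge0_ae_eq_integral => //.
  - exact/measurable_EFinP.
  - rewrite /limn_einf; apply: (@measurableT_comp _ _ _ _ _ _ (@oppe R)) => //.
    apply: (measurable_fun_limn_esup (f := fun n x => - (f n x)%:E)) => k.
    exact: (@measurableT_comp _ _ _ _ _ _ (@oppe R)).
  - by move=> x _; rewrite lee_fin.
  - move=> x _; rewrite limn_einf_lim; apply: lime_ge; first exact: is_cvg_einfs.
    by near=> n; apply: le_ereal_inf_tmp => _ [m _ <-]; rewrite lee_fin.
  - apply: filterS fg => x fgx _.
    have hx : (fun n => (f n x)%:E) @ \oo --> (g x)%:E.
      by apply: cvg_EFin => //; exact: nearW.
    by rewrite (cvg_limn_einf_sup hx).1.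
have := fatou mu measurableT mf'.
rewrite -gE => /(_ (fun n x _ => f0 n x)) /(lt_le_trans cg).
rewrite limn_einf_lim.
have /(cvg_lim (@ereal_hausdorff R)) -> :=
  @cvg_einfs_sup R (fun n => \int[mu]_x (f n x)%:E).
move=> /ereal_sup_gt[_ [n _ <-]] /= h.
by exists n => // m /= nm; apply: (lt_le_trans h); apply: ereal_inf_lbound; exists m.
Unshelve. all: by end_near. Qed.

Lemma fatou_ae_le (f : nat -> T -> R) (g : T -> R) (c : \bar R) :
  (forall n, measurable_fun setT (f n)) -> measurable_fun setT g ->
  (forall n x, (0 <= f n x)%R) -> (forall x, (0 <= g x)%R) ->
  {ae mu, forall x, f n x @[n --> \oo] --> g x} ->
  (\forall n \near \oo, \int[mu]_x (f n x)%:E <= c) -> \int[mu]_x (g x)%:E <= c.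
Proof.
move=> mf mg f0 g0 fg fc; rewrite leNgt; apply/negP => cg.
have [n []] := @filter_ex _ _ _ _ (filterI fc (fatou_ae_lt mf mg f0 g0 fg cg)).
by move=> /le_lt_trans /[apply]; rewrite ltxx.
Qed.

(** Dominated convergence with a moving majorant, due to Pratt. Fatou's lemma
    applied to [G n - h n] shows that no mass of [h n] survives, because the
    integrals of [G n] converge to that of their limit. *)
Lemma pratt_cvg0 (h G : nat -> T -> R) (g : T -> R) :
  (forall n, measurable_fun setT (h n)) -> (forall n, measurable_fun setT (G n)) ->
  measurable_fun setT g -> (forall x, (0 <= g x)%R) ->
  (forall n x, (0 <= h n x <= G n x)%R) ->
  {ae mu, forall x, h n x @[n --> \oo] --> 0%R} ->
  {ae mu, forall x, G n x @[n --> \oo] --> g x} ->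
  \int[mu]_x (g x)%:E < +oo ->
  \int[mu]_x (G n x)%:E @[n --> \oo] --> \int[mu]_x (g x)%:E ->
  \int[mu]_x (h n x)%:E @[n --> \oo] --> 0.
Proof.
move=> mh mG mg g0 hG h0 Gg gfin Gint.
have hge0 n x : (0 <= h n x)%R by have /andP[] := hG n x.
have Gge0 n x : (0 <= G n x)%R by have /andP[] := hG n x; exact: le_trans.
have Gh0 n x : (0 <= G n x - h n x)%R by rewrite subr_ge0; have /andP[] := hG n x.
have mGh n : measurable_fun setT (fun x => (G n x - h n x)%R) by exact: measurable_funB.
apply/ge0_cvge0P => [n|e e0]; first exact: int_ge0.
have gF : \int[mu]_x (g x)%:E \is a fin_num by rewrite ge0_fin_numE// int_ge0.
set A := fine (\int[mu]_x (g x)%:E).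
have gA : \int[mu]_x (g x)%:E = A%:E by rewrite fineK.
have lo : \forall n \near \oo, (A - e / 2)%:E < \int[mu]_x (G n x - h n x)%:E.
  apply: (fatou_ae_lt mGh mg) => //.
    apply: filterS2 h0 Gg => x hx Gx.
    by rewrite -[X in _ --> X]subr0; exact: cvgB.
  by rewrite gA lte_fin; lra.
have hi : \forall n \near \oo, \int[mu]_x (G n x)%:E < (A + e / 2)%:E.
  have : nbhs (\int[mu]_x (g x)%:E) [set y | y < (A + e / 2)%:E].
    rewrite gA; apply: open_nbhs_nbhs; split; first exact: open_ereal_lt_ereal.
    by rewrite /= lte_fin; lra.
  by move=> /Gint.
apply: filterS2 lo hi => n lo hi.
have GE : \int[mu]_x (G n x)%:E =
    \int[mu]_x (G n x - h n x)%:E + \int[mu]_x (h n x)%:E.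
  rewrite -intD//; by apply: eq_integral => x _; rewrite subrK.
have fin f : (forall x, 0 <= f x)%R -> \int[mu]_x (f x)%:E <= \int[mu]_x (G n x)%:E ->
    \int[mu]_x (f x)%:E \is a fin_num.
  by move=> f0 fG; rewrite ge0_fin_numE ?int_ge0// (le_lt_trans fG)// (lt_trans hi)// ltry.
have f1 := fin _ (Gh0 n); have f2 := fin _ (hge0 n).
have {}f1 : \int[mu]_x (G n x - h n x)%:E \is a fin_num.
  by apply: f1; rewrite GE leeDl// int_ge0.
have {}f2 : \int[mu]_x (h n x)%:E \is a fin_num.
  by apply: f2; rewrite GE leeDr// int_ge0.
move: lo hi; rewrite GE -(fineK f1) -(fineK f2) -EFinD !lte_fin; lra.
Qed.

(** Divided by [(2^-n)^p], the powers of the increments still have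
    geometrically small integrals, so almost everywhere the increments are
    eventually below [2^-n] and the sequence is Cauchy. *)
Lemma ae_cvg_of_int_le_geometric (p : R) (v : nat -> T -> R) : (0 < p)%R ->
  (forall n, measurable_fun setT (v n)) ->
  (forall n, \int[mu]_x (`|v n.+1 x - v n x| `^ p)%:E <=
     ((2^-1 ^+ n) `^ p * 2^-1 ^+ n)%:E) ->
  {ae mu, forall x, cvgn (v ^~ x)}.
Proof.
move=> p0 mv hv.
have mD n : measurable_fun setT (fun x => (`|v n.+1 x - v n x| `^ p)%R).
  apply: (measurableT_comp (measurable_powR _)).
  by apply: measurableT_comp => //; exact: measurable_funB.
have c0 n : (0 < ((2^-1 ^+ n) `^ p)^-1 :> R)%R.
  by rewrite invr_gt0 powR_gt0// exprn_gt0.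
have : {ae mu, forall x, (((2^-1 ^+ n) `^ p)^-1 * `|v n.+1 x - v n x| `^ p)%R
    @[n --> \oo] --> 0%R}.
  apply: ae_cvg0_of_int_le_geometric.
  - by move=> n; exact: measurable_funM.
  - by move=> n x; rewrite mulr_ge0 ?powR_ge0// ltW.
  move=> n; rewrite (intZ _ (ltW (c0 n)) (fun x => powR_ge0 _ _) (mD n)).
  apply: (@le_trans _ _ ((((2^-1 ^+ n) `^ p)^-1)%:E * ((2^-1 ^+ n) `^ p * 2^-1 ^+ n)%:E)).
    by apply: lee_wpmul2l => //; rewrite lee_fin ltW.
  by rewrite -EFinM lee_fin mulrA mulVf ?mul1r// gt_eqF// -invr_gt0.
apply: filterS => x /cvgrPdist_lt /(_ 1%R ltr01)[n0 _ hn0].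
have step n : (n0 <= n)%N -> (`|v n.+1 x - v n x| < 2^-1 ^+ n)%R.
  move=> /hn0 /=; rewrite sub0r normrN ger0_norm; last first.
    by rewrite mulr_ge0 ?powR_ge0// ltW.
  rewrite mulrC ltr_pdivrMr ?mul1r; last by rewrite -invr_gt0.
  move=> h; rewrite ltNge; apply/negP => h'; move: h; rewrite ltNge => /negP; apply.
  by apply: ge0_ler_powR; rewrite ?nnegrE// ?exprn_ge0// ltW.
have : cvgn (series (fun n => v n.+1 x - v n x)%R).
  apply: normed_cvg.
  pose u1 : nat -> R := fun n => (`|v n.+1 x - v n x| * (n < n0)%:R)%R.
  pose u2 : nat -> R := geometric 1%R 2^-1%R.
  have u2E n : u2 n = (2^-1 ^+ n)%R by rewrite /u2 /geometric/= mul1r.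
  apply: (@series_le_cvg _ (fun n => `|v n.+1 x - v n x|)%R (u1 + u2)%R).
  - by move=> n.
  - by move=> n; rewrite addr_ge0 ?mulr_ge0// -/(u2 n) u2E exprn_ge0.
  - move=> n; rewrite -[(_ + _)%R n]/(u1 n + u2 n)%R u2E /u1.
    case: ltnP => nn; first by rewrite mulr1 lerDl exprn_ge0.
    by rewrite mulr0 add0r ltW// step.
  rewrite seriesD; apply: is_cvgD; last first.
    by apply: is_cvg_geometric_series; rewrite ger0_norm//; lra.
  apply: (@is_cvg_near_cst nat _ (\sum_(0 <= i < n0) u1 i)%R).
  near=> n; rewrite /series/= (@big_cat_nat _ _ _ n0)//=; last by near: n; exact: nbhs_infty_ge.
  rewrite [X in (_ + X)%R](_ : _ = 0%R) ?addr0//.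
  rewrite big_nat big1 // => i /andP[ni _].
  by rewrite /u1 ltnNge ni mulr0.
move=> /cvg_ex[l hl]; apply/cvg_ex; exists (l + v 0%N x)%R.
have -> : v ^~ x = (fun n => series (fun n => v n.+1 x - v n x) n + v 0%N x)%R.
  by apply/funext => n; rewrite /series/= telescope_sumr// subrK.
by apply: cvgD => //; exact: cvg_cst.
Unshelve. all: by end_near. Qed.

End fatou_tools.

(** * Norms, measurability and translations in coordinate space *)

Section rV_norm.
Context {R : realType} {N : nat}.
Implicit Types x y : 'rV[R]_N.

Lemma rV_norm_ltP x (e : R) : 0 < e ->
  (`|x| < e) <-> (forall i, `|x ord0 i| < e).
Proof.
move=> e0; rewrite [`|x|]/Num.Def.normr/= mx_normrE; split.
  by move/bigmax_ltP => [_ h] i; exact: (h (ord0, i)).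
by move=> h; apply/bigmax_ltP; split => // -[i j] _ /=; rewrite ord1.
Qed.

Lemma rV_norm_leP x (e : R) : 0 <= e ->
  (`|x| <= e) <-> (forall i, `|x ord0 i| <= e).
Proof.
move=> e0; rewrite [`|x|]/Num.Def.normr/= mx_normrE; split.
  by move/bigmax_leP => [_ h] i; exact: (h (ord0, i)).
by move=> h; apply/bigmax_leP; split => // -[i j] _ /=; rewrite ord1.
Qed.

Lemma rV_coord_le_norm x i : `|x ord0 i| <= `|x|.
Proof. by have /(rV_norm_leP x) := normr_ge0 x => -[+ _]; apply. Qed.

Lemma enorm_ge0 x : 0 <= enorm x.
Proof. exact: sqrtr_ge0. Qed.

Lemma enormN x : enorm (- x) = enorm x.
Proof. by congr Num.sqrt; apply: eq_bigr => i _; rewrite mxE sqrrN. Qed.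

Lemma norm_le_enorm x : `|x| <= enorm x.
Proof.
apply/rV_norm_leP => [|i]; first exact: enorm_ge0.
rewrite -sqrtr_sqr ler_sqrt; last by apply: sumr_ge0 => j _; exact: sqr_ge0.
rewrite (bigD1 i)//= lerDl; apply: sumr_ge0 => j _; exact: sqr_ge0.
Qed.

Lemma enorm_le_norm x : enorm x <= Num.sqrt N%:R * `|x|.
Proof.
rewrite -[X in _ * X]ger0_norm// -sqrtr_sqr -sqrtrM ?ler0n//.
rewrite ler_sqrt; last by rewrite mulr_ge0 ?sqr_ge0.
have -> : N%:R * `|x| ^+ 2 = \sum_(i < N) `|x| ^+ 2.
  by rewrite sumr_const card_ord mulr_natl.
apply: ler_sum => i _; rewrite -[leLHS]real_normK ?num_real//.
by rewrite lerXn2r ?nnegrE// rV_coord_le_norm.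
Qed.

Lemma enorm_gt0 x : x != 0 -> 0 < enorm x.
Proof. by move=> x0; apply: lt_le_trans (norm_le_enorm x); rewrite normr_gt0. Qed.

Lemma enorm0 : enorm (0 : 'rV[R]_N) = 0.
Proof. by apply/eqP; rewrite eq_le enorm_ge0 andbT (le_trans (enorm_le_norm 0))// normr0 mulr0. Qed.

End rV_norm.

Section measurability_rV.
Context {R : realType} {N : nat}.

(** The sigma-algebra is generated by coordinates, so an open set has to be
    written as a countable union of boxes; those with rational data suffice.
    *)
Lemma open_measurable_rV (A : set 'rV[R]_N) : open A -> measurable A.
Proof.
move=> oA.
pose box (qr : {ffun 'I_N -> rat} * rat) : set 'rV[R]_N :=
  [set x | forall i, `|x ord0 i - ratr (qr.1 i)| < ratr qr.2].
have -> : A = \bigcup_(qr in [set qr | box qr `<=` A]) box qr.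
  apply/seteqP; split => [x Ax|x [qr /= qrA]]; last exact: qrA.
  have /nbhs_ballP[e /= e0 eA] : nbhs x A by apply: open_nbhs_nbhs.
  have e42 : e / 4 < e / 2 by lra.
  have [r] := rat_in_itvoo e42; rewrite in_itv/= => /andP[r4 r2].
  have /choice[q qP] i : exists q : rat, `|x ord0 i - ratr q| < ratr r.
    have xr : x ord0 i - ratr r < x ord0 i + ratr r by lra.
    have [q] := rat_in_itvoo xr; rewrite in_itv/= => /andP[k1 k2].
    by exists q; rewrite ltr_norml; apply/andP; split; lra.
  exists ([ffun i => q i], r) => /= [y hy|i]; last by rewrite ffunE.
  apply: eA; split => // i j; rewrite !ord1 /ball/=.
  have := hy j; have := qP j; rewrite /= ffunE => h1 h2.
  rewrite -(subrK (ratr (q j)) (x ord0 j)) -addrA (le_lt_trans (ler_normD _ _))//.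
  by rewrite [X in _ + X]distrC; lra.
rewrite bigcup_mkcond; apply: countable_bigcupT_measurable => // qr.
case: ifPn => // _.
have -> : box qr = \bigcap_(i in [set: 'I_N])
    ((fun v : 'rV[R]_N => v ord0 i : measurableTypeR R) @^-1`
      [set t | `|t - ratr (qr.1 i)| < ratr qr.2]).
  by apply/seteqP; split => [x h i _|x h i]; exact: h.
apply: fin_bigcap_measurable => // i _.
rewrite -[X in measurable X]setTI; apply: measurable_coord => //.
rewrite (_ : mkset _ = `]ratr (qr.1 i) - ratr qr.2, ratr (qr.1 i) + ratr qr.2[%classic)//.
by apply/seteqP; split => t /=; rewrite in_itv/= ltr_norml => /andP[? ?]; apply/andP; split; lra.
Qed.

Lemma continuous_measurable_rV (f : 'rV[R]_N -> R) :
  continuous f -> measurable_fun setT f.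
Proof.
move=> cf; apply: (measurability _ (RGenOInfty.measurableE R)) => _ [_ [a ->] <-].
rewrite setTI; apply: open_measurable_rV.
by apply: open_comp => // x _; exact: cf.
Qed.

Lemma measurable_coordR (i : 'I_N) :
  measurable_fun [set: 'rV[R]_N] (fun v => v ord0 i).
Proof. exact: measurable_coord. Qed.

Lemma measurable_fun_rV_add d (T : measurableType d) (f g : T -> 'rV[R]_N) :
  measurable_fun setT f -> measurable_fun setT g ->
  measurable_fun setT (fun x => f x + g x).
Proof.
move=> mf mg; apply: measurable_fun_coordP => i.
under eq_fun do rewrite mxE.
apply: measurable_funD.
- exact: (measurableT_comp (measurable_coordR i) mf).
- exact: (measurableT_comp (measurable_coordR i) mg).
Qed.

Lemma measurable_fun_rV_sub d (T : measurableType d) (f g : T -> 'rV[R]_N) :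
  measurable_fun setT f -> measurable_fun setT g ->
  measurable_fun setT (fun x => f x - g x).
Proof.
move=> mf mg; apply: measurable_fun_coordP => i.
under eq_fun do rewrite !mxE.
apply: measurable_funB.
- exact: (measurableT_comp (measurable_coordR i) mf).
- exact: (measurableT_comp (measurable_coordR i) mg).
Qed.

Lemma measurable_enorm : measurable_fun [set: 'rV[R]_N] (@enorm R N).
Proof.
rewrite /enorm; apply: (@measurableT_comp _ _ _ _ _ _ (@Num.sqrt R)).
  by apply: continuous_measurable_fun; exact: sqrt_continuous.
apply: measurable_sum => i; apply: measurable_funX; exact: measurable_coordR.
Qed.

Lemma measurable_rV_norm : measurable_fun [set: 'rV[R]_N] (fun x => `|x|).
Proof. by apply: continuous_measurable_rV; exact: norm_continuous. Qed.

End measurability_rV.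

Section translation.
Context {R : realType}.
Local Open Scope ereal_scope.

Lemma lebesgue_translation (a : R) (A : set (measurableTypeR R)) : measurable A ->
  pushforward lebesgue_measure ((fun x => x + a)%R : _ -> measurableTypeR R) A = lebesgue_measure A.
Proof.
have ma : measurable_fun [set: measurableTypeR R] ((fun x => x + a)%R : _ -> measurableTypeR R).
  exact: measurable_funD.
move=> mA; apply/esym.
apply: (@lebesgue_measure_unique R (pushforward lebesgue_measure ((fun x => x + a)%R : _ -> measurableTypeR R))) => //= _ [[b c]] _ <-.
rewrite /pushforward/=.
rewrite (_ : _ @^-1` _ = `](b - a)%R, (c - a)%R]%classic); last first.
  by apply/seteqP; split => t /=; rewrite !in_itv/= => /andP[? ?]; apply/andP; split; lra.
rewrite !lebesgue_measure_itv/= !lte_fin ltrD2r.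
by case: ifP => // _; rewrite -!EFinB; congr (_%:E); ring.
Qed.

Lemma integral_translation1 (a : R) (f : R -> \bar R) :
  measurable_fun [set: R] f -> (forall x, 0 <= f x) ->
  \int[lebesgue_measure]_x f (x + a)%R = \int[lebesgue_measure]_x f x.
Proof.
move=> mf f0.
have ma : measurable_fun [set: measurableTypeR R] ((fun x => x + a)%R : _ -> measurableTypeR R).
  exact: measurable_funD.
transitivity (\int[pushforward lebesgue_measure ((fun x => x + a)%R : measurableTypeR R -> measurableTypeR R)]_x f x).
  by rewrite ge0_integral_pushforward.
by apply: eq_measure_integral => A mA _; exact: lebesgue_translation.
Qed.

(** The measure of dimension [n.+1] is the image of a product measure, so
    integrals can be computed by peeling off the first coordinate. *)
Lemma integral_rV_consE n (f : 'rV[R]_n.+1 -> \bar R) :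
  measurable_fun setT f -> (forall x, 0 <= f x) ->
  \int[lebesgue_rV R n.+1]_x f x =
  \int[lebesgue_measure]_t \int[lebesgue_rV R n]_v f (rV_cons (t, v)).
Proof.
move=> mf f0 /=.
transitivity (\int[(lebesgue_measure \x lebesgue_rV R n)]_z f (rV_cons z)).
  rewrite /cons_measure ge0_integral_pushforward//.
  exact: measurable_rV_cons.
rewrite fubini_tonelli1//.
by apply: measurableT_comp => //; exact: measurable_rV_cons.
Qed.

(** Induction on the dimension, one coordinate at a time. *)
Lemma integral_translation n (a : 'rV[R]_n) (f : 'rV[R]_n -> \bar R) :
  measurable_fun setT f -> (forall x, 0 <= f x) ->
  \int[lebesgue_rV R n]_x f (x + a)%R = \int[lebesgue_rV R n]_x f x.
Proof.
elim: n a f => [|n IH] a f mf f0.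
  by apply: eq_integral => x _; congr f; apply/rowP => -[].
rewrite !integral_rV_consE//; last first.
  apply: measurableT_comp => //; apply: measurable_fun_rV_add => //; exact: measurable_cst.
pose a' : 'rV[R]_n := (\row_j a ord0 (lift ord0 j))%R.
have consD t v : (rV_cons (t, v) + a = rV_cons (t + a ord0 ord0, v + a'))%R.
  apply/rowP => i; rewrite mxE; case: (unliftP ord0 i) => [j|] ->.
    by rewrite !rV_consS/= !mxE.
  by rewrite !rV_cons0.
pose g t := \int[lebesgue_rV R n]_v f (rV_cons (t, v)).
have mfc : measurable_fun setT (fun z => f (@rV_cons R n z)).
  by apply: measurableT_comp => //; exact: measurable_rV_cons.
transitivity (\int[lebesgue_measure]_t g (t + a ord0 ord0)%R).
  apply: eq_integral => t _; rewrite /g.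
  rewrite -(IH a' (fun v => f (rV_cons ((t + a ord0 ord0)%R, v))))//.
    by apply: eq_integral => v _; rewrite consD.
  exact: (measurableT_comp mfc).
rewrite (integral_translation1 _ (f := g))//.
  by apply: (@measurable_fun_fubini_tonelli_F _ _ _ _ _ (lebesgue_rV R n) _ mfc) => z; exact: f0.
by move=> t; exact: integral_ge0.
Qed.

End translation.

(** * Integrability of the truncated kernel *)

Lemma dyadic_bracket_small (R : realType) (t : R) : 0 < t <= 1 ->
  exists j, 2^-1 ^+ j / 2 < t <= 2^-1 ^+ j.
Proof.
move=> /andP[t0 t1].
have ex : exists n, 2^-1 ^+ n / 2 < t.
  exists (Num.bound t^-1); have := @upper_nthrootP R t^-1 _ (leqnn _).
  set m := Num.bound _ => h.
  have h2 : (2^-1 : R) ^+ m < t.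
    by rewrite exprVn -[ltRHS]invrK ltf_pV2 ?posrE ?invr_gt0// exprn_gt0.
  apply: le_lt_trans h2; rewrite ler_pdivrMr// ler_peMr ?exprn_ge0//; lra.
case: (ex_minnP ex) => -[|j] hj hmin; first by exists 0%N; rewrite expr0 in hj *; rewrite hj.
exists j.+1; rewrite hj/= leNgt; apply/negP => h.
suff : (j < j)%N by rewrite ltnn.
by apply: hmin; move: h; rewrite exprS mulrC.
Qed.

Lemma dyadic_bracket_large (R : realType) (t : R) : 1 < t ->
  exists j, 2 ^+ j < t <= 2 * 2 ^+ j.
Proof.
move=> t1; have ex : exists n, t <= 2 ^+ n.
  by exists (Num.bound t); exact/ltW/upper_nthrootP.
case: (ex_minnP ex) => -[|j] hj hmin; first by move: hj; rewrite expr0 leNgt t1.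
exists j; rewrite -exprS hj andbT ltNge; apply/negP => h.
suff : (j < j)%N by rewrite ltnn.
exact: hmin.
Qed.

Lemma nneseries_geometric_lty (R : realType) (c q : R) : 0 <= c -> 0 <= q < 1 ->
  (\sum_(n <oo) (c * q ^+ n)%:E < +oo)%E.
Proof.
move=> c0 /andP[q0 q1]; apply: (@le_lt_trans _ _ (c / (1 - q))%:E); last exact: ltry.
apply: lime_le.
  by apply: is_cvg_nneseries => n _ _; rewrite lee_fin mulr_ge0// exprn_ge0.
near=> n; rewrite big_mkord sumEFin lee_fin -mulr_sumr; apply: ler_wpM2l => //.
rewrite -(ler_pM2r (_ : 0 < 1 - q)) ?subr_gt0// mulVf ?subr_eq0 ?gt_eqF//.
suff -> : (\sum_(i < n) q ^+ i) * (1 - q) = 1 - q ^+ n.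
  by rewrite gerBl exprn_ge0.
elim: (n) => [|m ih]; first by rewrite big_ord0 expr0 mul0r subrr.
by rewrite big_ord_recr/= mulrDl ih exprSr; ring.
Unshelve. all: by end_near. Qed.

Lemma powR_exprn (R : realType) (x a : R) n : 0 <= x -> (x ^+ n) `^ a = (x `^ a) ^+ n.
Proof.
by move=> x0; rewrite -[x ^+ n]powR_mulrn// powRAC powR_mulrn ?powR_ge0.
Qed.

Lemma powR2N_lt1 (R : realType) (a : R) : 0 < a -> 2 `^ (- a) < 1.
Proof.
move=> a0; rewrite powRN invf_lt1 ?powR_gt0//.
apply: (@le_lt_trans _ _ (1 `^ a)); first by rewrite powR1.
apply: gt0_ltr_powR; rewrite ?nnegrE//; lra.
Qed.

Section kernel.
Context {R : realType} {N : nat}.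
Local Notation mu := (lebesgue_rV R N).
Implicit Types (x y z : 'rV[R]_N) (p sigma r : R).

Definition cube r : set 'rV[R]_N := [set x | `|x| <= r].

Lemma measurable_cube r : measurable (cube r).
Proof.
rewrite (_ : cube r = [set: 'rV[R]_N] `&` (fun x => `|x|) @^-1` `]-oo, r]%classic).
  exact: measurable_rV_norm.
by apply/seteqP; split => x /=; rewrite in_itv/=; [split|move=> []].
Qed.

Lemma measure_cube r : 0 <= r ->
  (mu : {measure set _ -> \bar R}) (cube r) = ((2 * r) ^+ N)%:E.
Proof.
move=> r0.
have -> : cube r = [set v | forall i : 'I_N, (- r) <= v ord0 i <= r].
  apply/seteqP; split => [x /(rV_norm_leP _ r0) h i|x h]; first by rewrite -ler_norml.
  by apply/rV_norm_leP => // i; rewrite ler_norml.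
have rr : forall i : 'I_N, (fun=> - r) i <= (fun=> r) i by move=> i; lra.
apply: (eq_trans (lebesgue_rV_box rr)).
by rewrite prodr_const card_ord; congr ((_ ^+ _)%:E); ring.
Qed.

Lemma bounded_set_cube (A : set 'rV[R]_N) : bounded_set A ->
  exists r, 0 < r /\ A `<=` cube r.
Proof.
move=> [M [Mr AM]]; exists (Num.max 1 (M + 1)); split.
  by rewrite lt_max ltr01.
by move=> x Ax; apply: AM => //; rewrite lt_max; apply/orP; right; lra.
Qed.

Lemma cube_measure_lty r : ((mu : {measure set _ -> \bar R}) (cube r) < +oo)%E.
Proof.
have [r0|r0] := leP 0 r; first by rewrite measure_cube// ltry.
rewrite (_ : cube r = set0) ?measure0//.
by apply/seteqP; split => x //= h; have := le_lt_trans h r0; rewrite ltNge normr_ge0.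
Qed.

(** The tail weight of the energy: the Lipschitz bound [min 1 |z|^p] of the
    increments of a cutoff, divided by the singular denominator. *)
Definition kern sigma p z : R :=
  Num.min 1 (enorm z `^ p) / enorm z `^ (N%:R + sigma * p).

Lemma kern_ge0 sigma p z : 0 <= kern sigma p z.
Proof. by rewrite /kern divr_ge0 ?powR_ge0// le_min ler01 powR_ge0. Qed.

Lemma kernN sigma p z : kern sigma p (- z) = kern sigma p z.
Proof. by rewrite /kern enormN. Qed.

Lemma measurable_kern sigma p : measurable_fun setT (kern sigma p).
Proof.
apply: measurable_funM.
  apply: measurable_minr => //.
  exact: (measurableT_comp (measurable_powR _) measurable_enorm).
under eq_fun do rewrite -powRN.
exact: (measurableT_comp (measurable_powR _) measurable_enorm).
Qed.

(** The integral is compared with a sum over dyadic shells. Near the origin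
    the integrand on the shell of radius [2^-j] contributes [2^-(j p (1 -
    sigma))], at infinity the shell of radius [2^j] contributes [2^-(j sigma
    p)]: two convergent geometric series, which is where [0 < sigma < 1]
    enters. *)
Lemma integral_kern_lty sigma p : 0 < sigma < 1 -> 0 < p ->
  (\int[mu]_z (kern sigma p z)%:E < +oo)%E.
Proof.
move=> /andP[s0 s1] p0.
have sp0 : 0 < sigma * p by rewrite mulr_gt0.
have spp : 0 < p - sigma * p by rewrite subr_gt0 gtr_pMl.
have a0 : 0 <= N%:R + sigma * p by rewrite addr_ge0 ?ler0n// ltW.
set a := N%:R + sigma * p in a0 *.
have a1 : 0 < a by rewrite /a ltr_wpDl ?ler0n.
pose r j : R := 2^-1 ^+ j. pose b j : R := 2 ^+ j.
have r0 j : 0 < r j by exact: exprn_gt0.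
have b0 j : 0 < b j by exact: exprn_gt0.
pose alpha j : R := (Num.sqrt N%:R * r j) `^ p / (r j / 2) `^ a.
pose beta j : R := (b j `^ a)^-1.
have alpha0 j : 0 <= alpha j by rewrite divr_ge0 ?powR_ge0.
have beta0 j : 0 <= beta j by rewrite invr_ge0 powR_ge0.
pose f j z : R := alpha j * \1_(cube (r j)) z + beta j * \1_(cube (2 * b j)) z.
have mf1 j : measurable_fun setT (fun z => alpha j * \1_(cube (r j)) z : R).
  apply: measurable_funM => //; apply: measurable_indic; exact: measurable_cube.
have mf2 j : measurable_fun setT (fun z => beta j * \1_(cube (2 * b j)) z : R).
  apply: measurable_funM => //; apply: measurable_indic; exact: measurable_cube.
have mf j : measurable_fun setT (f j) by exact: measurable_funD.
have f10 j z : 0 <= alpha j * \1_(cube (r j)) z by rewrite mulr_ge0.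
have f20 j z : 0 <= beta j * \1_(cube (2 * b j)) z by rewrite mulr_ge0.
have f0 j z : 0 <= f j z by rewrite addr_ge0.
have kf z : exists j, kern sigma p z <= f j z.
  have [->|z0] := eqVneq z 0.
    exists 0%N; rewrite /kern enorm0 -/a [X in _ / X]powR0 ?gt_eqF//.
    by rewrite invr0 mulr0.
  have nz0 : 0 < `|z| by rewrite normr_gt0.
  have ez := norm_le_enorm z.
  have [z1|z1] := leP `|z| 1.
    have [j /andP[h1 h2]] : exists j, r j / 2 < `|z| <= r j.
      by apply: dyadic_bracket_small; rewrite nz0.
    exists j; rewrite /f [X in alpha j * X]indicE mem_set//= mulr1.
    apply: (@le_trans _ _ (alpha j)); last by rewrite lerDl.
    apply: ler_pM; rewrite ?invr_ge0 ?powR_ge0 ?le_min ?ler01 ?powR_ge0//=.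
      rewrite ge_min; apply/orP; right; apply: ge0_ler_powR; rewrite ?nnegrE ?enorm_ge0//.
      - exact: ltW.
      - by rewrite mulr_ge0 ?sqrtr_ge0// ltW.
      by apply: (le_trans (enorm_le_norm z)); exact: ler_wpM2l.
    rewrite lef_pV2 ?posrE ?powR_gt0 ?divr_gt0 ?enorm_gt0//.
    apply: ge0_ler_powR; rewrite ?nnegrE ?enorm_ge0 ?divr_ge0 ?(ltW (r0 j))//.
    by apply: ltW; apply: lt_le_trans h1 _.
  have [j /andP[h1 h2]] := dyadic_bracket_large z1.
  exists j; rewrite /f [X in beta j * X]indicE mem_set//= mulr1.
  apply: (@le_trans _ _ (beta j)); last by rewrite lerDr.
  rewrite -[leRHS]mul1r; apply: ler_pM; rewrite ?invr_ge0 ?powR_ge0 ?le_min ?ler01 ?powR_ge0//=.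
  rewrite lef_pV2 ?posrE ?powR_gt0 ?enorm_gt0//.
  apply: ge0_ler_powR; rewrite ?nnegrE ?enorm_ge0 ?(ltW (b0 j))//.
  by apply: ltW; apply: lt_le_trans h1 _.
have intf j : (\int[mu]_z (f j z)%:E =
    (alpha j * (2 * r j) ^+ N + beta j * (2 * (2 * b j)) ^+ N)%:E)%E.
  rewrite /f (intD _ (f10 j) (f20 j))// !intZ//; last 2 first.
  - apply: measurable_indic; exact: measurable_cube.
  - apply: measurable_indic; exact: measurable_cube.
  rewrite !integral_indic ?setIT//; [|exact: measurable_cube..].
  by rewrite !measure_cube ?mulr_ge0 ?(ltW (r0 j)) ?(ltW (b0 j)).
pose c1 : R := Num.sqrt N%:R `^ p * 2 `^ a * 2 ^+ N.
pose q1 : R := 2^-1 `^ (p - sigma * p).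
pose c2 : R := 4 ^+ N. pose q2 : R := 2 `^ (- (sigma * p)).
have h2 : (2^-1 : R) = 2 `^ (-1) by rewrite powR_inv1.
have E1 j : alpha j * (2 * r j) ^+ N = c1 * q1 ^+ j.
  rewrite /alpha /q1 /c1 -powR_exprn// -/(r j).
  rewrite (powRM p (sqrtr_ge0 _) (ltW (r0 j))) (powRM a (ltW (r0 j)))//.
  rewrite (@powRB _ (r j) p); last by rewrite (gt_eqF (r0 j)) implybT.
  rewrite (@powRD _ (r j) N%:R); last by rewrite (gt_eqF (r0 j)) implybT.
  rewrite [X in X `^ a]h2 -powRrM mulN1r powRN powR_mulrn ?(ltW (r0 j))// exprMn.
  have := exprn_gt0 N (r0 j); have := powR_gt0 (sigma * p) (r0 j).
  have : 0 < (2:R) `^ a by rewrite powR_gt0.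
  move=> /lt0r_neq0 ? /lt0r_neq0 ? /lt0r_neq0 ?; field.
  by do ?[apply/andP; split].
have E2 j : beta j * (2 * (2 * b j)) ^+ N = c2 * q2 ^+ j.
  rewrite /beta /q2 /c2 -powR_exprn// -/(b j) powRN.
  rewrite (@powRD _ (b j) N%:R); last by rewrite (gt_eqF (b0 j)) implybT.
  rewrite powR_mulrn ?(ltW (b0 j))// mulrA exprMn.
  have -> : (2 * 2 : R) = 4 by ring.
  have := exprn_gt0 N (b0 j); have := powR_gt0 (sigma * p) (b0 j).
  move=> /lt0r_neq0 ? /lt0r_neq0 ?; field.
  by do ?[apply/andP; split].
apply: (@le_lt_trans _ _ (\int[mu]_z (\sum_(j <oo) (f j z)%:E))%E).
  apply: ge0_le_integral => //.
  - by move=> z _; rewrite lee_fin kern_ge0.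
  - apply/measurable_EFinP; exact: measurable_kern.
  - apply: ge0_emeasurable_sum => [j z _ _|j _]; rewrite ?lee_fin//.
    exact/measurable_EFinP.
  move=> z _; have [j hj] := kf z.
  apply: (@le_trans _ _ (f j z)%:E); first by rewrite lee_fin.
  apply: (@le_trans _ _ (\sum_(0 <= i < j.+1) (f i z)%:E)%E).
    rewrite big_nat_recr//= leeDr//; apply: sume_ge0 => i _; by rewrite lee_fin.
  by apply: nneseries_lim_ge => i _ _; rewrite lee_fin.
rewrite integral_nneseries//; last 2 first.
- by move=> j; exact/measurable_EFinP.
- by move=> j z _; rewrite lee_fin.
have c10 : 0 <= c1 by rewrite !mulr_ge0 ?powR_ge0// exprn_ge0.
have c20 : 0 <= c2 by rewrite exprn_ge0.
under eq_eseriesr do rewrite intf E1 E2 EFinD.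
rewrite nneseriesD; last 2 first.
- by move=> j _ _; rewrite lee_fin mulr_ge0// exprn_ge0// powR_ge0.
- by move=> j _ _; rewrite lee_fin mulr_ge0// exprn_ge0// powR_ge0.
apply: lte_add_pinfty; apply: nneseries_geometric_lty => //.
  by rewrite /q1 powR_ge0/= h2 -powRrM mulN1r powR2N_lt1.
by rewrite /q2 powR_ge0/= powR2N_lt1.
Qed.

End kernel.

(** * The energy as an integral over the product space *)

Section product_rV.
Context {R : realType} {N : nat}.
Local Notation mu := (lebesgue_rV R N).
Local Notation mm := (lebesgue_rV R N \x lebesgue_rV R N)%E.
Local Notation V := 'rV[R]_N.

(** A null set of first coordinates gives a null strip in the product. *)
Lemma ae_fst (P : V -> Prop) : {ae mu, forall x, P x} -> {ae mm, forall z, P z.1}.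
Proof.
move=> [A [mA A0 hA]]; exists (A `*` setT); split.
- exact: measurableX.
- apply: (eq_trans (product_measure1E _ _ mA measurableT)).
  by rewrite [X in (X * _)%E]A0 mul0e.
- by move=> z /= hz; split => //; exact: hA.
Qed.

Lemma ae_snd (P : V -> Prop) : {ae mu, forall x, P x} -> {ae mm, forall z, P z.2}.
Proof.
move=> [A [mA A0 hA]]; exists (setT `*` A); split.
- exact: measurableX.
- apply: (eq_trans (product_measure1E _ _ measurableT mA)).
  by rewrite [X in (_ * X)%E]A0 mule0.
- by move=> z /= hz; split => //; exact: hA.
Qed.

Lemma measurable_fst_comp d (T : measurableType d) (f : V -> T) :
  measurable_fun setT f -> measurable_fun setT (fun z : V * V => f z.1).
Proof. by move=> mf; exact: (measurableT_comp mf measurable_fst). Qed.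

Lemma measurable_snd_comp d (T : measurableType d) (f : V -> T) :
  measurable_fun setT f -> measurable_fun setT (fun z : V * V => f z.2).
Proof. by move=> mf; exact: (measurableT_comp mf measurable_snd). Qed.

Lemma measurable_diff_comp d (T : measurableType d) (f : V -> T) :
  measurable_fun setT f -> measurable_fun setT (fun z : V * V => f (z.1 - z.2)).
Proof.
move=> mf; apply: (measurableT_comp mf); apply: measurable_fun_rV_sub.
  exact: measurable_fst.
exact: measurable_snd.
Qed.

Lemma measurable_shift d (T : measurableType d) (f : V -> T) (a : V) :
  measurable_fun setT f -> measurable_fun setT (fun x : V => f (x + a)).
Proof.
move=> mf; apply: (measurableT_comp mf); apply: measurable_fun_rV_add => //.
Qed.

Lemma integral_shift (a : V) (f : V -> R) : measurable_fun setT f ->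
  (forall x, 0 <= f x) ->
  (\int[mu]_x (f (x + a))%:E = \int[mu]_x (f x)%:E)%E.
Proof.
move=> mf f0; apply: (integral_translation a (f := fun x => (f x)%:E)).
  exact/measurable_EFinP.
by move=> x; rewrite lee_fin.
Qed.

(** By translation invariance the inner integral does not depend on the outer
    variable, so a product of [f x] and [k (x - y)] integrates to the product
    of the two integrals. *)
Lemma integral_prod_kernel_fst (f k : V -> R) :
  measurable_fun setT f -> measurable_fun setT k ->
  (forall x, 0 <= f x) -> (forall x, 0 <= k x) -> (forall x, k (- x) = k x) ->
  (\int[mm]_z (f z.1 * k (z.1 - z.2))%:E =
   (\int[mu]_x (f x)%:E) * (\int[mu]_x (k x)%:E))%E.
Proof.
move=> mf mk f0 k0 kN; rewrite fubini_tonelli1//=; last 2 first.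
- apply/measurable_EFinP; apply: measurable_funM.
    exact: measurable_fst_comp.
  exact: measurable_diff_comp.
- by move=> z; rewrite lee_fin mulr_ge0.
rewrite /fubini_F/=.
transitivity (\int[mu]_x ((f x)%:E * \int[mu]_x (k x)%:E))%E; last first.
  rewrite ge0_integralZr//.
  - exact/measurable_EFinP.
  - by move=> x _; rewrite lee_fin.
  - by apply: integral_ge0 => x _; rewrite lee_fin.
apply: eq_integral => x _.
rewrite (@intZ _ _ _ mu (f x) (fun y : V => k (x - y)))//; last first.
  by under eq_fun do rewrite -kN opprB; exact: measurable_shift.
congr (_ * _)%E; rewrite -(integral_shift (- x) mk k0).
by apply: eq_integral => y _; rewrite -kN opprB.
Qed.

Lemma integral_prod_kernel_snd (f k : V -> R) :
  measurable_fun setT f -> measurable_fun setT k ->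
  (forall x, 0 <= f x) -> (forall x, 0 <= k x) ->
  (\int[mm]_z (f z.2 * k (z.1 - z.2))%:E =
   (\int[mu]_x (f x)%:E) * (\int[mu]_x (k x)%:E))%E.
Proof.
move=> mf mk f0 k0; rewrite fubini_tonelli2//=; last 2 first.
- apply/measurable_EFinP; apply: measurable_funM.
    exact: measurable_snd_comp.
  exact: measurable_diff_comp.
- by move=> z; rewrite lee_fin mulr_ge0.
rewrite /fubini_G/=.
transitivity (\int[mu]_x ((f x)%:E * \int[mu]_x (k x)%:E))%E; last first.
  rewrite ge0_integralZr//.
  - exact/measurable_EFinP.
  - by move=> x _; rewrite lee_fin.
  - by apply: integral_ge0 => x _; rewrite lee_fin.
apply: eq_integral => x _.
rewrite (@intZ _ _ _ mu (f x) (fun y : V => k (y - x)))//; last exact: measurable_shift.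
by rewrite (integral_shift (- x) mk k0).
Qed.

End product_rV.

Section energy.
Context {R : realType} {N : nat}.
Local Notation mu := (lebesgue_rV R N).
Local Notation mm := (lebesgue_rV R N \x lebesgue_rV R N)%E.
Local Notation V := 'rV[R]_N.
Implicit Types (p sigma : R) (u v w : V -> R) (z : V * V).

(** The integrand of the energy, as a function on the product space. On that
    space the energy is a single integral, to which the convergence theorems
    apply. *)
Definition gkern sigma p u z : R :=
  `|u z.1 - u z.2| `^ p / enorm (z.1 - z.2) `^ (N%:R + sigma * p).

Definition power_int p u : \bar R := (\int[mu]_x (`|u x| `^ p)%:E)%E.

Lemma gkern_ge0 sigma p u z : 0 <= gkern sigma p u z.
Proof. by rewrite divr_ge0 ?powR_ge0. Qed.

Lemma measurable_norm_powR d (T : measurableType d) p (f : T -> R) :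
  measurable_fun setT f -> measurable_fun setT (fun x => `|f x| `^ p).
Proof.
move=> mf; apply: (measurableT_comp (measurable_powR _)).
exact: measurableT_comp.
Qed.

Lemma measurable_gkern sigma p u : measurable_fun setT u ->
  measurable_fun setT (gkern sigma p u).
Proof.
move=> mf; apply: measurable_funM.
  apply: measurable_norm_powR; apply: measurable_funB.
    exact: measurable_fst_comp.
  exact: measurable_snd_comp.
under eq_fun do rewrite -powRN.
apply: (measurableT_comp (measurable_powR _)).
exact: (measurable_diff_comp measurable_enorm).
Qed.

Lemma gagliardo_energyE sigma p u : measurable_fun setT u ->
  (gagliardo_energy sigma p u = \int[mm]_z (gkern sigma p u z)%:E)%E.
Proof.
move=> mf; rewrite fubini_tonelli1//.
- apply/measurable_EFinP; exact: measurable_gkern.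
- by move=> z; rewrite lee_fin gkern_ge0.
Qed.

Lemma gagliardo_energy_ge0 sigma p u : (0 <= gagliardo_energy sigma p u)%E.
Proof.
apply: integral_ge0 => x _; apply: integral_ge0 => y _.
by rewrite lee_fin divr_ge0 ?powR_ge0.
Qed.

Lemma power_int_ge0 p u : (0 <= power_int p u)%E.
Proof. by apply: int_ge0 => x; exact: powR_ge0. Qed.

Lemma gkern_diag sigma p u z : 0 < p -> z.1 = z.2 -> gkern sigma p u z = 0.
Proof. by move=> p0 h; rewrite /gkern h subrr normr0 powR0 ?mul0r// gt_eqF. Qed.

Lemma gkernD_le sigma p u v z : 0 <= p ->
  gkern sigma p (u \+ v) z <= 2 `^ p * (gkern sigma p u z + gkern sigma p v z).
Proof.
move=> p0; rewrite /gkern -mulrDl mulrA; apply: ler_wpM2r.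
  by rewrite invr_ge0 powR_ge0.
rewrite /= (_ : u z.1 + v z.1 - _ = (u z.1 - u z.2) + (v z.1 - v z.2)); last by ring.
exact: powR_normD_le.
Qed.

Lemma gkernB_le sigma p u v z : 0 <= p ->
  gkern sigma p (u \- v) z <= 2 `^ p * (gkern sigma p u z + gkern sigma p v z).
Proof.
move=> p0; rewrite /gkern -mulrDl mulrA; apply: ler_wpM2r.
  by rewrite invr_ge0 powR_ge0.
rewrite /= (_ : u z.1 - v z.1 - _ = (u z.1 - u z.2) - (v z.1 - v z.2)); last by ring.
exact: powR_normB_le.
Qed.

(** Upper bounds on energies are all proved pointwise on the integrand. *)
Lemma energy_le_of_gkern sigma p u (f : V * V -> R) : measurable_fun setT u ->
  measurable_fun setT f -> (forall z, gkern sigma p u z <= f z) ->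
  (gagliardo_energy sigma p u <= \int[mm]_z (f z)%:E)%E.
Proof.
move=> mu_ mf h; rewrite gagliardo_energyE//.
apply: int_le => //; [exact: gkern_ge0|exact: measurable_gkern].
Qed.

Lemma gagliardo_energyD_le sigma p u v : 0 <= p ->
  measurable_fun setT u -> measurable_fun setT v ->
  (gagliardo_energy sigma p (u \+ v)%R <=
   (2 `^ p)%:E * (gagliardo_energy sigma p u + gagliardo_energy sigma p v))%E.
Proof.
move=> p0 mf mg; have mku := measurable_gkern sigma p mf.
have mkv := measurable_gkern sigma p mg.
apply: (le_trans (energy_le_of_gkern _ _ (fun z => gkernD_le sigma u v z p0))).
- exact: measurable_funD.
- by apply: measurable_funM => //; exact: measurable_funD.
rewrite intZ ?powR_ge0//; last 2 first.
- by move=> z; rewrite addr_ge0 ?gkern_ge0.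
- exact: measurable_funD.
by rewrite (intD _ (gkern_ge0 _ _ _) (gkern_ge0 _ _ _))// -!gagliardo_energyE.
Qed.

Lemma gagliardo_energyN sigma p u :
  gagliardo_energy sigma p (fun x => - u x) = gagliardo_energy sigma p u.
Proof.
apply: eq_integral => x _; apply: eq_integral => y _.
by rewrite -opprD normrN.
Qed.

Lemma gagliardo_energyB_le sigma p u v : 0 <= p ->
  measurable_fun setT u -> measurable_fun setT v ->
  (gagliardo_energy sigma p (u \- v)%R <=
   (2 `^ p)%:E * (gagliardo_energy sigma p u + gagliardo_energy sigma p v))%E.
Proof.
move=> p0 mf mg; rewrite -(gagliardo_energyN _ _ v).
by apply: gagliardo_energyD_le => //; exact: measurableT_comp.
Qed.

Lemma power_intD_le p u v : 0 <= p ->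
  measurable_fun setT u -> measurable_fun setT v ->
  (power_int p (u \+ v)%R <= (2 `^ p)%:E * (power_int p u + power_int p v))%E.
Proof.
move=> p0 mf mg.
have mu' := measurable_norm_powR p mf; have mv' := measurable_norm_powR p mg.
rewrite /power_int -(intD _ (fun=> powR_ge0 _ _) (fun=> powR_ge0 _ _))//.
rewrite -(intZ _ (powR_ge0 _ _) (f := fun x => `|u x| `^ p + `|v x| `^ p)); first last.
- exact: measurable_funD.
- by move=> x; rewrite addr_ge0 ?powR_ge0.
apply: int_le.
- by move=> x; rewrite powR_ge0.
- by apply: measurable_norm_powR; exact: measurable_funD.
- by apply: measurable_funM => //; exact: measurable_funD.
- by move=> x; exact: powR_normD_le.
Qed.

Lemma power_intN p u : power_int p (fun x => - u x) = power_int p u.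
Proof. by apply: eq_integral => x _; rewrite normrN. Qed.

Lemma power_intB_le p u v : 0 <= p ->
  measurable_fun setT u -> measurable_fun setT v ->
  (power_int p (u \- v)%R <= (2 `^ p)%:E * (power_int p u + power_int p v))%E.
Proof.
move=> p0 mf mg; rewrite -(power_intN _ v).
by apply: power_intD_le => //; exact: measurableT_comp.
Qed.

Definition kern_mass sigma p : \bar R := (\int[mu]_z (kern sigma p z)%:E)%E.

Lemma int_two_sided_kern sigma p (f : V -> R) : measurable_fun setT f ->
  (forall x, 0 <= f x) ->
  (\int[mm]_z ((f z.1 + f z.2) * kern sigma p (z.1 - z.2))%:E =
   2%:E * (\int[mu]_x (f x)%:E * kern_mass sigma p))%E.
Proof.
move=> mf f0.
have mk := @measurable_kern R N sigma p; have k0 := @kern_ge0 R N sigma p.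
have mk' := measurable_diff_comp mk.
under eq_integral do rewrite mulrDl.
rewrite intD//.
- rewrite (integral_prod_kernel_fst mf mk f0 k0 (kernN sigma p)).
  rewrite (integral_prod_kernel_snd mf mk f0 k0).
  rewrite -/(kern_mass sigma p); set X := (_ * kern_mass sigma p)%E.
  have -> : (2%:E = 1%:E + 1%:E :> \bar R)%E by rewrite -EFinD; congr EFin; ring.
  by rewrite (@ge0_muleDl _ X 1%:E 1%:E) ?lee_fin// !mul1e.
- by move=> z; rewrite mulr_ge0.
- by move=> z; rewrite mulr_ge0.
- by apply: measurable_funM => //; exact: measurable_fst_comp.
- by apply: measurable_funM => //; exact: measurable_snd_comp.
Qed.

(** Away from the origin the singular denominator is controlled by the
    integrable kernel; this handles the long-range part of the energy. *)
Lemma kern_far sigma p (d : R) (x : V) : 0 < d -> 0 < p -> d < enorm x ->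
  (enorm x `^ (N%:R + sigma * p))^-1 <= (Num.min 1 (d `^ p))^-1 * kern sigma p x.
Proof.
move=> d0 p0 dx; rewrite /kern mulrA -[leLHS]mul1r; apply: ler_wpM2r.
  by rewrite invr_ge0 powR_ge0.
rewrite mulrC ler_pdivlMr ?mul1r ?lt_min ?ltr01 ?powR_gt0//.
rewrite le_min ge_min lexx/= ge_min; apply/orP; right.
by apply: ge0_ler_powR; rewrite ?nnegrE ?(ltW d0) ?(ltW p0) ?(ltW dx) ?enorm_ge0.
Qed.

(** On [|x - y| <= d] a smaller exponent only gains the factor [d^((k - sigma)
    p)]; on the rest the increment is bounded by the values, and the kernel is
    integrable. *)
Lemma gkern_split sigma k p (d : R) w z : 0 < p -> 0 < d -> 0 < sigma <= k ->
  gkern sigma p w z <= d `^ ((k - sigma) * p) * gkern k p w z +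
   2 `^ p / Num.min 1 (d `^ p) *
    ((`|w z.1| `^ p + `|w z.2| `^ p) * kern sigma p (z.1 - z.2)).
Proof.
move=> p0 d0 /andP[s0 sk].
have m0 : 0 < Num.min 1 (d `^ p) by rewrite lt_min ltr01 powR_gt0.
have T0 : 0 <= 2 `^ p / Num.min 1 (d `^ p) *
    ((`|w z.1| `^ p + `|w z.2| `^ p) * kern sigma p (z.1 - z.2)).
  apply: mulr_ge0; first by rewrite divr_ge0 ?powR_ge0 ?ltW.
  by rewrite mulr_ge0 ?kern_ge0 ?addr_ge0 ?powR_ge0.
have [zz|zz] := eqVneq z.1 z.2.
  by rewrite !gkern_diag// mulr0 add0r.
have e0 : 0 < enorm (z.1 - z.2) by rewrite enorm_gt0// subr_eq0.
have [ed|ed] := leP (enorm (z.1 - z.2)) d.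
  apply: (@le_trans _ _ (d `^ ((k - sigma) * p) * gkern k p w z)); last by rewrite lerDl.
  rewrite /gkern mulrCA; apply: ler_wpM2l; first exact: powR_ge0.
  rewrite (_ : N%:R + k * p = (k - sigma) * p + (N%:R + sigma * p)); last by ring.
  rewrite (@powRD _ _ ((k - sigma) * p)) ?(gt_eqF e0) ?implybT//.
  rewrite invfM mulrA -[leLHS]mul1r; apply: ler_wpM2r.
    by rewrite invr_ge0 powR_ge0.
  rewrite ler_pdivlMr ?mul1r ?powR_gt0//.
  apply: ge0_ler_powR; rewrite ?nnegrE ?enorm_ge0 ?(ltW d0)//.
  by rewrite mulr_ge0 ?subr_ge0 ?(ltW p0).
apply: (@le_trans _ _ (2 `^ p / Num.min 1 (d `^ p) *
    ((`|w z.1| `^ p + `|w z.2| `^ p) * kern sigma p (z.1 - z.2)))); last first.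
  by rewrite lerDr mulr_ge0 ?powR_ge0 ?gkern_ge0.
rewrite mulrACA /gkern; apply: ler_pM; rewrite ?invr_ge0 ?powR_ge0//.
  by apply: powR_normB_le; exact: ltW.
exact: kern_far.
Qed.

(** The interpolation inequality between exponents. Taking [d] small makes the
    first term small, at the price of a large multiple of the L^p norm; this
    is what yields strong convergence at every lower exponent. *)
Lemma energy_split sigma k p (d : R) w : 0 < p -> 0 < d -> 0 < sigma <= k ->
  measurable_fun setT w ->
  (gagliardo_energy sigma p w <=
    (d `^ ((k - sigma) * p))%:E * gagliardo_energy k p w +
    (2 `^ p / Num.min 1 (d `^ p))%:E *
      (2%:E * (power_int p w * kern_mass sigma p)))%E.
Proof.
move=> p0 d0 sk mw.
have m0 : 0 < Num.min 1 (d `^ p) by rewrite lt_min ltr01 powR_gt0.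
have mwp := measurable_norm_powR p mw.
have mk := measurable_diff_comp (@measurable_kern R N sigma p).
have msum : measurable_fun setT (fun z : V * V =>
   (`|w z.1| `^ p + `|w z.2| `^ p) * kern sigma p (z.1 - z.2)).
  apply: measurable_funM => //; apply: measurable_funD.
    exact: (measurable_fst_comp mwp).
  exact: (measurable_snd_comp mwp).
have mg := measurable_gkern k p mw.
apply: (le_trans (energy_le_of_gkern _ _ (fun z => gkern_split w z p0 d0 sk))) => //.
  apply: measurable_funD; exact: measurable_funM.
rewrite intD//.
- rewrite intZ ?powR_ge0//; last exact: gkern_ge0.
  rewrite intZ//; last 2 first.
  + by rewrite divr_ge0 ?powR_ge0 ?ltW.
  + by move=> z; rewrite mulr_ge0 ?kern_ge0 ?addr_ge0 ?powR_ge0.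
  rewrite (int_two_sided_kern _ _ mwp); last by move=> x; exact: powR_ge0.
  by rewrite -gagliardo_energyE.
- by move=> z; rewrite mulr_ge0 ?powR_ge0 ?gkern_ge0.
- move=> z; apply: mulr_ge0; first by rewrite divr_ge0 ?powR_ge0 ?ltW.
  by rewrite mulr_ge0 ?kern_ge0 ?addr_ge0 ?powR_ge0.
- exact: measurable_funM.
- exact: measurable_funM.
Qed.

End energy.

(** * Limits of energies, the Poincare inequality and cutoffs *)

Lemma powRe_continuous (R : realType) (a : R) : 0 < a ->
  continuous (fun t : R => a `^ t).
Proof.
move=> a0 t.
have -> : (fun t : R => a `^ t) = @expR R \o (fun t => t * ln a).
  by apply/funext => x; rewrite /= /powR gt_eqF.
apply: continuous_comp; last exact: continuous_expR.
by apply: cvgM; [exact: cvg_id|exact: cvg_cst].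
Qed.

Lemma ge0_lty_EFin (R : realType) (x : \bar R) : (0 <= x)%E -> (x < +oo)%E ->
  exists r : R, 0 <= r /\ x = r%:E.
Proof.
case: x => [r|//|//]; rewrite lee_fin => r0 _; by exists r.
Qed.

Section energy_limits.
Context {R : realType} {N : nat}.
Local Notation mu := (lebesgue_rV R N).
Local Notation mm := (lebesgue_rV R N \x lebesgue_rV R N)%E.
Local Notation V := 'rV[R]_N.
Implicit Types (p sigma : R) (u v w : V -> R) (z : V * V).

(** Both the values of the function and the exponent of the denominator may
    vary. The diagonal is harmless, since the integrand vanishes there. *)
Lemma gkern_cvg p (sg : nat -> R) sigma (u_ : nat -> V -> R) u z : 0 < p ->
  sg @ \oo --> sigma -> u_ n z.1 @[n --> \oo] --> u z.1 ->
  u_ n z.2 @[n --> \oo] --> u z.2 ->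
  gkern (sg n) p (u_ n) z @[n --> \oo] --> gkern sigma p u z.
Proof.
move=> p0 sgc u1 u2; have [zz|zz] := eqVneq z.1 z.2.
  rewrite gkern_diag//; under eq_fun do rewrite gkern_diag//.
  exact: cvg_cst.
have e0 : 0 < enorm (z.1 - z.2) by rewrite enorm_gt0// subr_eq0.
apply: cvgM; first by apply: cvg_norm_powR => //; exact: cvgB.
apply: cvgV; first by rewrite gt_eqF// powR_gt0.
apply: (@cvg_comp _ _ _ (fun n => N%:R + sg n * p) (fun t => enorm (z.1 - z.2) `^ t) _ (nbhs (N%:R + sigma * p))).
  by apply: cvgD; [exact: cvg_cst|apply: cvgM => //; exact: cvg_cst].
exact: powRe_continuous.
Qed.

Lemma ae_gkern_cvg p (sg : nat -> R) sigma (u_ : nat -> V -> R) u : 0 < p ->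
  sg @ \oo --> sigma -> {ae mu, forall x, u_ n x @[n --> \oo] --> u x} ->
  {ae mm, forall z, gkern (sg n) p (u_ n) z @[n --> \oo] --> gkern sigma p u z}.
Proof.
move=> p0 sgc uc; apply: filterS2 (ae_fst uc) (ae_snd uc) => z h1 h2.
exact: gkern_cvg.
Qed.

Lemma energy_fatou p (sg : nat -> R) sigma (u_ : nat -> V -> R) u (c : \bar R) :
  0 < p -> sg @ \oo --> sigma ->
  (forall n, measurable_fun setT (u_ n)) -> measurable_fun setT u ->
  {ae mu, forall x, u_ n x @[n --> \oo] --> u x} ->
  (\forall n \near \oo, gagliardo_energy (sg n) p (u_ n) <= c)%E ->
  (gagliardo_energy sigma p u <= c)%E.
Proof.
move=> p0 sgc mu_ mu0 uc h; rewrite gagliardo_energyE//.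
apply: (fatou_ae_le (f := fun n => gkern (sg n) p (u_ n))).
- by move=> n; exact: measurable_gkern.
- exact: measurable_gkern.
- by move=> n z; exact: gkern_ge0.
- by move=> z; exact: gkern_ge0.
- exact: ae_gkern_cvg.
- by apply: filterS h => n; rewrite gagliardo_energyE.
Qed.

(** Convergence almost everywhere together with convergence of the energies
    gives convergence in energy: [gkern (u_ n - u)] is dominated by [2^p]
    times the sum of the integrands of [u_ n] and [u], whose integrals
    converge. *)
Lemma energy_scheffe p (sg : nat -> R) sigma (u_ : nat -> V -> R) u :
  0 < p -> sg @ \oo --> sigma ->
  (forall n, measurable_fun setT (u_ n)) -> measurable_fun setT u ->
  {ae mu, forall x, u_ n x @[n --> \oo] --> u x} ->
  (gagliardo_energy sigma p u < +oo)%E ->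
  gagliardo_energy (sg n) p (u_ n) @[n --> \oo] --> gagliardo_energy sigma p u ->
  gagliardo_energy (sg n) p u @[n --> \oo] --> gagliardo_energy sigma p u ->
  gagliardo_energy (sg n) p (u_ n \- u) @[n --> \oo] --> 0%E.
Proof.
move=> p0 sgc mu_ mu0 uc fin h1 h2.
have muB n : measurable_fun setT (u_ n \- u) by exact: measurable_funB.
under eq_fun do rewrite gagliardo_energyE//.
have mk n v : measurable_fun setT v -> measurable_fun setT (gkern (sg n) p v).
  exact: measurable_gkern.
have mk0 := measurable_gkern sigma p mu0.
have finE : gagliardo_energy sigma p u \is a fin_num.
  by rewrite ge0_fin_numE// gagliardo_energy_ge0.
apply: (pratt_cvg0 (G := fun n z => 2 `^ p * (gkern (sg n) p (u_ n) z + gkern (sg n) p u z))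
   (g := fun z => 2 `^ p * (gkern sigma p u z + gkern sigma p u z))).
- by move=> n; exact: mk.
- by move=> n; apply: measurable_funM => //; apply: measurable_funD; exact: mk.
- by apply: measurable_funM => //; exact: measurable_funD.
- by move=> z; rewrite mulr_ge0 ?powR_ge0// addr_ge0// gkern_ge0.
- by move=> n z; rewrite gkern_ge0/=; apply: gkernB_le; exact: ltW.
- have hc : {ae mu, forall x, (u_ n \- u) x @[n --> \oo] --> (fun=> 0) x}.
    by apply: filterS uc => x ux; rewrite -(subrr (u x)); apply: cvgB => //; exact: cvg_cst.
  apply: filterS (ae_gkern_cvg p0 sgc hc) => z.
  by rewrite [X in _ --> X]/gkern subrr normr0 powR0 ?mul0r// gt_eqF.
- have hc : {ae mu, forall x, (fun n => u) n x @[n --> \oo] --> u x}.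
    by apply: aeW => x; exact: cvg_cst.
  apply: filterS2 (ae_gkern_cvg p0 sgc uc) (ae_gkern_cvg p0 sgc hc) => z k1 k2.
  by apply: cvgM; [exact: cvg_cst|exact: cvgD].
- rewrite intZ ?powR_ge0//; [|by move=> z; rewrite addr_ge0 ?gkern_ge0|exact: measurable_funD].
  rewrite (intD _ (gkern_ge0 _ _ _) (gkern_ge0 _ _ _))// -!gagliardo_energyE//.
  by rewrite -(fineK finE) -EFinD -EFinM ltry.
have E n : (\int[mm]_z (2 `^ p * (gkern (sg n) p (u_ n) z + gkern (sg n) p u z))%:E =
   (2 `^ p)%:E * (gagliardo_energy (sg n) p (u_ n) + gagliardo_energy (sg n) p u))%E.
  have m1 := mk n _ (mu_ n); have m2 := mk n _ mu0.
  rewrite intZ ?powR_ge0//; [|by move=> z; rewrite addr_ge0 ?gkern_ge0|exact: measurable_funD].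
  by rewrite (intD _ (gkern_ge0 _ _ _) (gkern_ge0 _ _ _))// -!gagliardo_energyE.
under eq_fun do rewrite E.
rewrite intZ ?powR_ge0//; [|by move=> z; rewrite addr_ge0 ?gkern_ge0|exact: measurable_funD].
rewrite (intD _ (gkern_ge0 _ _ _) (gkern_ge0 _ _ _))// -!gagliardo_energyE//.
have hs : (gagliardo_energy (sg n) p (u_ n) + gagliardo_energy (sg n) p u)%E
    @[n --> \oo] --> (gagliardo_energy sigma p u + gagliardo_energy sigma p u)%E.
  exact: (cvgeD (fin_num_adde_defr _ finE) h1 h2).
have pf : ((2 `^ p)%:E : \bar R) \is a fin_num by [].
have hz : ((2 `^ p)%:E * (gagliardo_energy (sg n) p (u_ n) + gagliardo_energy (sg n) p u))%E
    @[n --> \oo] --> ((2 `^ p)%:E * (gagliardo_energy sigma p u + gagliardo_energy sigma p u))%E.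
  exact: cvgeZl.
exact: hz.
Qed.

End energy_limits.

Section energy_bounds.
Context {R : realType} {N : nat}.
Local Notation mu := (lebesgue_rV R N).
Local Notation mm := (lebesgue_rV R N \x lebesgue_rV R N)%E.
Local Notation V := 'rV[R]_N.
Implicit Types (p sigma k : R) (u v w : V -> R) (z : V * V).

(** On a translated unit box [D] at distance 1 from [Omega] the function
    vanishes, so for [x] in [Omega] the increment to a point of [D] is the
    value at [x], and the denominator is bounded. *)
Lemma poincare p k (Omega : set V) : (0 < N)%N -> 0 < p -> 0 < k -> bounded_set Omega ->
  exists C : R, 0 <= C /\ forall w, measurable_fun setT w ->
   {ae mu, forall x, ~ Omega x -> w x = 0} ->
   (power_int p w <= C%:E * gagliardo_energy k p w)%E.
Proof.
move=> N0 p0 k0 /bounded_set_cube[r [r0 Or]].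
pose D : set V := [set y | forall i : 'I_N, r + 1 <= y ord0 i <= r + 2].
have rr (i : 'I_N) : (fun=> r + 1) i <= (fun=> r + 2) i by lra.
have muD : (mu : {measure set V -> \bar R}) D = 1%E.
  apply: (eq_trans (lebesgue_rV_box rr)); rewrite prodr_const.
  by rewrite (_ : r + 2 - (r + 1) = 1) ?expr1n//; ring.
clear rr.
have mD : measurable D.
  rewrite (_ : D = \bigcap_(i in [set: 'I_N])
    ((fun v : V => v ord0 i : measurableTypeR R) @^-1` `[r + 1, r + 2]%classic)).
    apply: fin_bigcap_measurable => // i _.
    by rewrite -[X in measurable X]setTI; exact: measurable_coord.
  by apply/seteqP; split => [x h i _|x h i]; have := h i; rewrite /= in_itv/=; [|apply].
have DO y : D y -> r < `|y|.
  move=> /(_ (Ordinal N0)) /andP[h _].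
  have h1 : r < y ord0 (Ordinal N0) by apply: lt_le_trans h; rewrite ltrDl.
  apply: (lt_le_trans h1).
  exact: (le_trans (ler_norm _) (rV_coord_le_norm y (Ordinal N0))).
pose l : R := Num.sqrt N%:R * (2 * r + 2).
have l0 : 0 < l by rewrite mulr_gt0 ?sqrtr_gt0 ?ltr0n//; lra.
pose C : R := l `^ (N%:R + k * p).
exists C; split; first exact: powR_ge0.
move=> w mw w0.
have mwp := measurable_norm_powR p mw.
have mprod : measurable_fun setT (fun z : V * V => `|w z.1| `^ p * \1_D z.2).
  apply: measurable_funM; first exact: (measurable_fst_comp mwp).
  by apply: measurable_snd_comp; exact: measurable_indic.
have -> : power_int p w = (\int[mm]_z (`|w z.1| `^ p * \1_D z.2)%:E)%E.
  rewrite fubini_tonelli1//=.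
  - apply: eq_integral => x _; rewrite /fubini_F/=.
    rewrite (@intZ _ _ _ mu (`|w x| `^ p) (fun y : V => \1_D y)) ?powR_ge0//.
      by rewrite integral_indic// setIT [X in (_ * X)%E]muD mule1.
    exact: measurable_indic.
  - exact/measurable_EFinP.
rewrite gagliardo_energyE// -intZ; first last.
- exact: measurable_gkern.
- exact: gkern_ge0.
- exact: powR_ge0.
apply: int_ae_le => //.
- by move=> z; rewrite mulr_ge0 ?powR_ge0 ?gkern_ge0.
- by apply: measurable_funM => //; exact: measurable_gkern.
apply: filterS2 (ae_fst w0) (ae_snd w0) => z w1 w2.
have R0 : 0 <= C * gkern k p w z by rewrite mulr_ge0 ?powR_ge0 ?gkern_ge0.
rewrite indicE; case: (boolP (z.2 \in D)) => [/set_mem zD|_]; last by rewrite mulr0.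
rewrite mulr1; have [zO|zO] := pselect (Omega z.1); last first.
  by rewrite w1// normr0 powR0// gt_eqF.
have wz2 : w z.2 = 0.
  by apply: w2 => /Or zr; have := DO _ zD; rewrite ltNge => /negP; apply.
have zz : 0 < enorm (z.1 - z.2).
  rewrite enorm_gt0// subr_eq0; apply/eqP => h.
  by have := DO _ zD; rewrite -h ltNge => /negP; apply; exact: Or.
rewrite /gkern wz2 subr0 mulrCA -[leLHS]mulr1; apply: ler_wpM2l; first exact: powR_ge0.
rewrite ler_pdivlMr ?powR_gt0// mul1r.
apply: ge0_ler_powR; rewrite ?nnegrE ?enorm_ge0 ?(ltW l0)//.
  by rewrite addr_ge0 ?ler0n// mulr_ge0// ltW.
apply: (le_trans (enorm_le_norm _)); apply: ler_wpM2l; first exact: sqrtr_ge0.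
apply: (le_trans (ler_normB _ _)).
have h1 : `|z.1| <= r by exact: Or.
have h2 : `|z.2| <= r + 2.
  apply/rV_norm_leP => [|i]; first by lra.
  by have := zD i => /andP[a1 a2]; rewrite ler_norml; apply/andP; split; lra.
lra.
Qed.

(** Bounded and Lipschitz at once, in the form that is integrated against the
    singular kernel. *)
Definition lip_cutoff p (eta : V -> R) (L : R) :=
  forall x y, `|eta x - eta y| `^ p <= L * Num.min 1 (enorm (x - y) `^ p).

(** The product rule for increments: one term keeps the energy of [w], the
    other has the increment of the cutoff and is integrable by
    [integral_kern_lty]. *)
Lemma energy_cutoff_lty p sigma (eta : V -> R) (L : R) w : 0 < p -> 0 < sigma < 1 -> 0 <= L ->
  measurable_fun setT eta -> measurable_fun setT w ->
  (forall x, `|eta x| <= 1) -> lip_cutoff p eta L ->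
  (power_int p w < +oo)%E -> (gagliardo_energy sigma p w < +oo)%E ->
  (gagliardo_energy sigma p (eta \* w)%R < +oo)%E.
Proof.
move=> p0 s01 L0 me mw eta1 etaL Pw Ew.
have mwp := measurable_norm_powR p mw.
have mk := measurable_diff_comp (@measurable_kern R N sigma p).
have mg := measurable_gkern sigma p mw.
pose f (z : V * V) := (`|w z.1| `^ p + `|w z.2| `^ p) * kern sigma p (z.1 - z.2).
have f0 z : 0 <= f z by rewrite mulr_ge0 ?kern_ge0 ?addr_ge0 ?powR_ge0.
have mf : measurable_fun setT f.
  apply: measurable_funM => //; apply: measurable_funD.
    exact: (measurable_fst_comp mwp).
  exact: (measurable_snd_comp mwp).
have h z : gkern sigma p (eta \* w) z <= 2 `^ p * (gkern sigma p w z + L * f z).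
  rewrite /gkern /f /kern /=.
  set D := enorm (z.1 - z.2) `^ (N%:R + sigma * p).
  have D0 : 0 <= D^-1 by rewrite invr_ge0 powR_ge0.
  rewrite mulrA mulrA -mulrDl mulrA; apply: ler_wpM2r => //.
  rewrite (_ : eta z.1 * w z.1 - _ = eta z.1 * (w z.1 - w z.2) + (eta z.1 - eta z.2) * w z.2); last by ring.
  apply: (le_trans (powR_normD_le _ _ (ltW p0))).
  apply: ler_wpM2l; first exact: powR_ge0.
  rewrite !normrM !(powRM p (normr_ge0 _) (normr_ge0 _)); apply: lerD.
    rewrite -[leRHS]mul1r; apply: ler_wpM2r; first exact: powR_ge0.
    apply: (@le_trans _ _ (1 `^ p)); last by rewrite powR1.
    by apply: ge0_ler_powR; rewrite ?nnegrE//; exact: ltW.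
  rewrite mulrAC; apply: ler_pM; rewrite ?powR_ge0 ?etaL//.
  by rewrite lerDr powR_ge0.
have mLf : measurable_fun setT (fun z => L * f z) by exact: measurable_funM.
have Lf0 z : 0 <= L * f z by rewrite mulr_ge0.
apply: (le_lt_trans (energy_le_of_gkern _ _ h)).
- exact: measurable_funM.
- by apply: measurable_funM => //; exact: measurable_funD.
rewrite intZ ?powR_ge0//; [|by move=> z; rewrite addr_ge0 ?gkern_ge0|exact: measurable_funD].
rewrite (intD _ (gkern_ge0 _ _ _) Lf0)// -gagliardo_energyE// intZ//.
rewrite (int_two_sided_kern _ _ mwp); last by move=> x; exact: powR_ge0.
have K1 := integral_kern_lty s01 p0 (N := N).
have K0 : (0 <= kern_mass (N := N) sigma p)%E by apply: int_ge0 => x; exact: kern_ge0.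
have [a [_ ->]] := ge0_lty_EFin K0 K1.
have [b [_ bE]] := ge0_lty_EFin (power_int_ge0 p w) Pw.
have [c [_ ->]] := ge0_lty_EFin (gagliardo_energy_ge0 sigma p w) Ew.
by rewrite -/(power_int p w) bE -!EFinM ltry.
Qed.

Lemma energy_bump_lty p sigma (eta : V -> R) (L : R) (B : set V) : 0 < p -> 0 < sigma < 1 -> 0 <= L ->
  measurable_fun setT eta -> measurable B -> ((mu : {measure set V -> \bar R}) B < +oo)%E ->
  (forall x, ~ B x -> eta x = 0) -> lip_cutoff p eta L ->
  (gagliardo_energy sigma p eta < +oo)%E.
Proof.
move=> p0 s01 L0 me mB Bfin etaB etaL.
have mk := measurable_diff_comp (@measurable_kern R N sigma p).
have mi : measurable_fun setT (\1_B : V -> R) by exact: measurable_indic.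
pose f (z : V * V) := (\1_B z.1 + \1_B z.2) * kern sigma p (z.1 - z.2).
have f0 z : 0 <= f z by rewrite mulr_ge0 ?kern_ge0 ?addr_ge0.
have mf : measurable_fun setT f.
  apply: measurable_funM => //; apply: measurable_funD.
    exact: (measurable_fst_comp mi).
  exact: (measurable_snd_comp mi).
have h z : gkern sigma p eta z <= L * f z.
  rewrite /gkern /f /kern mulrA mulrA; apply: ler_wpM2r.
    by rewrite invr_ge0 powR_ge0.
  have M0 : 0 <= L * Num.min 1 (enorm (z.1 - z.2) `^ p).
    by rewrite mulr_ge0// le_min ler01 powR_ge0.
  rewrite mulrAC -[leLHS]mulr1.
  have [[B1|B2]|] := pselect (B z.1 \/ B z.2).
  - apply: ler_pM; rewrite ?powR_ge0 ?etaL//.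
    by rewrite !indicE mem_set// lerDl.
  - apply: ler_pM; rewrite ?powR_ge0 ?etaL//.
    by rewrite !indicE (mem_set B2) lerDr.
  - move=> /not_orP[B1 B2]; rewrite (etaB _ B1) (etaB _ B2) subrr normr0 powR0 ?gt_eqF//.
    by rewrite mul0r mulr_ge0// addr_ge0.
apply: (le_lt_trans (energy_le_of_gkern _ _ h)) => //.
  exact: measurable_funM.
rewrite intZ// (int_two_sided_kern _ _ mi)//.
rewrite integral_indic// setIT.
have K1 := integral_kern_lty s01 p0 (N := N).
have K0 : (0 <= kern_mass (N := N) sigma p)%E by apply: int_ge0 => x; exact: kern_ge0.
have [a [_ ->]] := ge0_lty_EFin K0 K1.
have [b [_ ->]] := ge0_lty_EFin (measure_ge0 _ B) Bfin.
by rewrite -!EFinM ltry.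
Qed.

End energy_bounds.

(** * Diagonal extraction and fine partitions *)

Definition infinitely_often (S : set nat) := forall m, exists n, (m < n)%N /\ S n.

Lemma infinite_pigeonhole (K : finType) (c : nat -> K) (S : set nat) :
  infinitely_often S ->
  exists k, infinitely_often (S `&` [set n | c n = k]).
Proof.
move=> infS; apply: contrapT => /forallNP h.
have /choice[m mP] k : exists m, forall n, (m < n)%N -> ~ (S n /\ c n = k).
  have /existsNP[m hm] := h k; exists m => n mn Sn.
  by apply: hm; exists n; split.
have [n [mn Sn]] := infS (\max_k m k).
apply: (mP (c n) n) => //; apply: leq_ltn_trans mn; exact: leq_bigmax.
Qed.

(** Each classifier has finitely many classes, so one class is met infinitely
    often. Passing successively to such classes and taking the diagonal gives
    a Cauchy subsequence. *)
Lemma homogeneous_extraction (P : nat -> nat -> nat -> Prop) :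
  (forall j, exists (K : finType) (c : nat -> K), forall m n, c m = c n -> P j m n) ->
  exists phi : nat -> nat, {homo phi : m n / (m < n)%N} /\
    forall j m n, (j <= m)%N -> (j <= n)%N -> P j (phi m) (phi n).
Proof.
move=> hP.
have /choice[F hF] (jS : nat * set nat) : exists S', infinitely_often jS.2 ->
    [/\ infinitely_often S', S' `<=` jS.2 & forall m n, S' m -> S' n -> P jS.1 m n].
  have [infS|?] := pselect (infinitely_often jS.2); last by exists set0.
  have [K [c hc]] := hP jS.1.
  have [k hk] := infinite_pigeonhole c infS.
  exists (jS.2 `&` [set n | c n = k]) => _; split; [exact: hk|by move=> x []|].
  by move=> m n [_ /= cm] [_ /= cn]; apply: hc; rewrite cm cn.
pose S := fix S j := if j is j'.+1 then F (j, S j') else F (0%N, setT).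
have S0 : infinitely_often [set: nat] by move=> m; exists m.+1.
have infS j : infinitely_often (S j).
  by elim: j => [|j ih]; [have [] := hF (0%N, setT) S0|have [] := hF (j.+1, S j) ih].
have SS j n : (j <= n)%N -> S n `<=` S j.
  elim: n => [|n ih]; first by rewrite leqn0 => /eqP ->.
  rewrite leq_eqVlt => /predU1P[->//|jn]; apply: subset_trans (ih jn).
  by have [] := hF (n.+1, S n) (infS n).
have SP j m n : S j m -> S j n -> P j m n.
  case: j => [|j].
    by have [_ _ h] := hF (0%N, setT) S0; exact: h.
  by have [_ _ h] := hF (j.+1, S j) (infS j); exact: h.
have /choice[g gP] : forall jm : nat * nat, exists n, (jm.2 < n)%N /\ S jm.1 n.
  by move=> [j m]; exact: infS.
pose phi := fix phi j := if j is j'.+1 then g (j, phi j') else g (0%N, 0%N).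
have phiS j : S j (phi j) by case: j => [|j]; [exact: (gP (0%N, 0%N)).2|exact: (gP (j.+1, phi j)).2].
exists phi; split.
  by apply: homo_ltn; [exact: ltn_trans|move=> j; exact: (gP (j.+1, phi j)).1].
move=> j m n jm jn; apply: SP.
- exact: (SS _ _ jm).
- exact: (SS _ _ jn).
Qed.

Section compactness.
Context {R : realType} {N : nat}.
Local Notation mu := (lebesgue_rV R N).
Local Notation mm := (lebesgue_rV R N \x lebesgue_rV R N)%E.
Local Notation V := 'rV[R]_N.
Local Notation mes := ((lebesgue_rV R N : {measure set 'rV[R]_N -> \bar R})).
Implicit Types (p sigma k : R) (u v w : V -> R) (z : V * V).

Lemma mes_le (A B : set V) : measurable A -> measurable B -> A `<=` B ->
  (mes A <= mes B)%E.
Proof. by move=> mA mB AB; apply: le_measure; rewrite ?inE. Qed.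

Lemma measurable_box (a b : 'I_N -> R) (b1 b2 : bool) :
  measurable [set x : V | forall i, x ord0 i \in Interval (BSide b1 (a i)) (BSide b2 (b i))].
Proof.
rewrite (_ : mkset _ = \bigcap_(i in [set: 'I_N])
    ((fun v : V => v ord0 i : measurableTypeR R) @^-1`
       [set` Interval (BSide b1 (a i)) (BSide b2 (b i))])).
  apply: fin_bigcap_measurable => // i _.
  by rewrite -[X in measurable X]setTI; apply: measurable_coord => //; exact: measurable_itv.
by apply/seteqP; split => [x h i _|x h i]; [exact: h|exact: (h i Logic.I)].
Qed.

(** A cube is divided into half-open cubes of equal side. The last property
    says that the diameter raised to [N + sigma p] is at most [e] times a
    lower bound of the volumes, which holds for small sides because [sigma p]
    is positive. *)
Lemma fine_partition p sigma r e : (0 < N)%N -> 0 < p -> 0 < sigma -> 0 < r -> 0 < e ->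
  exists (K : finType) (Q : K -> set V) (q : R),
    [/\ 0 < q, forall f, measurable (Q f), forall f, (q%:E <= mes (Q f) < +oo)%E,
     cube r `<=` \bigcup_f Q f & (forall f g x, Q f x -> Q g x -> f = g) /\
     forall f x y, Q f x -> Q f y -> enorm (x - y) `^ (N%:R + sigma * p) <= e * q].
Proof.
move=> N0 p0 s0 r0 e0.
have sp0 : 0 < sigma * p by rewrite mulr_gt0.
have a0 : 0 < N%:R + sigma * p by rewrite addr_gt0// ltr0n.
set a := N%:R + sigma * p in a0 *.
have sN : 0 < Num.sqrt N%:R :> R by rewrite sqrtr_gt0 ltr0n.
pose t : R := e / (2 ^+ N * Num.sqrt N%:R `^ a).
have t0 : 0 < t by rewrite divr_gt0// mulr_gt0 ?exprn_gt0 ?powR_gt0.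
pose h0 := t `^ (sigma * p)^-1.
have h00 : 0 < h0 by rewrite powR_gt0.
pose M := (Num.bound ((2 * r + 1) / h0)).+1.
have M0 : 0 < M%:R :> R by rewrite ltr0n.
pose h := (2 * r + 1) / M%:R.
have h_gt0 : 0 < h by rewrite divr_gt0//; lra.
have hh0 : h <= h0.
  rewrite /h ler_pdivrMr// -ler_pdivrMl// mulrC.
  apply: (le_trans (ltW (archi_boundP _))); first by rewrite divr_ge0 ?(ltW h00)//; lra.
  by rewrite ler_nat.
pose lo (f : {ffun 'I_N -> 'I_M}) (i : 'I_N) : R := - r + (f i)%:R * h.
pose Q (f : {ffun 'I_N -> 'I_M}) : set V :=
  [set x | forall i, x ord0 i \in `[lo f i, lo f i + h[].
have mQ f : measurable (Q f) by exact: (measurable_box (lo f) (fun i => lo f i + h) true true).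
pose q := (h / 2) ^+ N.
have q0 : 0 < q by rewrite exprn_gt0// divr_gt0.
have box_sub (b : R) f : 0 <= b -> mes [set v | forall i : 'I_N, lo f i <= v ord0 i <= lo f i + b] = (b ^+ N)%:E.
  move=> b0.
  have hb (i : 'I_N) : lo f i <= (fun i => lo f i + b) i by rewrite lerDl.
  apply: (eq_trans (lebesgue_rV_box hb)).
  under eq_bigr do rewrite addrAC subrr add0r.
  by rewrite prodr_const card_ord.
have mclosed (b : R) f : measurable [set v : V | forall i : 'I_N, lo f i <= v ord0 i <= lo f i + b].
  have := measurable_box (lo f) (fun i => lo f i + b) true false.
  by congr measurable; apply/seteqP; split => v hv i; have := hv i; rewrite in_itv.
exists {ffun 'I_N -> 'I_M}, Q, q; split => //.
- move=> f; apply/andP; split.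
    have h20 : 0 <= h / 2 by rewrite divr_ge0 ?(ltW h_gt0).
    rewrite -[X in (X <= _)%E](box_sub _ f h20); apply: (mes_le (mclosed _ f) (mQ f)).
    move=> x hx i; have /andP[h1 h2] := hx i; rewrite in_itv/= h1/=.
    by apply: (le_lt_trans h2); rewrite ltrD2l; lra.
  apply: (@le_lt_trans _ _ (h ^+ N)%:E); last exact: ltry.
  rewrite -(box_sub _ f (ltW h_gt0)); apply: (mes_le (mQ f) (mclosed _ f)).
  by move=> x hx i; have := hx i; rewrite in_itv/= => /andP[-> /ltW].
- move=> x xr.
  have xi i : 0 <= (x ord0 i + r) / h.
    rewrite divr_ge0 ?(ltW h_gt0)//; have := le_trans (rV_coord_le_norm x i) xr.
    by rewrite ler_norml => /andP[]; lra.
  have xM i : (Num.truncn ((x ord0 i + r) / h) < M)%N.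
    rewrite truncn_lt_nat// ltr_pdivrMr// /h mulrC -mulrA mulVf ?mulr1 ?gt_eqF//.
    by have := le_trans (rV_coord_le_norm x i) xr; rewrite ler_norml => /andP[]; lra.
  exists [ffun i => Ordinal (xM i)] => // i; rewrite /lo ffunE/= in_itv/=.
  have /andP[k1 k2] := truncn_itv (xi i).
  move: k1 k2; rewrite ler_pdivlMr// ltr_pdivrMr// -natr1; lra.
split.
- move=> f g x Qf Qg; apply/ffunP => i; apply/val_inj => /=.
  have := Qf i; have := Qg i; rewrite !in_itv/= /lo => /andP[g1 g2] /andP[f1 f2].
  have key (m n : nat) (y : R) : - r + m%:R * h <= y -> y < - r + n%:R * h + h -> (m <= n)%N.
    by move=> m1 n1; rewrite -ltnS -(ltr_nat R) -natr1 -(ltr_pM2r h_gt0); lra.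
  by apply/eqP; rewrite eqn_leq (key _ _ _ f1 g2) (key _ _ _ g1 f2).
move=> f x y Qx Qy.
have xy : `|x - y| <= h.
  apply/rV_norm_leP => [|i]; first exact: ltW.
  have := Qx i; have := Qy i; rewrite !in_itv/= !mxE => /andP[g1 g2] /andP[f1 f2].
  by rewrite ler_norml; apply/andP; split; lra.
apply: (@le_trans _ _ ((Num.sqrt N%:R * h) `^ a)).
  apply: ge0_ler_powR; rewrite ?nnegrE ?enorm_ge0 ?(ltW a0)//.
    by rewrite mulr_ge0 ?sqrtr_ge0 ?ltW.
  by apply: (le_trans (enorm_le_norm _)); rewrite ler_pM2l.
rewrite powRM ?sqrtr_ge0 ?(ltW h_gt0)//.
rewrite [X in _ * X](_ : _ = h ^+ N * h `^ (sigma * p)); last first.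
  by rewrite /a powRD ?(gt_eqF h_gt0) ?implybT// powR_mulrn// ltW.
have ht : h `^ (sigma * p) <= t.
  rewrite -[leRHS](powRVK (p := sigma * p)) ?(gt_eqF sp0) ?(ltW t0)//.
  by apply: ge0_ler_powR; rewrite ?nnegrE ?(ltW sp0) ?(ltW h_gt0) ?(ltW h00).
apply: (@le_trans _ _ (Num.sqrt N%:R `^ a * (h ^+ N * t))).
  by rewrite ler_pM2l ?powR_gt0// ler_pM2l ?exprn_gt0.
rewrite /t /q (_ : (h / 2) ^+ N = h ^+ N / 2 ^+ N); last by rewrite expr_div_n.
move: (h ^+ N) => H; rewrite le_eqVlt; apply/orP; left; apply/eqP.
have : Num.sqrt N%:R `^ a != 0 :> R by rewrite gt_eqF// powR_gt0.
have : 2 ^+ N != 0 :> R by rewrite gt_eqF// exprn_gt0.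
move: (2 ^+ N) (Num.sqrt N%:R `^ a) => S T S0 T0.
by field; apply/andP.
Qed.

(** The average over [c = w y] of the deviation of [w] from [c] is the double
    integral divided by the measure, so some value [c] does no worse than the
    average, up to [d]. *)
Lemma exists_good_constant p (Q : set V) (q d : R) w : 0 < q -> 0 < d ->
  measurable Q -> (q%:E <= mes Q)%E -> measurable_fun setT w ->
  exists c : R, (q%:E * \int[mu]_x (\1_Q x * `|w x - c| `^ p)%:E <=
    \int[mm]_z (\1_Q z.1 * \1_Q z.2 * `|w z.1 - w z.2| `^ p)%:E + d%:E)%E.
Proof.
move=> q0 d0 mQ qQ mw; set J := (\int[mm]_z (\1_Q z.1 * \1_Q z.2 * `|w z.1 - w z.2| `^ p)%:E)%E.
have J0 : (0 <= J)%E by apply: int_ge0 => z; rewrite !mulr_ge0 ?powR_ge0.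
have [Jfin|] := boolP (J \is a fin_num); last first.
  by rewrite ge0_fin_numE// -leNgt leye_eq => /eqP ->; exists 0; rewrite leey.
apply: contrapT => /forallNP h.
have mi : measurable_fun setT (\1_Q : V -> R) by exact: measurable_indic.
have mz : measurable_fun setT (fun z : V * V => \1_Q z.1 * \1_Q z.2 * `|w z.1 - w z.2| `^ p).
  apply: measurable_funM; first apply: measurable_funM.
  - exact: (measurable_fst_comp mi).
  - exact: (measurable_snd_comp mi).
  apply: measurable_norm_powR; apply: measurable_funB.
    exact: (measurable_fst_comp mw).
  exact: (measurable_snd_comp mw).
have mf y : measurable_fun setT (fun x => \1_Q x * `|w x - w y| `^ p).
  by apply: measurable_funM => //; apply: measurable_norm_powR; exact: measurable_funB.
have f0 y x : 0 <= \1_Q x * `|w x - w y| `^ p by rewrite mulr_ge0 ?powR_ge0.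
have JE : (J = \int[mu]_y ((\1_Q y)%:E * \int[mu]_x (\1_Q x * `|w x - w y| `^ p)%:E))%E.
  rewrite /J fubini_tonelli2//=.
  - apply: eq_integral => y _; rewrite /fubini_G/=.
    rewrite -(intZ mu _ (f0 y) (mf y))//; apply: eq_integral => x _.
    by congr EFin; ring.
  - exact/measurable_EFinP.
pose c := (fine J + d) / q.
have c0 : 0 <= c by rewrite divr_ge0 ?(ltW q0)// addr_ge0 ?fine_ge0 ?(ltW d0).
have : (J + d%:E <= J)%E.
  apply: (@le_trans _ _ (c%:E * mes Q)%E).
    apply: (@le_trans _ _ (c%:E * q%:E)%E); last by apply: lee_wpmul2l; rewrite ?lee_fin.
    by rewrite -EFinM /c mulfVK ?gt_eqF// EFinD fineK.
  rewrite [leRHS]JE.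
  have -> : (c%:E * mes Q = \int[mu]_y (c%:E * (\1_Q y)%:E))%E.
    rewrite ge0_integralZl//; first by rewrite integral_indic// setIT.
    exact/measurable_EFinP.
  apply: ge0_le_integral => //.
  - by move=> y _; rewrite mule_ge0 ?lee_fin.
  - by apply: emeasurable_funM => //; exact/measurable_EFinP.
  - apply: emeasurable_funM; first exact/measurable_EFinP.
    have := @measurable_fun_fubini_tonelli_G _ _ V V R mu (fun z : V * V => (\1_Q z.1 * `|w z.1 - w z.2| `^ p)%:E).
    apply.
      apply/measurable_EFinP; apply: measurable_funM; first exact: (measurable_fst_comp mi).
      apply: measurable_norm_powR; apply: measurable_funB.
        exact: (measurable_fst_comp mw).
      exact: (measurable_snd_comp mw).
    by move=> z; rewrite lee_fin mulr_ge0 ?powR_ge0.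
  move=> y _; rewrite muleC; apply: lee_wpmul2l; first by rewrite lee_fin.
  have /negP := h (w y); rewrite -ltNge => /ltW hy.
  rewrite -(@lee_pmul2l _ q%:E) ?lte_fin//.
  by rewrite -EFinM /c mulrC mulfVK ?gt_eqF// EFinD fineK.
by rewrite -(fineK Jfin) -EFinD lee_fin; lra.
Qed.

End compactness.

(** * Compactness of bounded sets of finite energy *)

Section step_functions.
Context {R : realType} {N : nat}.
Local Notation mu := (lebesgue_rV R N).
Local Notation mm := (lebesgue_rV R N \x lebesgue_rV R N)%E.
Local Notation V := 'rV[R]_N.
Local Notation mes := ((lebesgue_rV R N : {measure set 'rV[R]_N -> \bar R})).
Context {K : finType} (Q : K -> set V).

Definition step (c : K -> R) (x : V) : R := \sum_f c f * \1_(Q f) x.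

Lemma int_sum (F : K -> V -> R) :
  (forall f, measurable_fun setT (F f)) -> (forall f x, 0 <= F f x) ->
  (\int[mu]_x (\sum_f F f x)%:E = \sum_f \int[mu]_x (F f x)%:E)%E.
Proof.
move=> mF F0; under eq_integral do rewrite -sumEFin.
rewrite ge0_integral_sum//.
- by move=> f; exact/measurable_EFinP.
- by move=> f x _; rewrite lee_fin.
Qed.

Lemma int_prod_sum (F : K -> V * V -> R) :
  (forall f, measurable_fun setT (F f)) -> (forall f x, 0 <= F f x) ->
  (\int[mm]_x (\sum_f F f x)%:E = \sum_f \int[mm]_x (F f x)%:E)%E.
Proof.
move=> mF F0; under eq_integral do rewrite -sumEFin.
rewrite ge0_integral_sum//.
- by move=> f; exact/measurable_EFinP.
- by move=> f x _; rewrite lee_fin.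
Qed.

Lemma sum_indic_eq (F : K -> R) f x : (forall g, Q g x -> g = f) -> Q f x ->
  \sum_g F g * \1_(Q g) x = F f.
Proof.
move=> uniq Qf; rewrite (bigD1 f)//= indicE mem_set// mulr1 big1 ?addr0// => g gf.
rewrite indicE memNset ?mulr0// => /uniq gE.
by move: gf; rewrite gE eqxx.
Qed.

Lemma sum_indic_out (F : K -> R) x : (forall f, ~ Q f x) -> \sum_g F g * \1_(Q g) x = 0.
Proof. by move=> h; rewrite big1// => g _; rewrite indicE memNset ?mulr0. Qed.

Context (mQ : forall f, measurable (Q f))
  (dQ : forall f g x, Q f x -> Q g x -> f = g).

Lemma measurable_step c : measurable_fun setT (step c).
Proof.
by apply: measurable_sum => f; apply: measurable_funM => //; exact: measurable_indic.
Qed.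

Lemma step_in c f x : Q f x -> step c x = c f.
Proof. by move=> Qf; apply: sum_indic_eq => // g Qg; exact: dQ Qg Qf. Qed.

Lemma step_out c x : (forall f, ~ Q f x) -> step c x = 0.
Proof. exact: sum_indic_out. Qed.

Lemma step_cases x : (exists f, Q f x) \/ (forall f, ~ Q f x).
Proof. by have [|/forallNP] := pselect (exists f, Q f x); [left|right]. Qed.

Lemma power_int_stepB_le p (c c' : K -> R) (e : R) : 0 < p -> 0 <= e ->
  (forall f, `|c f - c' f| <= e) ->
  (power_int p (step c \- step c')%R <= (e `^ p)%:E * \sum_f mes (Q f))%E.
Proof.
move=> p0 e0 h.
have mi f : measurable_fun setT (\1_(Q f) : V -> R) by exact: measurable_indic.
have -> : (\sum_f mes (Q f) = \int[mu]_x (\sum_f 1 * \1_(Q f) x)%:E)%E.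
  rewrite int_sum//.
  - by apply: eq_bigr => f _; under eq_integral do rewrite mul1r; rewrite integral_indic// setIT.
  - by move=> f; exact: measurable_funM.
have msum : measurable_fun setT (fun x : V => \sum_f 1 * \1_(Q f) x : R).
  by apply: measurable_sum => f; exact: measurable_funM.
have sum0 x : 0 <= \sum_f 1 * \1_(Q f) x :> R by apply: sumr_ge0 => f _; rewrite mul1r.
rewrite -(intZ mu (powR_ge0 _ _) sum0 msum); apply: int_le.
- by move=> x; exact: powR_ge0.
- by apply: measurable_norm_powR; apply: measurable_funB; exact: measurable_step.
- exact: measurable_funM.
move=> x /=; have [[f Qf]|Qn] := step_cases x.
  rewrite !(step_in _ Qf) (@sum_indic_eq (fun=> 1) f)// ?mulr1; last by move=> g Qg; exact: dQ Qg Qf.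
  by apply: ge0_ler_powR; rewrite ?nnegrE// ltW.
rewrite !step_out// subr0 normr0 powR0 ?gt_eqF//.
by rewrite mulr_ge0 ?powR_ge0.
Qed.

Lemma coef_step_le p (c : K -> R) f (q : R) : 0 < p -> (q%:E <= mes (Q f))%E ->
  ((`|c f| `^ p)%:E * q%:E <= power_int p (step c))%E.
Proof.
move=> p0 hq.
apply: (@le_trans _ _ ((`|c f| `^ p)%:E * mes (Q f))%E).
  by apply: lee_wpmul2l => //; rewrite lee_fin powR_ge0.
have -> : mes (Q f) = (\int[mu]_x (\1_(Q f) x)%:E)%E by rewrite integral_indic// setIT.
have mi : measurable_fun setT (\1_(Q f) : V -> R) by exact: measurable_indic.
rewrite -(intZ mu (powR_ge0 _ _) _ mi)//; apply: int_le.
- by move=> x; rewrite mulr_ge0 ?powR_ge0.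
- exact: measurable_funM.
- by apply: measurable_norm_powR; exact: measurable_step.
move=> x; rewrite indicE; case: (boolP (x \in Q f)) => [/set_mem Qf|_].
  by rewrite mulr1 (step_in _ Qf).
by rewrite mulr0 powR_ge0.
Qed.

(** A fractional Poincare inequality on each small piece: the deviation from a
    constant is controlled by the double integral, hence by the energy times
    the fineness of the partition. *)
Lemma step_approximation p sigma (r e q E d : R) (w : V -> R) :
  0 < p -> 0 < q -> 0 < d -> 0 <= e ->
  (forall f, (q%:E <= mes (Q f))%E) -> cube r `<=` \bigcup_f Q f ->
  (forall f x y, Q f x -> Q f y -> enorm (x - y) `^ (N%:R + sigma * p) <= e * q) ->
  measurable_fun setT w -> {ae mu, forall x, ~ cube r x -> w x = 0} ->
  (gagliardo_energy sigma p w <= E%:E)%E ->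
  exists c, (power_int p (w \- step c)%R <= (e * E + d)%:E)%E.
Proof.
move=> p0 q0 d0 e0 hq cov small mw w0 hE.
pose d' := d * q / (#|K|.+1)%:R.
have d'0 : 0 < d' by rewrite divr_gt0 ?ltr0n// mulr_gt0.
have /choice[c hc] f := exists_good_constant p q0 d'0 (mQ f) (hq f) mw.
exists c.
have mi f : measurable_fun setT (\1_(Q f) : V -> R) by exact: measurable_indic.
pose F f x := \1_(Q f) x * `|w x - c f| `^ p.
have F0 f x : 0 <= F f x by rewrite mulr_ge0 ?powR_ge0.
have mF f : measurable_fun setT (F f).
  by apply: measurable_funM => //; apply: measurable_norm_powR; exact: measurable_funB.
pose G f (z : V * V) := \1_(Q f) z.1 * \1_(Q f) z.2 * `|w z.1 - w z.2| `^ p.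
have G0 f z : 0 <= G f z by rewrite !mulr_ge0 ?powR_ge0.
have mG f : measurable_fun setT (G f).
  apply: measurable_funM; first apply: measurable_funM.
  - exact: (measurable_fst_comp (mi f)).
  - exact: (measurable_snd_comp (mi f)).
  apply: measurable_norm_powR; apply: measurable_funB.
    exact: (measurable_fst_comp mw).
  exact: (measurable_snd_comp mw).
have PE : power_int p (w \- step c) = (\sum_f \int[mu]_x (F f x)%:E)%E.
  rewrite -int_sum//; apply: int_ae_eq.
  - by move=> x; exact: powR_ge0.
  - by move=> x; exact: sumr_ge0.
  - by apply: measurable_norm_powR; apply: measurable_funB => //; exact: measurable_step.
  - exact: measurable_sum.
  apply: filterS w0 => x wx /=.
  rewrite /F; under eq_bigr do rewrite mulrC.
  have [[f Qf]|Qn] := step_cases x.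
    rewrite (step_in _ Qf) (@sum_indic_eq (fun g => `|w x - c g| `^ p) f)//.
    by move=> g Qg; exact: dQ Qg Qf.
  rewrite step_out// sum_indic_out// wx ?subr0 ?normr0 ?powR0 ?gt_eqF//.
  by move=> /cov[f _]; exact: Qn.
have sumG : (\sum_f \int[mm]_z (G f z)%:E <= (e * q * E)%:E)%E.
  rewrite -int_prod_sum//; apply: (@le_trans _ _ ((e * q)%:E * gagliardo_energy sigma p w)%E).
    rewrite gagliardo_energyE// -intZ; first last.
    - exact: measurable_gkern.
    - exact: gkern_ge0.
    - by rewrite mulr_ge0// ltW.
    apply: int_le.
    - by move=> z; exact: sumr_ge0.
    - exact: measurable_sum.
    - by apply: measurable_funM => //; exact: measurable_gkern.
    move=> z; have R0 : 0 <= e * q * gkern sigma p w z by rewrite mulr_ge0 ?gkern_ge0// mulr_ge0// ltW.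
    have GE f : G f z = (\1_(Q f) z.2 * `|w z.1 - w z.2| `^ p) * \1_(Q f) z.1.
      by rewrite /G -mulrA mulrC.
    under eq_bigr do rewrite GE.
    have [[f Qf]|Qn] := step_cases z.1; last by rewrite sum_indic_out.
    rewrite (@sum_indic_eq (fun g => \1_(Q g) z.2 * `|w z.1 - w z.2| `^ p) f)//; last first.
      by move=> g Qg; exact: dQ Qg Qf.
    rewrite indicE; case: (boolP (z.2 \in Q f)) => [/set_mem Qf2|_]; last by rewrite mul0r.
    rewrite mul1r; have [zz|zz] := eqVneq z.1 z.2.
      by rewrite zz subrr normr0 powR0 ?gt_eqF.
    have ee : 0 < enorm (z.1 - z.2) by rewrite enorm_gt0// subr_eq0.
    rewrite /gkern mulrCA -[leLHS]mulr1; apply: ler_wpM2l; first exact: powR_ge0.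
    by rewrite ler_pdivlMr ?powR_gt0// mul1r; exact: small Qf Qf2.
  by rewrite [X in (_ <= X)%E]EFinM; apply: lee_wpmul2l => //; rewrite lee_fin mulr_ge0// ltW.
rewrite PE -(@lee_pmul2l _ q%:E) ?lte_fin//.
rewrite ge0_sume_distrr; last by move=> f _; apply: int_ge0 => x; exact: F0.
apply: (@le_trans _ _ (\sum_f (\int[mm]_z (G f z)%:E + d'%:E))%E); first by apply: lee_sum => f _; exact: hc.
rewrite big_split/= sumEFin sumr_const.
apply: (le_trans (leeD2r _ sumG)); rewrite -EFinD -EFinM lee_fin.
have hd : d' *+ #|K| <= d * q.
  rewrite /d' -mulr_natr mulrAC ler_pdivrMr ?ltr0n// ler_pM2l ?mulr_gt0// ler_nat.
  exact: leqnSn.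
by rewrite [leRHS](_ : _ = e * q * E + d * q) ?lerD2l//; ring.
Qed.

End step_functions.

Section rellich.
Context {R : realType} {N : nat}.
Local Notation mu := (lebesgue_rV R N).
Local Notation V := 'rV[R]_N.
Local Notation mes := ((lebesgue_rV R N : {measure set 'rV[R]_N -> \bar R})).

(** Rounding bounded coefficients to multiples of [e] leaves finitely many
    possibilities. *)
Lemma finite_net (K : finType) (c : nat -> K -> R) (B e : R) : 0 < e ->
  (forall n f, `|c n f| <= B) ->
  exists (L : finType) (cl : nat -> L), forall m n, cl m = cl n ->
    forall f, `|c m f - c n f| <= e.
Proof.
move=> e0 cB.
pose t n f := Num.truncn ((c n f + B) / e).
pose L := Num.truncn (2 * B / e).
have cb n f : 0 <= (c n f + B) / e.
  by have := cB n f; rewrite ler_norml => /andP[h _]; rewrite divr_ge0 ?(ltW e0)//; lra.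
have tL n f : (t n f < L.+1)%N.
  rewrite ltnS; apply: le_truncn; rewrite ler_pM2r ?invr_gt0//.
  by have := cB n f; rewrite ler_norml => /andP[_ h]; lra.
exists {ffun K -> 'I_L.+1}, (fun n => [ffun f => Ordinal (tL n f)]) => m n /ffunP h f.
have := h f; rewrite !ffunE => -[tt].
have /andP[a1 a2] := truncn_itv (cb m f); have /andP[b1 b2] := truncn_itv (cb n f).
rewrite -!/(t _ _) tt -!natr1 in a1 a2; rewrite -!/(t _ _) -!natr1 in b1 b2.
move: a1 a2 b1 b2; rewrite !ler_pdivlMr// !ltr_pdivrMr//.
by move=> *; rewrite ler_norml; apply/andP; split; lra.
Qed.

(** Functions of bounded energy are uniformly close to step functions on one
    partition, and step functions with bounded coefficients fall into finitely
    many classes of nearby functions: total boundedness in L^p. *)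
Lemma power_int_classifier p sigma r (E e : R) (w : nat -> V -> R) :
  (0 < N)%N -> 0 < p -> 0 < sigma -> 0 < r -> 0 < e -> 0 <= E ->
  (forall n, measurable_fun setT (w n)) ->
  (forall n, {ae mu, forall x, ~ cube r x -> w n x = 0}) ->
  (forall n, gagliardo_energy sigma p (w n) <= E%:E)%E ->
  (forall n, power_int p (w n) <= E%:E)%E ->
  exists (L : finType) (cl : nat -> L), forall m n, cl m = cl n ->
    (power_int p (w m \- w n)%R <= e%:E)%E.
Proof.
move=> N0 p0 s0 r0 e0 E0 mw w0 wE wP.
pose T : R := 2 `^ p.
have T0 : 0 < T by rewrite powR_gt0.
pose e1 := e / (T * (2 + T * 3)).
have e10 : 0 < e1 by rewrite divr_gt0// mulr_gt0// addr_gt0// mulr_gt0.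
pose e2 := e1 / (E + 1).
have E10 : 0 < E + 1 by lra.
have e20 : 0 < e2 by rewrite divr_gt0.
have [K [Q [q [q0 mQ hq cov [dQ small]]]]] := fine_partition N0 p0 s0 r0 e20.
have hq1 f : (q%:E <= mes (Q f))%E by have /andP[] := hq f.
have /choice[c hc] n := step_approximation mQ dQ p0 q0 e10 (ltW e20) hq1 cov small (mw n) (w0 n) (wE n).
have A n : (power_int p (w n \- step Q (c n))%R <= (2 * e1)%:E)%E.
  apply: (le_trans (hc n)); rewrite lee_fin.
  have : e2 * E <= e1 by rewrite /e2 mulrAC ler_pdivrMr// ler_pM2l//; lra.
  lra.
have mS n : measurable_fun setT (step Q (c n)) by exact: measurable_step.
pose B := (T * (E + 2 * e1) / q) `^ p^-1.
have cB n f : `|c n f| <= B.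
  have h1 := coef_step_le mQ dQ (c n) p0 (hq1 f).
  have h2 : (power_int p (step Q (c n)) <= (T * (E + 2 * e1))%:E)%E.
    have -> : step Q (c n) = w n \- (w n \- step Q (c n)).
      by apply/funext => x /=; rewrite opprB addrC subrK.
    apply: (le_trans (power_intB_le (ltW p0) (mw n) _)); first exact: measurable_funB.
    by rewrite EFinM; apply: lee_wpmul2l; [rewrite lee_fin ltW|rewrite EFinD; exact: leeD].
  have := le_trans h1 h2; rewrite -EFinM lee_fin -ler_pdivlMr// => h3.
  rewrite -[leLHS](powRK (p := p)) ?gt_eqF//.
  by apply: ge0_ler_powR; rewrite ?nnegrE ?powR_ge0 ?invr_ge0 ?(ltW p0)// (le_trans _ h3)// powR_ge0.
have [m [m0 mE]] : exists m : R, 0 <= m /\ (\sum_f mes (Q f) = m%:E)%E.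
  have : (\sum_f mes (Q f) < +oo)%E.
    by apply: lte_sum_pinfty => f _; have /andP[] := hq f.
  by apply: ge0_lty_EFin; apply: sume_ge0.
pose eta := (e1 / (m + 1)) `^ p^-1.
have m10 : 0 < m + 1 by lra.
have eta0 : 0 < eta by rewrite powR_gt0// divr_gt0.
have etap : eta `^ p = e1 / (m + 1) by rewrite powRVK ?gt_eqF// ltW// divr_gt0.
have [L [cl clP]] := finite_net eta0 cB.
exists L, cl => i j /clP hij.
have hS : (power_int p (step Q (c i) \- step Q (c j))%R <= e1%:E)%E.
  apply: (le_trans (power_int_stepB_le mQ dQ p0 (ltW eta0) hij)).
  rewrite mE -EFinM lee_fin etap mulrAC ler_pdivrMr// ler_pM2l//; lra.
have -> : w i \- w j = (w i \- step Q (c i)) \+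
   ((step Q (c i) \- step Q (c j)) \- (w j \- step Q (c j))).
  by apply/funext => x /=; ring.
have mB k : measurable_fun setT (w k \- step Q (c k)) by exact: measurable_funB.
have mSS : measurable_fun setT (step Q (c i) \- step Q (c j)) by exact: measurable_funB.
apply: (le_trans (power_intD_le (ltW p0) (mB i) _)); first exact: measurable_funB.
have h3 := power_intB_le (ltW p0) mSS (mB j).
apply: (@le_trans _ _ (T%:E * ((2 * e1)%:E + (T%:E * (e1%:E + (2 * e1)%:E))))%E).
  apply: lee_wpmul2l; first by rewrite lee_fin ltW.
  apply: leeD => //; apply: (le_trans h3); apply: lee_wpmul2l; first by rewrite lee_fin ltW.
  exact: leeD.
rewrite -!(EFinD, EFinM) lee_fin.
have -> : T * (2 * e1 + T * (e1 + 2 * e1)) = e1 * (T * (2 + T * 3)) by ring.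
by rewrite /e1 mulfVK// gt_eqF// mulr_gt0// addr_gt0// mulr_gt0.
Qed.

(** A diagonal subsequence that is Cauchy at a geometric rate converges almost
    everywhere, and Fatou's lemma upgrades this to convergence in L^p. The
    limit is redefined as zero off [Omega]. *)
Lemma rellich_kolmogorov p sigma (Omega : set V) (E : R) (w : nat -> V -> R) :
  (0 < N)%N -> 0 < p -> 0 < sigma -> 0 <= E ->
  measurable Omega -> bounded_set Omega ->
  (forall n, measurable_fun setT (w n)) ->
  (forall n, {ae mu, forall x, ~ Omega x -> w n x = 0}) ->
  (forall n, gagliardo_energy sigma p (w n) <= E%:E)%E ->
  (forall n, power_int p (w n) <= E%:E)%E ->
  exists phi : nat -> nat, {homo phi : m n / (m < n)%N} /\
  exists u : V -> R, [/\ measurable_fun setT u,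
    forall x, ~ Omega x -> u x = 0,
    {ae mu, forall x, w (phi n) x @[n --> \oo] --> u x} &
    power_int p (w (phi n) \- u)%R @[n --> \oo] --> 0%E].
Proof.
move=> N0 p0 s0 E0 mO /bounded_set_cube[r [r0 Or]] mw w0 wE wP.
pose g j : R := (2^-1 ^+ j) `^ p * 2^-1 ^+ j.
have g0 j : 0 < g j by rewrite mulr_gt0 ?powR_gt0 ?exprn_gt0.
have w0' n : {ae mu, forall x, ~ cube r x -> w n x = 0}.
  by apply: filterS (w0 n) => x h xr; apply: h => /Or.
have [j|phi [hphi phiP]] := @homogeneous_extraction
    (fun j m n => (power_int p (w m \- w n)%R <= (g j)%:E)%E).
  exact: (power_int_classifier N0 p0 s0 r0 (g0 j) E0 mw w0' wE wP).
exists phi; split => //.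
pose v n := w (phi n).
have mv n : measurable_fun setT (v n) by exact: mw.
have vc : {ae mu, forall x, cvgn (v ^~ x)}.
  by apply: (ae_cvg_of_int_le_geometric p0 mv) => n; exact: phiP.
pose u x : R := fine (limn_esup (fun n => (v n x)%:E)) * \1_Omega x.
have mu_ : measurable_fun setT u.
  apply: measurable_funM; last exact: measurable_indic.
  apply: (@measurableT_comp _ _ _ _ _ _ (@fine R)); first exact: fine_measurable.
  apply: measurable_fun_limn_esup => n; exact/measurable_EFinP.
have uO x : ~ Omega x -> u x = 0 by move=> h; rewrite /u indicE memNset ?mulr0.
have vu : {ae mu, forall x, v n x @[n --> \oo] --> u x}.
  apply: filterS2 vc (ae_foralln (fun n => w0 (phi n))) => x /cvg_ex[l vl] wx.
  suff -> : u x = l by [].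
  have [xO|xO] := pselect (Omega x).
    rewrite /u indicE mem_set// mulr1.
    have hx : (fun n => (v n x)%:E) @ \oo --> l%:E.
      by apply: cvg_EFin => //; exact: nearW.
    by rewrite (cvg_limn_einf_sup hx).2.
  rewrite uO//; apply: (@cvg_unique _ (@Rhausdorff R) _ _ _ _ _ vl).
  rewrite (_ : v ^~ x = fun=> 0); first exact: cvg_cst.
  by apply/funext => n; exact: wx.
exists u; split => //.
apply/ge0_cvge0P => [n|e e1]; first exact: power_int_ge0.
have hg j : (power_int p (v j \- u)%R <= (g j)%:E)%E.
  apply: (fatou_ae_le (f := fun i x => `|v j x - v i x| `^ p)).
  - by move=> i; apply: measurable_norm_powR; exact: measurable_funB.
  - by apply: measurable_norm_powR; exact: measurable_funB.
  - by move=> i x; exact: powR_ge0.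
  - by move=> x; exact: powR_ge0.
  - apply: filterS vu => x vx; apply: cvg_norm_powR => //.
    by apply: cvgB => //; exact: cvg_cst.
  - by exists j => // i /= ji; exact: phiP.
have g2 j : g j <= 2^-1 ^+ j.
  rewrite /g -[leRHS]mul1r; apply: ler_wpM2r; first by rewrite exprn_ge0.
  apply: (@le_trans _ _ (1 `^ p)); last by rewrite powR1.
  apply: ge0_ler_powR; rewrite ?nnegrE ?exprn_ge0 ?(ltW p0)//.
  by rewrite exprn_ile1//; lra.
have : geometric 1 (2^-1 : R) @ \oo --> 0.
  by apply: cvg_geometric; rewrite ger0_norm//; lra.
move=> /cvgrPdist_lt/(_ e e1); apply: filterS => n.
rewrite /geometric/= mul1r sub0r normrN ger0_norm ?exprn_ge0// => hn.
apply: (le_lt_trans (hg n)); rewrite lte_fin; exact: le_lt_trans (g2 n) hn.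
Qed.

End rellich.

(** * Explicit families of smooth bumps *)

(** A quadratic error bound is stable under integration in a parameter; so the
    derivative of a convolution can be read off from the kernel. *)
Lemma is_derive_of_quadratic_bound (R : realType) (V : normedModType R) (f : V -> R)
    (a v : V) (l K : R) :
  (forall h : R, `|f (h *: v + a) - f a - h * l| <= K * h ^+ 2) -> is_derive a v f l.
Proof.
move=> H.
have K0 : 0 <= K by have := H 1; rewrite expr1n mulr1; exact: le_trans.
have cv : (fun h : R => h^-1 *: ((f \o shift a) (h *: v) - f a)) @ 0^' --> l.
  apply/cvgrPdist_le => e e0.
  have K1 : 0 < K + 1 by lra.
  near=> h.
  have h0 : h != 0 by near: h; exact: nbhs_dnbhs_neq.
  have hn : 0 < `|h| by rewrite normr_gt0.
  rewrite distrC -(ler_pM2l hn) -normrM mulrBr /= /shift/=.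
  rewrite -[h^-1 *: _]/(h^-1 * _) mulrA divff// mul1r.
  apply: (le_trans (H h)).
  rewrite -real_normK ?num_real// expr2 mulrCA ler_pM2l//.
  apply: (@le_trans _ _ ((K + 1) * `|h|)); first by apply: ler_wpM2r => //; lra.
  rewrite -ler_pdivlMl// mulrC.
  have : `|h| < e / (K + 1); last by move/ltW.
  near: h; apply: dnbhs0_lt; exact: divr_gt0.
apply: DeriveDef; first by apply/cvg_ex; exists l.
exact: cvg_lim cv.
Unshelve. all: by end_near. Qed.

Section flat_function.
Context {R : realType}.
Implicit Types t : R.

(** The functions [t^-n e^(-1/t)], extended by 0: derivatives are linear
    combinations of functions of the same kind, so one lemma on first
    derivatives covers all orders. *)
Definition flat n t : R := if 0 < t then t^-1 ^+ n * expR (- t^-1) else 0.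

Lemma flat_ge0 n t : 0 <= flat n t.
Proof.
rewrite /flat; case: ifPn => // t0.
by rewrite mulr_ge0 ?expR_ge0// exprn_ge0// invr_ge0 ltW.
Qed.

(** The factorial comes from [expR x >= x^n / n!] at [x = 1/t]. *)
Lemma flat_le n t : flat n t <= n`!%:R.
Proof.
rewrite /flat; case: ifPn => [t0|_]; last exact: ler0n.
have s0 : 0 < t^-1 by rewrite invr_gt0.
rewrite expRN ler_pdivrMr ?expR_gt0//.
case: n => [|n].
  by rewrite expr0 fact0 mul1r -expR0 ler_expR ltW.
have := expR_ge1Dxn n (ltW s0).
have f0 : 0 < n.+1`!%:R :> R by rewrite ltr0n fact_gt0.
move=> h; rewrite mulrC -ler_pdivrMr//; lra.
Qed.

Lemma flatS n t : flat n t = flat n.+1 t * t.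
Proof.
rewrite /flat; case: ifPn => [t0|_]; last by rewrite mul0r.
transitivity (t^-1 ^+ n * expR (- t^-1) * (t^-1 * t)).
  by rewrite mulVf ?gt_eqF// mulr1.
by rewrite exprS; ring.
Qed.

(** At the origin the identity [flat n t = flat n.+1 t * t] gives a quadratic
    bound, hence derivative 0. *)
Lemma is_derive_flat n t : is_derive t 1 (flat n) (flat n.+2 t - n%:R * flat n.+1 t).
Proof.
have [t0|t0|->] := ltgtP t 0.
- apply: (@near_eq_is_derive _ _ _ (fun=> 0)) => //; first last.
  - rewrite /flat !ifN ?mulr0 ?subrr -?leNgt ?ltW//; exact: is_derive_cst.
  near=> x; rewrite /flat ifN// -leNgt ltW//; near: x; exact: lt_nbhsl.
- apply: (@near_eq_is_derive _ _ _ ((fun s => s ^+ n * expR (- s)) \o (fun x => x^-1))) => //; first last.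
  - have dV : is_derive t (1:R) (fun x : R => x^-1) (- (t ^- 2)).
      have h := @is_deriveV R id t 1 1 (lt0r_neq0 t0) (is_derive_id _ _).
      by rewrite [_ *: _]mulr1 in h; exact: h.
    have dE (s : R) : is_derive s (1:R) (fun x : R => expR (- x)) (- expR (- s)).
      have h := @is_derive1_comp R expR (fun x => - x) s _ _ (is_derive_expR _) (is_deriveNid _ _).
      by rewrite mulrN1 in h; exact: h.
    have dX (s : R) : is_derive s (1:R) (fun x : R => x ^+ n) (n%:R * s ^+ n.-1).
      have h := @is_deriveX R R id n s 1 1 (is_derive_id _ _).
      by rewrite [_ *: _]mulr1 exprfctE in h; exact: h.
    have dG (s : R) : is_derive s (1:R) (fun x : R => x ^+ n * expR (- x))
        (n%:R * s ^+ n.-1 * expR (- s) - s ^+ n * expR (- s)).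
      have h := @is_deriveM R R _ _ s 1 _ _ (dX s) (dE s).
      apply: is_derive_eq h _.
      by rewrite -[_ *: - _]/(_ * - _) -[expR _ *: _]/(expR _ * _); ring.
    have h := @is_derive1_comp R _ (fun x : R => x^-1) t _ _ (dG t^-1) dV.
    apply: is_derive_eq h _; rewrite /flat t0.
    have -> : t ^- 2 = t^-1 ^+ 2 by rewrite exprVn.
    case: (n) => [|m] /=; first by rewrite mulr0n !mul0r !sub0r subr0 expr0 mul1r mulrNN mulrC.
    by rewrite !exprS expr0 -natr1; move: (t^-1 ^+ m) => S; ring.
  near=> x; rewrite /flat ifT//; near: x; exact: lt_nbhsr.
- rewrite [X in is_derive _ _ _ X](_ : _ = 0); last by rewrite /flat ltxx mulr0 subrr.
  apply: (@is_derive_of_quadratic_bound _ _ _ _ _ _ (n.+2`!%:R)) => h.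
  rewrite mulr0 subr0 addr0 [h *: 1]mulr1 [flat n 0]/flat ltxx subr0.
  rewrite ger0_norm ?flat_ge0// (flatS n) (flatS n.+1) -mulrA -expr2.
  by apply: ler_wpM2r; [exact: sqr_ge0|exact: flat_le].
Unshelve. all: by end_near. Qed.

End flat_function.

Section bump.
Context {R : realType}.
Implicit Types (t c : R) (k : nat).

(** A term [q * flat n (1 + t) * flat m (1 - t)], coded by [(q, (n, m))];
    derivatives of the bump are finite sums of such terms, manipulated as
    lists. *)
Definition bump_term (q : R * (nat * nat)) t : R :=
  q.1 * (flat q.2.1 (1 + t) * flat q.2.2 (1 - t)).

Definition bump_term_deriv (q : R * (nat * nat)) : seq (R * (nat * nat)) :=
  let: (c, (n, m)) := q in
  [:: (c, (n.+2, m)); (- (n%:R * c), (n.+1, m));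
      (- c, (n, m.+2)); (m%:R * c, (n, m.+1))].

Definition bump_sum (s : seq (R * (nat * nat))) t : R :=
  foldr (fun q y => bump_term q t + y) 0 s.

Lemma bump_sum_cat s1 s2 t : bump_sum (s1 ++ s2) t = bump_sum s1 t + bump_sum s2 t.
Proof. by elim: s1 => [|q s1 ih] /=; rewrite ?add0r// ih addrA. Qed.

Lemma is_derive_bump_term q t : is_derive t 1 (bump_term q) (bump_sum (bump_term_deriv q) t).
Proof.
case: q => [c [n m]].
have dp : is_derive t (1:R) (fun x : R => 1 + x) (0 + 1).
  exact: (is_deriveD (is_derive_cst _ _ _) (is_derive_id _ _)).
have dm : is_derive t (1:R) (fun x : R => 1 - x) (0 - 1).
  exact: (is_deriveB (is_derive_cst _ _ _) (is_derive_id _ _)).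
have d1 := @is_derive1_comp R (flat n) _ t _ _ (is_derive_flat n (1 + t)) dp.
have d2 := @is_derive1_comp R (flat m) _ t _ _ (is_derive_flat m (1 - t)) dm.
have d3 := @is_deriveM R R _ _ t 1 _ _ d1 d2.
have d4 := @is_deriveM R R _ _ t 1 _ _ (is_derive_cst c t 1) d3.
apply: is_derive_eq d4 _; rewrite /= /bump_term/=.
rewrite scaler0 add0r.
rewrite -![_ *: _]/(_ * _); ring.
Qed.

Lemma is_derive_bump_sum s t :
  is_derive t 1 (bump_sum s) (bump_sum (flatten (map bump_term_deriv s)) t).
Proof.
elim: s => [|q s ih]; first exact: is_derive_cst.
rewrite [map _ _]/= [flatten _]/= bump_sum_cat.
exact: (is_deriveD (is_derive_bump_term q t) ih).
Qed.

Definition bump_seq k := iter k (fun s => flatten (map bump_term_deriv s)) [:: (1:R, (0, 0)%N)].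

Definition bump k t : R := bump_sum (bump_seq k) t.

Lemma is_derive_bump k t : is_derive t 1 (bump k) (bump k.+1 t).
Proof. exact: is_derive_bump_sum. Qed.

Lemma bump_sum_bounded s : exists M : R, forall t, `|bump_sum s t| <= M.
Proof.
elim: s => [|[c [n m]] s [M hM]]; first by exists 0 => t; rewrite normr0.
exists (`|c| * (n`!%:R * m`!%:R) + M) => t /=.
apply: (le_trans (ler_normD _ _)); apply: lerD => //.
rewrite /bump_term/= normrM; apply: ler_wpM2l => //.
rewrite ger0_norm ?mulr_ge0 ?flat_ge0//.
by apply: ler_pM; rewrite ?flat_ge0 ?flat_le.
Qed.

Lemma bump_sum_out s t : 1 <= `|t| -> bump_sum s t = 0.
Proof.
move=> t1; elim: s => [//|[c [n m]] s /= ->]; rewrite addr0 /bump_term/=.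
move: t1; rewrite ler_normr => /orP[t1|t1].
  by rewrite [flat m _]/flat ifN ?mulr0// -leNgt; lra.
by rewrite [flat n _]/flat ifN ?mul0r ?mulr0// -leNgt; lra.
Qed.

Lemma bump0E t : bump 0 t = flat 0 (1 + t) * flat 0 (1 - t).
Proof. by rewrite /bump/= addr0 /bump_term/= mul1r. Qed.

(** A function together with all its derivatives, with the support, symmetry
    and size needed for mollifying at scale [e]. The lower bound [beta] on the
    half-width is kept separate because it must not degenerate as [e] tends to
    0. *)
Definition bump_family (b : nat -> R -> R) (e : R) (M : nat -> R) (beta : R) :=
  [/\ forall k t, is_derive t 1 (b k) (b k.+1 t),
      forall k t, `|b k t| <= M k,
      forall k t, e <= `|t| -> b k t = 0,
      forall t, 0 <= b 0%N t <= 1 /\ b 0%N (- t) = b 0%N t &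
      forall t, `|t| <= e / 2 -> beta <= b 0%N t].

(** Rescaling of a single bump; the lower bound is independent of the scale.
    *)
Lemma exists_bump_family : exists2 beta : R, 0 < beta &
  forall e : R, 0 < e -> exists b M, (forall k, 1 <= M k) /\ bump_family b e M beta.
Proof.
exists (expR (- 2) * expR (- 2)); first by rewrite mulr_gt0 ?expR_gt0.
move=> e e0.
exists (fun k t => e^-1 ^+ k * bump k (e^-1 * t)).
have /choice[M hM] k : exists M : R, 1 <= M /\ forall t, `|e^-1 ^+ k * bump k (e^-1 * t)| <= M.
  have [M hM] := bump_sum_bounded (bump_seq k).
  exists (Num.max 1 (e^-1 ^+ k * M)); rewrite le_max lexx; split => // t.
  have ek0 : 0 <= e^-1 ^+ k by rewrite exprn_ge0// invr_ge0 ltW.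
  rewrite le_max; apply/orP; right; rewrite normrM (ger0_norm ek0).
  apply: ler_wpM2l => //; exact: hM.
exists M; split; first by move=> k; have [] := hM k.
split.
- move=> k t.
  have d1 : is_derive t (1:R) (fun x : R => e^-1 * x) (e^-1 *: 1).
    exact: (@is_deriveZ R R R id e^-1 t 1 1 (is_derive_id _ _)).
  have d2 := @is_derive1_comp R (bump k) _ t _ _ (is_derive_bump k (e^-1 * t)) d1.
  have d3 := @is_deriveZ R R R _ (e^-1 ^+ k) t 1 _ d2.
  apply: is_derive_eq d3 _; rewrite -![_ *: _]/(_ * _) exprS; ring.
- by move=> k; have [] := hM k.
- move=> k t et; rewrite /bump bump_sum_out ?mulr0//.
  by rewrite normrM gtr0_norm ?invr_gt0// mulrC ler_pdivlMr ?mul1r.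
- move=> t; rewrite !expr0 !mul1r !bump0E; split.
    rewrite mulr_ge0 ?flat_ge0//= -[leRHS]mulr1.
    by apply: ler_pM; rewrite ?flat_ge0// (le_trans (flat_le _ _)).
  by rewrite mulrN opprK mulrC.
move=> t te; rewrite expr0 mul1r bump0E.
have : `|e^-1 * t| <= 1 / 2.
  rewrite normrM gtr0_norm ?invr_gt0// mulrC ler_pdivrMr//; lra.
rewrite ler_norml => /andP[h1 h2].
have fl (x : R) : 1 / 2 <= x -> expR (- 2) <= flat 0 x.
  move=> x2; have x0 : 0 < x by lra.
  rewrite /flat x0 expr0 mul1r ler_expR lerN2.
  by rewrite -[leRHS]invrK lef_pV2 ?posrE ?invr_gt0//; lra.
by apply: ler_pM; rewrite ?expR_ge0//; apply: fl; lra.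
Qed.

Lemma bump_family_lip b e M beta k t t' : bump_family b e M beta ->
  `|b k t - b k t'| <= M k.+1 * `|t - t'|.
Proof.
move=> [db bM _ _ _]; wlog tt : t t' / t' <= t.
  move=> h; have [|/ltW] := leP t' t; first exact: h.
  by move/h; rewrite distrC [`|t' - t|]distrC.
have [|x xt ->] := @MVT_segment R (b k) (b k.+1) t' t tt.
- apply: derivable_within_continuous => x _.
  by have [] := db k x.
by rewrite normrM; apply: ler_wpM2r.
Qed.

(** Mean value theorem applied twice. *)
Lemma bump_family_taylor b e M beta k t h : bump_family b e M beta ->
  `|b k (t + h) - b k t - h * b k.+1 t| <= M k.+2 * h ^+ 2.
Proof.
move=> fam; have [db bM _ _ _] := fam.
have key : exists x, `|x - t| <= `|h| /\ b k (t + h) - b k t = h * b k.+1 x.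
  have [h0|h0] := leP 0 h.
    have th : t <= t + h by rewrite lerDl.
    have [|x xt ->] := @MVT_segment R (b k) (b k.+1) t (t + h) th.
    - by apply: derivable_within_continuous => x _; have [] := db k x.
    exists x; split; last by ring.
    move: xt; rewrite in_itv/= => /andP[x1 x2]; rewrite !ger0_norm//; lra.
  have th : t + h <= t by rewrite gerDl ltW.
  have [|x xt E] := @MVT_segment R (b k) (b k.+1) (t + h) t th.
  - by apply: derivable_within_continuous => x _; have [] := db k x.
  exists x; split; last first.
    by rewrite -[LHS]opprK opprB E; ring.
  move: xt; rewrite in_itv/= => /andP[x1 x2].
  by rewrite (ltr0_norm h0) ler_norml; apply/andP; split; lra.
have [x [xt ->]] := key.
rewrite -mulrBr normrM.
apply: (@le_trans _ _ (`|h| * (M k.+2 * `|x - t|))).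
  by apply: ler_wpM2l => //; exact: (bump_family_lip k.+1 x t fam).
have M0 : 0 <= M k.+2 by exact: le_trans (bM k.+2 0).
rewrite mulrCA; apply: ler_wpM2l => //.
by rewrite -[h ^+ 2]real_normK ?num_real// expr2; apply: ler_wpM2l.
Qed.

End bump.

(** * Convolution with bumps *)

Lemma lipschitz_bound_continuous (R : realType) (V : normedModType R) (f : V -> R) (L : R) :
  (forall x y, `|f x - f y| <= L * `|x - y|) -> continuous f.
Proof.
move=> fL x; apply/cvgrPdist_lt => e e0.
have L1 : 0 < `|L| + 1 by rewrite ltr_wpDl.
have d0 : 0 < e / (`|L| + 1) by rewrite divr_gt0.
near=> y.
apply: (le_lt_trans (fL x y)).
have h : `|x - y| < e / (`|L| + 1).
  by near: y; have /cvgrPdist_lt := @cvg_id _ (nbhs x); exact.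
apply: (@le_lt_trans _ _ ((`|L| + 1) * `|x - y|)).
  apply: ler_wpM2r => //; have := ler_norm L; lra.
by rewrite -ltr_pdivlMl// mulrC.
Unshelve. all: by end_near. Qed.

(** Telescoping, one factor at a time. *)
Lemma prod_diff_le (R : realType) (I : Type) (r : seq I) (a b M : I -> R) :
  (forall i, 1 <= M i) -> (forall i, `|a i| <= M i) -> (forall i, `|b i| <= M i) ->
  `|\prod_(i <- r) a i - \prod_(i <- r) b i| <=
    (\prod_(i <- r) M i) * \sum_(i <- r) `|a i - b i|.
Proof.
move=> M1 aM bM; elim: r => [|i r ih]; first by rewrite !big_nil subrr normr0 mulr0.
rewrite !big_cons.
set A := \prod_(j <- r) a j in ih *; set B := \prod_(j <- r) b j in ih *.
set P := \prod_(j <- r) M j in ih *; set S := \sum_(j <- r) _ in ih *.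
have P0 : 0 <= P by apply: prodr_ge0 => j _; exact: le_trans (M1 j).
have AP : `|A| <= P by rewrite /A normr_prod; apply: ler_prod => j _; rewrite normr_ge0 aM.
rewrite (_ : a i * A - b i * B = (a i - b i) * A + b i * (A - B)); last by ring.
apply: (le_trans (ler_normD _ _)); rewrite !normrM.
apply: (@le_trans _ _ (`|a i - b i| * P + M i * (P * S))).
  by apply: lerD; [exact: ler_wpM2l|exact: ler_pM].
rewrite [leRHS](_ : _ = M i * (`|a i - b i| * P) + M i * (P * S)); last by ring.
by rewrite lerD2r ler_peMl// mulr_ge0.
Qed.

Section multi_bump.
Context {R : realType} {N : nat}.
Local Notation V := 'rV[R]_N.
Context (b : nat -> R -> R) (e : R) (M : nat -> R) (beta : R).
Context (e0 : 0 < e) (M1 : forall k, 1 <= M k) (fam : bump_family b e M beta).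
Implicit Types (alpha : 'I_N -> nat) (x y z : V).

(** A partial derivative of a tensor product of one-dimensional bumps; the
    multi-index says how often each factor has been differentiated. *)
Definition mbump alpha z : R := \prod_i b (alpha i) (z ord0 i).

Definition incr alpha (i : 'I_N) (j : 'I_N) : nat := (alpha j + (j == i))%N.

Lemma mbump_le alpha z : `|mbump alpha z| <= \prod_i M (alpha i).
Proof.
have [_ bM _ _ _] := fam.
by rewrite /mbump normr_prod; apply: ler_prod => j _; rewrite normr_ge0 bM.
Qed.

Lemma mbump_out alpha z : e <= `|z| -> mbump alpha z = 0.
Proof.
have [_ _ bo _ _] := fam.
move=> ez; suff [i ei] : exists i, e <= `|z ord0 i|.
  by rewrite /mbump (bigD1 i)//= bo ?mul0r.
apply: contrapT => /forallNP h; move: ez; rewrite leNgt => /negP; apply.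
by apply/rV_norm_ltP => // i; rewrite ltNge; apply/negP; exact: h.
Qed.

Lemma mbump_lip alpha : exists L, forall z z', `|mbump alpha z - mbump alpha z'| <= L * `|z - z'|.
Proof.
have [_ bM _ _ _] := fam.
exists ((\prod_i M (alpha i)) * \sum_i M (alpha i).+1) => z z'.
apply: (le_trans (@prod_diff_le _ _ _ _ _ (fun i => M (alpha i)) _ _ _)) => [i|i|i|].
- exact: M1.
- exact: bM.
- exact: bM.
rewrite -mulrA; apply: ler_wpM2l.
  by apply: prodr_ge0 => j _; exact: le_trans (M1 _).
rewrite mulr_suml; apply: ler_sum => i _.
apply: (le_trans (bump_family_lip (alpha i) _ _ fam)).
apply: ler_wpM2l; first exact: le_trans (M1 _).
by have := rV_coord_le_norm (z - z') i; rewrite !mxE.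
Qed.

Lemma measurable_mbump alpha : measurable_fun setT (mbump alpha).
Proof.
apply: continuous_measurable_rV; have [L hL] := mbump_lip alpha.
exact: lipschitz_bound_continuous hL.
Qed.

(** Only one factor changes along a coordinate direction. *)
Lemma mbump_taylor alpha (i : 'I_N) : exists K, forall z h,
  `|mbump alpha (h *: delta_mx ord0 i + z) - mbump alpha z - h * mbump (incr alpha i) z|
    <= K * h ^+ 2.
Proof.
have [_ bM _ _ _] := fam.
exists (M (alpha i).+2 * \prod_(j | j != i) M (alpha j)) => z h.
rewrite /mbump (bigD1 i)//= [in X in _ - X - _](bigD1 i)//= [in X in _ - _ - X](bigD1 i)//=.
have e1 : (h *: delta_mx ord0 i + z) ord0 i = z ord0 i + h.
  by rewrite !mxE !eqxx mulr1 addrC.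
have e2 : \prod_(j | j != i) b (alpha j) ((h *: delta_mx ord0 i + z) ord0 j) =
    \prod_(j | j != i) b (alpha j) (z ord0 j).
  by apply: eq_bigr => j ji; rewrite !mxE (negbTE ji) andbF mulr0 add0r.
have e3 : \prod_(j | j != i) b (incr alpha i j) (z ord0 j) =
    \prod_(j | j != i) b (alpha j) (z ord0 j).
  by apply: eq_bigr => j ji; rewrite /incr (negbTE ji) addn0.
rewrite e1 e2 e3 /incr eqxx addn1.
set P := \prod_(j | j != i) b (alpha j) (z ord0 j).
have PM : `|P| <= \prod_(j | j != i) M (alpha j).
  by rewrite /P normr_prod; apply: ler_prod => j _; rewrite normr_ge0 bM.
rewrite mulrA -!mulrBl normrM mulrAC; apply: ler_pM => //.
exact: bump_family_taylor fam.
Qed.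

Definition mbump0 := mbump (fun=> 0%N).

Lemma mbump0_ge0 z : 0 <= mbump0 z.
Proof.
have [_ _ _ b0 _] := fam.
by apply: prodr_ge0 => i _; have [/andP[]] := b0 (z ord0 i).
Qed.

Lemma mbump0_le1 z : mbump0 z <= 1.
Proof.
have [_ _ _ b0 _] := fam.
apply: (@le_trans _ _ (\prod_(i < N) 1)); last by rewrite big1.
by apply: ler_prod => i _; have [] := b0 (z ord0 i).
Qed.

Lemma mbump0N z : mbump0 (- z) = mbump0 z.
Proof.
have [_ _ _ b0 _] := fam.
by apply: eq_bigr => i _; rewrite mxE; have [] := b0 (z ord0 i).
Qed.

Lemma mbump0_ge z : 0 <= beta -> `|z| <= e / 2 -> beta ^+ N <= mbump0 z.
Proof.
have [_ _ _ _ bb] := fam.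
move=> be0 ze.
have -> : beta ^+ N = \prod_(i < N) beta by rewrite prodr_const card_ord.
by apply: ler_prod => i _; rewrite be0 bb// (le_trans (rV_coord_le_norm z i)).
Qed.

End multi_bump.

Section convolution.
Context {R : realType} {N : nat}.
Local Notation mu := (lebesgue_rV R N).
Local Notation V := 'rV[R]_N.
Context (b : nat -> R -> R) (e : R) (M : nat -> R) (beta : R).
Context (e0 : 0 < e) (M1 : forall k, 1 <= M k) (fam : bump_family b e M beta).
Context (w : V -> R) (iw : mu.-integrable setT (EFin \o w)).
Implicit Types (alpha : 'I_N -> nat) (x y z : V) (g : V -> R).

Let mw : measurable_fun setT w.
Proof. by apply/measurable_EFinP; exact: measurable_int iw. Qed.

Lemma integrable_bounded_mul g (C : R) : measurable_fun setT g ->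
  (forall y, `|g y| <= C) -> mu.-integrable setT (EFin \o (fun y => w y * g y)).
Proof.
move=> mg gC.
have iC : mu.-integrable setT (fun y => C%:E * (w y)%:E)%E by exact: integrableZl.
apply: le_integrable iC => //.
  by apply/measurable_EFinP; exact: measurable_funM.
move=> y _ /=; rewrite lee_fin !normrM mulrC; apply: ler_wpM2r => //.
exact: le_trans (gC y) (ler_norm _).
Qed.

Definition wnorm1 := (\int[mu]_y `|w y|)%R.

Lemma Rintegral_bounded_mul g (C : R) : measurable_fun setT g ->
  (forall y, `|g y| <= C) -> `|(\int[mu]_y (w y * g y))%R| <= C * wnorm1.
Proof.
move=> mg gC; have ig := integrable_bounded_mul mg gC.
have iC : mu.-integrable setT (fun y => (C * `|w y|)%:E)%E.
  have := integrableZl measurableT C (integrable_abse iw).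
  by congr integrable; apply/funext => y /=; rewrite EFinM.
have inw : mu.-integrable setT (EFin \o (fun y => `|w y|)).
  exact: (integrable_abse iw).
apply: (le_trans (le_normr_Rintegral measurableT ig)).
rewrite /wnorm1 -RintegralZl//; apply: le_Rintegral => //.
  exact: (integrable_abse ig).
move=> y _; rewrite normrM mulrC; apply: ler_wpM2r => //.
Qed.

Definition conv alpha x : R := (\int[mu]_y (w y * mbump b alpha (x - y)))%R.

Let mshift alpha x : measurable_fun setT (fun y : V => mbump b alpha (x - y)).
Proof.
apply: (measurableT_comp (measurable_mbump M1 fam alpha)).
by apply: measurable_fun_rV_sub.
Qed.

Lemma conv_lip alpha : exists L, forall x x', `|conv alpha x - conv alpha x'| <= L * `|x - x'|.
Proof.
have [L hL] := mbump_lip M1 fam (N := N) alpha.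
exists (L * wnorm1) => x x'.
have i1 := integrable_bounded_mul (mshift alpha x) (fun y => mbump_le fam alpha (x - y)).
have i2 := integrable_bounded_mul (mshift alpha x') (fun y => mbump_le fam alpha (x' - y)).
rewrite /conv -RintegralB//.
under eq_Rintegral do rewrite -mulrBr.
rewrite mulrAC; apply: Rintegral_bounded_mul.
  exact: measurable_funB.
by move=> y; apply: (le_trans (hL _ _)); rewrite opprB addrA subrK.
Qed.

Lemma continuous_conv alpha : continuous (conv alpha).
Proof. have [L hL] := conv_lip alpha; exact: lipschitz_bound_continuous hL. Qed.

(** The uniform quadratic error of the kernel is integrated against [|w|]. *)
Lemma is_derive_conv alpha (i : 'I_N) x :
  is_derive x (delta_mx ord0 i) (conv alpha) (conv (incr alpha i) x).
Proof.
have [K hK] := mbump_taylor fam alpha i.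
apply: (@is_derive_of_quadratic_bound _ _ _ _ _ _ (K * wnorm1)) => h.
have i1 := integrable_bounded_mul (mshift alpha (h *: delta_mx ord0 i + x))
  (fun y => mbump_le fam alpha _).
have i2 := integrable_bounded_mul (mshift alpha x) (fun y => mbump_le fam alpha _).
have i3 := integrable_bounded_mul (mshift (incr alpha i) x) (fun y => mbump_le fam _ _).
rewrite /conv -RintegralB// -RintegralZl//.
rewrite -RintegralB//; last 2 first.
- have := integrableB measurableT i1 i2; by congr integrable.
- have := integrableZl measurableT h i3; by congr integrable.
rewrite (_ : (fun y => _) = fun y => w y * (mbump b alpha (h *: delta_mx ord0 i + x - y) -
   mbump b alpha (x - y) - h * mbump b (incr alpha i) (x - y))); last first.
  by apply/funext => y; ring.
rewrite mulrAC; apply: Rintegral_bounded_mul.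
  apply: measurable_funB; first exact: measurable_funB.
  exact: measurable_funM.
by move=> y; have := hK (x - y) h; rewrite addrA.
Qed.

Definition multi_index (l : seq 'I_N) : 'I_N -> nat :=
  foldr (fun i alpha => incr alpha i) (fun=> 0%N) l.

(** Differentiating the convolution only raises the multi-index of the kernel,
    so one derivative settles all orders. *)
Lemma partials_conv l : partials l (conv (fun=> 0%N)) = conv (multi_index l).
Proof.
elim: l => [//|i l ih]; rewrite [LHS]/= -/(partials l _) ih.
by apply/funext => x; have [_ ->] := is_derive_conv (multi_index l) i x.
Qed.

Lemma smooth_conv : smooth_on setT (conv (fun=> 0%N)).
Proof.
move=> l x _; rewrite partials_conv; split; first exact: continuous_conv.
by move=> i; have [] := is_derive_conv (multi_index l) i x.
Qed.

Lemma conv_out (A : set V) x : (forall y, ~ A y -> w y = 0) ->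
  (forall y, A y -> e <= `|x - y|) -> conv (fun=> 0%N) x = 0.
Proof.
move=> wA Ax; rewrite /conv (_ : (fun y => _) = fun=> 0).
  by rewrite /Rintegral integral0.
apply/funext => y; have [Ay|Ay] := pselect (A y); last by rewrite wA ?mul0r.
by rewrite (mbump_out e0 fam) ?mulr0//; exact: Ax.
Qed.

End convolution.

(** * Mollification and energy *)

Section jensen.
Context d (T : measurableType d) (R : realType) (mu : {measure set T -> \bar R}).

(** Young's inequality between [|a x|] and [A^(p-1)], with [A] the mean of
    [|a|], integrated against the probability density [rho]. *)
Lemma jensen_powR (p : R) (rho a : T -> R) : 1 < p ->
  measurable_fun setT rho -> measurable_fun setT a -> (forall x, 0 <= rho x) ->
  (\int[mu]_x (rho x)%:E = 1)%E ->
  mu.-integrable setT (EFin \o (fun x => a x * rho x)) ->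
  ((`|(\int[mu]_x (a x * rho x))%R| `^ p)%:E <= \int[mu]_x (rho x * `|a x| `^ p)%:E)%E.
Proof.
move=> p1 mrho ma rho0 rho1 ia.
have p0 : 0 < p by lra.
have pm0 : 0 < p - 1 by lra.
set I := (\int[mu]_x (rho x * `|a x| `^ p)%:E)%E.
have I0 : (0 <= I)%E by apply: int_ge0 => x; rewrite mulr_ge0 ?powR_ge0.
have [Ifin|] := boolP (I \is a fin_num); last first.
  by rewrite ge0_fin_numE// -leNgt leye_eq => /eqP ->; rewrite leey.
have iabs : mu.-integrable setT (EFin \o (fun x => `|a x * rho x|)).
  exact: (integrable_abse ia).
set A := (\int[mu]_x `|a x * rho x|)%R.
have A0 : 0 <= A by apply: Rintegral_ge0.
have AE : (\int[mu]_x (`|a x| * rho x)%:E)%E = A%:E.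
  rewrite /A /Rintegral fineK; last exact: (integrable_fin_num measurableT iabs).
  by apply: eq_integral => x _; rewrite normrM (ger0_norm (rho0 x)).
apply: (@le_trans _ _ (A `^ p)%:E).
  rewrite lee_fin; apply: ge0_ler_powR; rewrite ?nnegrE ?(ltW p0)//.
  exact: le_normr_Rintegral.
have [A00|Apos] := eqVneq A 0; first by rewrite A00 powR0 ?gt_eqF.
have {A0}Apos : 0 < A by rewrite lt_neqAle eq_sym Apos.
pose q := p / (p - 1).
have q0 : 0 < q by rewrite divr_gt0.
have pq : p^-1 + q^-1 = 1.
  by rewrite /q invf_div -[X in X + _]mul1r -mulrDl addrC subrK divff// gt_eqF.
have AqE : (A `^ (p - 1)) `^ q = A `^ p.
  by rewrite -powRrM /q mulrCA divff ?mulr1// gt_eqF.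
have AAE : A * A `^ (p - 1) = A `^ p by rewrite mulr_powRB1 ?(ltW Apos).
have mabs : measurable_fun setT (fun x => `|a x|) by exact: measurableT_comp.
have mpow : measurable_fun setT (fun x => `|a x| `^ p).
  exact: measurable_norm_powR.
have ar0 x : 0 <= `|a x| * rho x by rewrite mulr_ge0.
have mar : measurable_fun setT (fun x => `|a x| * rho x) by exact: measurable_funM.
have rp0 x : 0 <= rho x * `|a x| `^ p by rewrite mulr_ge0 ?powR_ge0.
have mrp : measurable_fun setT (fun x => rho x * `|a x| `^ p) by exact: measurable_funM.
have pV0 : 0 <= p^-1 by rewrite invr_ge0 ltW.
have Aq0 : 0 <= A `^ p / q by rewrite divr_ge0 ?powR_ge0 ?(ltW q0).
have key : ((A `^ p)%:E <= (p^-1)%:E * I + (A `^ p / q)%:E)%E.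
  have -> : ((A `^ p)%:E = \int[mu]_x ((A `^ (p - 1)) * (`|a x| * rho x))%:E)%E.
    by rewrite (intZ mu (powR_ge0 _ _) ar0 mar) AE -EFinM mulrC AAE.
  have -> : ((A `^ p / q)%:E = \int[mu]_x ((A `^ p / q) * rho x)%:E)%E.
    by rewrite (intZ mu Aq0 rho0 mrho) rho1 mule1.
  rewrite -(intZ mu pV0 rp0 mrp) -intD//.
  - apply: int_le.
    + by move=> x; rewrite mulr_ge0 ?powR_ge0.
    + exact: measurable_funM.
    + by apply: measurable_funD; exact: measurable_funM.
    move=> x; have := conjugate_powR (normr_ge0 (a x)) (powR_ge0 A (p - 1)) p0 q0 pq.
    rewrite AqE => h.
    rewrite (_ : A `^ (p - 1) * _ = rho x * (`|a x| * A `^ (p - 1))); last by ring.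
    rewrite (_ : p^-1 * _ + _ = rho x * (`|a x| `^ p / p + A `^ p / q)); last by ring.
    exact: ler_wpM2l.
  - by move=> x; rewrite mulr_ge0.
  - by move=> x; rewrite mulr_ge0.
  - exact: measurable_funM.
  - exact: measurable_funM.
move: key; rewrite -(fineK Ifin) -EFinM -EFinD !lee_fin => key.
have hq : q^-1 = 1 - p^-1 by rewrite -pq addrC addKr.
move: key; rewrite hq => key.
have : A `^ p / p <= p^-1 * fine I by lra.
by rewrite mulrC ler_pM2l ?invr_gt0.
Qed.

End jensen.

Section mollifier.
Context {R : realType} {N : nat}.
Local Notation mu := (lebesgue_rV R N).
Local Notation mm := (lebesgue_rV R N \x lebesgue_rV R N)%E.
Local Notation V := 'rV[R]_N.

Lemma Rintegral_shift (a : V) (f : V -> R) : measurable_fun setT f ->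
  (\int[mu]_x f (x + a))%R = (\int[mu]_x f x)%R.
Proof.
move=> mf; rewrite /Rintegral; congr fine.
have mF : measurable_fun setT (fun x => (f x)%:E) by exact/measurable_EFinP.
rewrite integralE [RHS]integralE; congr (_ - _)%E.
- have h := @integral_translation R N a ((fun x => (f x)%:E)^\+)%E (measurable_funepos mF).
  by rewrite -h//; apply: eq_integral => x _; rewrite !funeposE.
- have h := @integral_translation R N a ((fun x => (f x)%:E)^\-)%E (measurable_funeneg mF).
  by rewrite -h//; apply: eq_integral => x _; rewrite !funenegE.
Qed.

(** The double integral is first written as an iterated one, so that only
    products with the Lebesgue measure itself have to be exchanged. *)
Lemma tonelli_prod_swap (F : (V * V) * V -> R) : measurable_fun setT F ->
  (forall t, 0 <= F t) ->
  (\int[mm]_z \int[mu]_y (F (z, y))%:E = \int[mu]_y \int[mm]_z (F (z, y))%:E)%E.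
Proof.
move=> mF F0.
have mFE : measurable_fun setT (fun t => (F t)%:E) by exact/measurable_EFinP.
have F0E t : (0 <= (F t)%:E)%E by rewrite lee_fin.
rewrite fubini_tonelli1; last 2 first.
- exact: (@measurable_fun_fubini_tonelli_F _ _ _ V R mu _ mFE F0E).
- by move=> z; exact: int_ge0.
pose F' (t : (V * V) * V) := F ((t.1.1, t.2), t.1.2).
have mF' : measurable_fun setT F'.
  apply: (measurableT_comp mF); apply: measurable_fun_pair.
    apply: measurable_fun_pair; last exact: measurable_snd.
    exact: (measurableT_comp measurable_fst measurable_fst).
  exact: (measurableT_comp measurable_snd measurable_fst).
have mFE' : measurable_fun setT (fun t => (F' t)%:E) by exact/measurable_EFinP.
have F0E' t : (0 <= (F' t)%:E)%E by rewrite lee_fin; exact: F0.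
pose H (t : V * V) := (\int[mu]_y (F' (t, y))%:E)%E.
have mH : measurable_fun setT H.
  exact: (@measurable_fun_fubini_tonelli_F _ _ _ V R mu _ mFE' F0E').
have H0 t : (0 <= H t)%E by apply: int_ge0 => y; exact: F0.
transitivity (\int[mu]_x \int[mu]_z H (x, z))%E.
  apply: eq_integral => x _; rewrite /fubini_F/=.
  have mx : measurable_fun setT (fun t : V * V => (F ((x, t.1), t.2))%:E).
    apply/measurable_EFinP; apply: (measurableT_comp mF); apply: measurable_fun_pair => //.
    by apply: measurable_fun_pair.
  have h := fubini_tonelli (m1 := mu) (m2 := mu) _ mx (fun t => F0E (x, t.1, t.2)).
  transitivity (\int[mu]_y \int[mu]_z (F (x, y, z))%:E)%E; first by [].
  transitivity (\int[mu]_z \int[mu]_y (F (x, y, z))%:E)%E; last by [].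
  exact: h.
have h := fubini_tonelli (m1 := mu) (m2 := mu) _ mH H0.
rewrite /fubini_F /fubini_G /= in h; rewrite h.
apply: eq_integral => y _.
have my : measurable_fun setT (fun z : V * V => (F (z, y))%:E).
  by apply/measurable_EFinP; apply: (measurableT_comp mF); exact: measurable_fun_pair.
by rewrite (fubini_tonelli1 _ my (fun z => F0E (z, y))); apply: eq_integral.
Qed.

(** On a set of finite measure L^p is contained in L^1. *)
Lemma integrable_of_power_int (p r : R) (w : V -> R) : 1 < p -> measurable_fun setT w ->
  (forall x, ~ cube r x -> w x = 0) -> (power_int p w < +oo)%E ->
  mu.-integrable setT (EFin \o w).
Proof.
move=> p1 mw w0 Pw; apply/integrableP; split; first exact/measurable_EFinP.
have mi : measurable_fun setT (\1_(cube r) : V -> R).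
  by apply: measurable_indic; exact: measurable_cube.
have mp := measurable_norm_powR p mw.
apply: (@le_lt_trans _ _ (\int[mu]_x (\1_(cube r) x + `|w x| `^ p)%:E)%E).
  apply: int_le => //.
  - exact: measurableT_comp.
  - exact: measurable_funD.
  move=> x; have [xr|xr] := pselect (cube r x); last first.
    by rewrite w0// normr0 addr_ge0 ?powR_ge0.
  rewrite indicE mem_set//=; have [h|h] := leP `|w x| 1.
    by apply: (le_trans h); rewrite lerDl powR_ge0.
  by apply: (le_trans (le1r_powR (ltW h) (ltW p1))); rewrite lerDr.
rewrite intD//.
apply: lte_add_pinfty; last exact: Pw.
rewrite integral_indic//; last exact: measurable_cube.
by rewrite setIT; exact: cube_measure_lty.
Qed.

Lemma measurable_shift2 (f : V * V -> R) (a : V) : measurable_fun setT f ->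
  measurable_fun setT (fun z : V * V => f (z.1 + a, z.2 + a)).
Proof.
move=> mf; apply: (measurableT_comp mf); apply: measurable_fun_pair.
- by apply: measurable_fun_rV_add; [exact: measurable_fst|exact: measurable_cst].
- by apply: measurable_fun_rV_add; [exact: measurable_snd|exact: measurable_cst].
Qed.

Lemma integral_prod_shift (f : V * V -> R) (a : V) : measurable_fun setT f ->
  (forall z, 0 <= f z) ->
  (\int[mm]_z (f (z.1 + a, z.2 + a))%:E = \int[mm]_z (f z)%:E)%E.
Proof.
move=> mf f0.
have mF : measurable_fun setT (fun z => (f z)%:E) by exact/measurable_EFinP.
have mS : measurable_fun setT (fun z : V * V => (f (z.1 + a, z.2 + a))%:E).
  by apply/measurable_EFinP; exact: measurable_shift2.
have f0E z : (0 <= (f z)%:E)%E by rewrite lee_fin.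
rewrite (fubini_tonelli1 _ mS (fun z => f0E _)) (fubini_tonelli1 _ mF f0E).
pose g x := (\int[mu]_y (f (x, y))%:E)%E.
transitivity (\int[mu]_x g (x + a)%R)%E.
  apply: eq_integral => x _; rewrite /fubini_F/= /g.
  apply: (integral_shift a (f := fun y => f (x + a, y))) => //.
  exact: (measurableT_comp mf).
apply: (integral_translation a (f := g)).
  exact: (@measurable_fun_fubini_tonelli_F _ _ V V R mu (fun z => (f z)%:E) mF f0E).
by move=> x; exact: int_ge0.
Qed.

Context (b : nat -> R -> R) (e : R) (M : nat -> R) (beta : R).
Context (e0 : 0 < e) (M1 : forall k, 1 <= M k) (fam : bump_family b e M beta) (beta0 : 0 < beta).

Let mb := mbump0 b (N := N).
Let mmb : measurable_fun setT mb. Proof. exact: (measurable_mbump M1 fam). Qed.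
Let mb0 z : 0 <= mb z. Proof. exact: mbump0_ge0 fam z. Qed.

Definition bump_mass : R := (\int[mu]_z mb z)%R.

Lemma bump_integral_lty : (\int[mu]_z (mb z)%:E < +oo)%E.
Proof.
apply: (@le_lt_trans _ _ (\int[mu]_z (\1_(cube e) z)%:E)%E).
  apply: int_le => //; first by apply: measurable_indic; exact: measurable_cube.
  move=> z; rewrite indicE; case: (boolP (z \in cube e)) => [_|/negP zc].
    exact: mbump0_le1 fam z.
  have -> // : mb z = 0.
  apply: (mbump_out e0 fam); rewrite leNgt; apply/negP => h.
  by apply: zc; rewrite inE; exact: ltW.
rewrite integral_indic//; last exact: measurable_cube.
by rewrite setIT; exact: cube_measure_lty.
Qed.

Lemma bump_massE : (\int[mu]_z (mb z)%:E = bump_mass%:E)%E.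
Proof.
rewrite /bump_mass /Rintegral fineK// ge0_fin_numE ?bump_integral_lty//.
exact: int_ge0.
Qed.

(** The kernel is at least [beta^N] on a cube of side [e], so the normalised
    kernel is of size [e^-N]. *)
Lemma bump_mass_ge : beta ^+ N * e ^+ N <= bump_mass.
Proof.
rewrite -lee_fin -bump_massE.
have bN : 0 <= beta ^+ N by rewrite exprn_ge0// ltW.
have e20 : 0 <= e / 2 by rewrite divr_ge0// ltW.
have -> : ((beta ^+ N * e ^+ N)%:E = \int[mu]_z (beta ^+ N * \1_(cube (e / 2)) z)%:E)%E.
  rewrite intZ//; last by apply: measurable_indic; exact: measurable_cube.
  rewrite integral_indic ?setIT ?measure_cube//; last exact: measurable_cube.
  by rewrite -EFinM; congr (_ * _ ^+ _)%:E; field.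
apply: int_le => //.
- by move=> z; rewrite mulr_ge0.
- by apply: measurable_funM => //; apply: measurable_indic; exact: measurable_cube.
move=> z; rewrite indicE; case: (boolP (z \in cube (e / 2))) => [/set_mem zc|_]; last by rewrite mulr0.
by rewrite mulr1; exact: (mbump0_ge fam (ltW beta0) zc).
Qed.

Lemma bump_mass_gt0 : 0 < bump_mass.
Proof. by apply: lt_le_trans bump_mass_ge; rewrite mulr_gt0// exprn_gt0. Qed.

Definition rho z := mb z / bump_mass.

Lemma rho_ge0 z : 0 <= rho z.
Proof. by rewrite divr_ge0// ltW// bump_mass_gt0. Qed.

Lemma measurable_rho : measurable_fun setT rho.
Proof. exact: measurable_funM. Qed.

Lemma rhoN z : rho (- z) = rho z.
Proof. by rewrite /rho /mb (mbump0N fam). Qed.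

Lemma rho_out z : e <= `|z| -> rho z = 0.
Proof. by move=> ez; rewrite /rho /mb /mbump0 (mbump_out e0 fam) ?mul0r. Qed.

Lemma rho_le z : rho z <= (beta ^+ N * e ^+ N)^-1.
Proof.
rewrite /rho -[leRHS]mul1r; apply: ler_pM => //.
- by rewrite invr_ge0 ltW// bump_mass_gt0.
- exact: mbump0_le1 fam z.
rewrite lef_pV2 ?posrE ?bump_mass_gt0 ?bump_mass_ge//.
by rewrite mulr_gt0// exprn_gt0.
Qed.

Lemma integral_rho : (\int[mu]_z (rho z)%:E = 1)%E.
Proof.
under eq_integral do rewrite /rho mulrC.
rewrite intZ ?invr_ge0 ?(ltW bump_mass_gt0)// bump_massE -EFinM mulVf//.
by rewrite gt_eqF// bump_mass_gt0.
Qed.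

Lemma integrable_rho : mu.-integrable setT (EFin \o rho).
Proof.
apply/integrableP; split; first by apply/measurable_EFinP; exact: measurable_rho.
have -> : (\int[mu]_x `|(EFin \o rho) x| = \int[mu]_x (rho x)%:E)%E.
  by apply: eq_integral => x _; rewrite /= ger0_norm// rho_ge0.
by rewrite integral_rho ltry.
Qed.

Context (w : V -> R) (iw : mu.-integrable setT (EFin \o w)).
Let mw : measurable_fun setT w.
Proof. by apply/measurable_EFinP; exact: measurable_int iw. Qed.

(** Mollification by the normalised bump, written as a convolution so that
    smoothness is inherited. *)
Definition moll : V -> R := conv b (fun y => w y / bump_mass) (fun=> 0%N).

Let iwm : mu.-integrable setT (EFin \o (fun y => w y / bump_mass)).
Proof.
have := integrableZr measurableT (bump_mass^-1) iw.
by congr integrable; apply/funext.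
Qed.

Lemma smooth_moll : smooth_on setT moll.
Proof. exact: (smooth_conv M1 fam iwm). Qed.

Lemma continuous_moll : continuous moll.
Proof. exact: (continuous_conv M1 fam iwm). Qed.

Lemma measurable_moll : measurable_fun setT moll.
Proof. by apply: continuous_measurable_rV; exact: continuous_moll. Qed.

Lemma moll_shiftE x : moll x = (\int[mu]_z (w (x + z) * rho z))%R.
Proof.
transitivity (\int[mu]_y (w y * rho (x - y)))%R.
  by apply: eq_Rintegral => y _; rewrite /rho /mb /mbump0; ring.
have mf : measurable_fun setT (fun y : V => w y * rho (x - y)).
  apply: measurable_funM => //; apply: (measurableT_comp measurable_rho).
  exact: measurable_fun_rV_sub.
rewrite -(Rintegral_shift x mf); apply: eq_Rintegral => z _.
by rewrite opprD addrCA subrr addr0 rhoN addrC.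
Qed.

Lemma integrable_shift_rho x : mu.-integrable setT (EFin \o (fun z => w (x + z) * rho z)).
Proof.
have mwx : measurable_fun setT (fun z : V => w (x + z)).
  by under eq_fun do rewrite addrC; exact: measurable_shift.
have iws : mu.-integrable setT (EFin \o (fun z => w (x + z))).
  apply/integrableP; split; first exact/measurable_EFinP.
  have -> : (\int[mu]_z `|(EFin \o (fun z => w (x + z))) z| = \int[mu]_z `|(w z)%:E|)%E.
    rewrite -(integral_translation x (f := fun z => `|(w z)%:E|%E))//.
      by apply: eq_integral => z _ /=; rewrite addrC.
    by apply: measurableT_comp => //; exact/measurable_EFinP.
  by have /integrableP[] := iw.
apply: (integrable_bounded_mul iws (C := (beta ^+ N * e ^+ N)^-1)).
  exact: measurable_rho.
by move=> y; rewrite ger0_norm ?rho_ge0 ?rho_le.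
Qed.

(** The increment of the mollified function is an average of translated
    increments. *)
Lemma moll_diff_le p x x' : 1 < p ->
  ((`|moll x - moll x'| `^ p)%:E <=
   \int[mu]_z (rho z * `|w (x + z) - w (x' + z)| `^ p)%:E)%E.
Proof.
move=> p1.
have mwx y : measurable_fun setT (fun z : V => w (y + z)).
  by under eq_fun do rewrite addrC; exact: measurable_shift.
have E : (fun z => (w (x + z) - w (x' + z)) * rho z) =
    (fun z => w (x + z) * rho z - w (x' + z) * rho z).
  by apply/funext => z; ring.
have i1 := integrable_shift_rho x; have i2 := integrable_shift_rho x'.
have -> : moll x - moll x' = (\int[mu]_z ((w (x + z) - w (x' + z)) * rho z))%R.
  by rewrite !moll_shiftE -RintegralB// E.
apply: (jensen_powR p1 measurable_rho _ rho_ge0 integral_rho).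
  exact: measurable_funB.
by rewrite E; have := integrableB measurableT i1 i2; congr integrable.
Qed.

Lemma moll_error_le p x : 1 < p ->
  ((`|moll x - w x| `^ p)%:E <= \int[mu]_z (rho z * `|w (x + z) - w x| `^ p)%:E)%E.
Proof.
move=> p1.
have mwx y : measurable_fun setT (fun z : V => w (y + z)).
  by under eq_fun do rewrite addrC; exact: measurable_shift.
have E : (fun z => (w (x + z) - w x) * rho z) =
    (fun z => w (x + z) * rho z - w x * rho z).
  by apply/funext => z; ring.
have i1 := integrable_shift_rho x; have i2 := integrableZl measurableT (w x) integrable_rho.
have -> : moll x - w x = (\int[mu]_z ((w (x + z) - w x) * rho z))%R.
  rewrite moll_shiftE E RintegralB//.
  rewrite RintegralZl//; last exact: integrable_rho.
  by rewrite [X in w x * X]/Rintegral integral_rho mulr1.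
apply: (jensen_powR p1 measurable_rho _ rho_ge0 integral_rho).
  exact: measurable_funB.
by rewrite E; have := integrableB measurableT i1 i2; congr integrable.
Qed.

(** By Jensen's inequality the energy of an average is at most the average of
    the energies of the translates, which are all equal. *)
Lemma energy_moll_le p sigma : 1 < p ->
  (gagliardo_energy sigma p moll <= gagliardo_energy sigma p w)%E.
Proof.
move=> p1.
have mg := measurable_gkern sigma p mw.
pose F (t : (V * V) * V) : R := rho t.2 * gkern sigma p w (t.1.1 + t.2, t.1.2 + t.2).
have F0 t : 0 <= F t by rewrite mulr_ge0 ?rho_ge0 ?gkern_ge0.
have m12 : measurable_fun setT (fun t : (V * V) * V => (t.1.1 + t.2, t.1.2 + t.2)).
  apply: measurable_fun_pair; apply: measurable_fun_rV_add; try exact: measurable_snd.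
  - exact: (measurableT_comp measurable_fst measurable_fst).
  - exact: (measurableT_comp measurable_snd measurable_fst).
have mF : measurable_fun setT F.
  apply: measurable_funM; first exact: (measurableT_comp measurable_rho measurable_snd).
  exact: (measurableT_comp mg m12).
have mFE : measurable_fun setT (fun t => (F t)%:E) by exact/measurable_EFinP.
have F0E t : (0 <= (F t)%:E)%E by rewrite lee_fin.
rewrite gagliardo_energyE; last exact: measurable_moll.
apply: (@le_trans _ _ (\int[mm]_z \int[mu]_y (F (z, y))%:E)%E).
  apply: ge0_le_integral => //.
  - by move=> z _; rewrite lee_fin gkern_ge0.
  - apply/measurable_EFinP; apply: measurable_gkern; exact: measurable_moll.
  - exact: (@measurable_fun_fubini_tonelli_F _ _ _ V R mu _ mFE F0E).
  move=> z _.
  set D := (enorm (z.1 - z.2) `^ (N%:R + sigma * p))^-1.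
  have D0 : 0 <= D by rewrite invr_ge0 powR_ge0.
  rewrite /gkern -/D mulrC EFinM.
  have -> : (\int[mu]_y (F (z, y))%:E = D%:E * \int[mu]_y (rho y * `|w (z.1 + y) - w (z.2 + y)| `^ p)%:E)%E.
    rewrite -intZ//; last 2 first.
    - by move=> y; rewrite mulr_ge0 ?rho_ge0 ?powR_ge0.
    - apply: measurable_funM; first exact: measurable_rho.
      apply: measurable_norm_powR; apply: measurable_funB.
        by under eq_fun do rewrite addrC; exact: measurable_shift.
      by under eq_fun do rewrite addrC; exact: measurable_shift.
    apply: eq_integral => y _; rewrite /F /gkern/=.
    by rewrite opprD addrACA subrr addr0 -/D; congr EFin; ring.
  by apply: lee_wpmul2l; [rewrite lee_fin|exact: moll_diff_le].
rewrite tonelli_prod_swap//.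
have -> : (\int[mu]_y \int[mm]_z (F (z, y))%:E =
    \int[mu]_y ((rho y)%:E * gagliardo_energy sigma p w))%E.
  apply: eq_integral => y _; rewrite /F/=.
  rewrite (intZ mm (rho_ge0 y) (fun z => gkern_ge0 sigma p w (z.1 + y, z.2 + y))
    (measurable_shift2 y mg)).
  by rewrite (integral_prod_shift y mg (gkern_ge0 sigma p w)) gagliardo_energyE.
rewrite ge0_integralZr//; first by rewrite integral_rho mul1e.
- by apply/measurable_EFinP; exact: measurable_rho.
- by move=> y _; rewrite lee_fin rho_ge0.
- exact: gagliardo_energy_ge0.
Qed.

(** The error at [x] is an average of [w y - w x] over [|x - y| < e], where
    the kernel is of size [e^-N]; there [e^-N] is at most a constant times
    [e^(sigma p) / |x - y|^(N + sigma p)], so the energy controls the error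
    with the factor [e^(sigma p)]. *)
Lemma power_int_moll_error_le p sigma : 1 < p -> 0 < sigma ->
  (power_int p (moll \- w)%R <=
   ((beta ^+ N)^-1 * Num.sqrt N%:R `^ (N%:R + sigma * p) * e `^ (sigma * p))%:E *
     gagliardo_energy sigma p w)%E.
Proof.
move=> p1 s0; have p0 : 0 < p by lra.
have sp0 : 0 < sigma * p by rewrite mulr_gt0.
set a := N%:R + sigma * p.
have a0 : 0 <= a by rewrite addr_ge0 ?ler0n// ltW.
set C := (beta ^+ N)^-1 * Num.sqrt N%:R `^ a * e `^ (sigma * p).
have C0 : 0 <= C by rewrite !mulr_ge0 ?powR_ge0// invr_ge0 exprn_ge0// ltW.
have mg := measurable_gkern sigma p mw.
rewrite gagliardo_energyE// -(intZ mm C0 (gkern_ge0 sigma p w) mg).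
have mCg : measurable_fun setT (fun z => (C * gkern sigma p w z)%:E).
  by apply/measurable_EFinP; exact: measurable_funM.
have Cg0 z : (0 <= (C * gkern sigma p w z)%:E)%E by rewrite lee_fin mulr_ge0 ?gkern_ge0.
rewrite (fubini_tonelli1 _ mCg Cg0); apply: ge0_le_integral => //.
- apply/measurable_EFinP; apply: measurable_norm_powR; apply: measurable_funB => //.
  exact: measurable_moll.
- exact: (measurable_fun_fubini_tonelli_F _ mCg Cg0).
move=> x _; apply: (le_trans (moll_error_le x p1)).
have mk y : measurable_fun setT (fun x : V => rho (x - y) * `|w x - w y| `^ p).
  apply: measurable_funM; first exact: (measurable_shift (- y) measurable_rho).
  by apply: measurable_norm_powR; exact: measurable_funB.
have -> : (\int[mu]_z (rho z * `|w (x + z) - w x| `^ p)%:E =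
    \int[mu]_y (rho (y - x) * `|w y - w x| `^ p)%:E)%E.
  rewrite -(integral_shift x (mk x)); last by move=> y; rewrite mulr_ge0 ?rho_ge0 ?powR_ge0.
  by apply: eq_integral => z _; rewrite addrK [x + z]addrC.
rewrite /fubini_F; apply: int_le => //.
- by move=> y; rewrite mulr_ge0 ?rho_ge0 ?powR_ge0.
- by have /measurable_EFinP := measurableT_comp mCg (pair1_measurable x).
move=> y /=.
have [xy|xy] := leP e `|y - x|.
  by rewrite rho_out// mul0r mulr_ge0 ?gkern_ge0.
have [->|yx] := eqVneq y x.
  by rewrite [w x - w x]subrr normr0 powR0 ?gt_eqF// mulr0 mulr_ge0 ?gkern_ge0.
have en0 : 0 < enorm (x - y) by rewrite enorm_gt0// subr_eq0 eq_sym.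
rewrite /gkern/= distrC [leLHS]mulrC [leRHS]mulrCA.
apply: ler_wpM2l; first exact: powR_ge0.
rewrite ler_pdivlMr ?powR_gt0//.
apply: (@le_trans _ _ ((beta ^+ N * e ^+ N)^-1 * (Num.sqrt N%:R * e) `^ a)).
  apply: ler_pM; rewrite ?rho_ge0 ?powR_ge0 ?rho_le//.
  apply: ge0_ler_powR; rewrite ?nnegrE ?enorm_ge0//.
    by rewrite mulr_ge0 ?sqrtr_ge0 ?(ltW e0).
  apply: (le_trans (enorm_le_norm _)); apply: ler_wpM2l; first exact: sqrtr_ge0.
  by rewrite distrC ltW.
rewrite powRM ?sqrtr_ge0 ?(ltW e0)// [X in _ * (_ * X)]powRD; last first.
  by rewrite (gt_eqF e0) implybT.
rewrite powR_mulrn ?(ltW e0)// /C le_eqVlt; apply/orP; left; apply/eqP.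
have : beta ^+ N != 0 by rewrite gt_eqF// exprn_gt0.
have : e ^+ N != 0 by rewrite gt_eqF// exprn_gt0.
move: (beta ^+ N) (e ^+ N) (e `^ (sigma * p)) (Num.sqrt N%:R `^ a) => B E F G.
by move=> ? ?; field; apply/andP.
Qed.

End mollifier.

(** * Approximation by mollified functions *)

Section ereal_limits.
Context {R : realType}.

Lemma cvge_fin_lt (u : nat -> \bar R) (L : R) :
  (forall e, 0 < e -> \forall n \near \oo, (u n < (L + e)%:E)%E) ->
  (forall e, 0 < e -> \forall n \near \oo, ((L - e)%:E < u n)%E) ->
  u @ \oo --> L%:E.
Proof.
move=> h1 h2; apply/fine_cvgP; split.
  have := h1 1 ltr01; have := h2 1 ltr01; apply: filterS2 => n.
  by case: (u n).
apply/cvgrPdist_lt => e e0.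
have := h1 e e0; have := h2 e e0; apply: filterS2 => n.
rewrite /=; case: (u n) => [r||]//=; rewrite !lte_fin => h h'; by rewrite ltr_distlC h h'.
Qed.

Lemma cvge_subseq (u : nat -> \bar R) (phi : nat -> nat) (l : \bar R) :
  {homo phi : m n / (m < n)%N} -> u @ \oo --> l -> u (phi n) @[n --> \oo] --> l.
Proof. by move=> hphi; apply: (@cvg_comp _ _ _ phi u); exact: cvg_extraction. Qed.

End ereal_limits.

Section approximation.
Context {R : realType} {N : nat}.
Local Notation V := 'rV[R]_N.
Local Notation mu := (lebesgue_rV R N).
Implicit Types (u v w : V -> R).

(** Lower semicontinuity of the energy with varying exponent. *)
Lemma energy_fatou_lt p (sg : nat -> R) sigma (u_ : nat -> V -> R) u (c : \bar R) :
  0 < p -> sg @ \oo --> sigma ->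
  (forall n, measurable_fun setT (u_ n)) -> measurable_fun setT u ->
  {ae mu, forall x, u_ n x @[n --> \oo] --> u x} ->
  (c < gagliardo_energy sigma p u)%E ->
  \forall n \near \oo, (c < gagliardo_energy (sg n) p (u_ n))%E.
Proof.
move=> p0 sgc mu_ mu0 uc; rewrite gagliardo_energyE// => h.
have := fatou_ae_lt (fun n => measurable_gkern (sg n) p (mu_ n))
  (measurable_gkern sigma p mu0) (fun n => gkern_ge0 (sg n) p (u_ n))
  (gkern_ge0 sigma p u) (ae_gkern_cvg p0 sgc uc) h.
by apply: filterS => n; rewrite gagliardo_energyE.
Qed.

Lemma powR_cvg0 (a : R) (f : nat -> R) : 0 < a -> f @ \oo --> 0 -> (forall n, 0 <= f n) ->
  (f n `^ a) @[n --> \oo] --> 0.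
Proof.
move=> a0 f0 fge; apply/cvgrPdist_lt => e e0.
have ea : 0 < e `^ a^-1 by rewrite powR_gt0.
move/cvgrPdist_lt : f0 => /(_ _ ea); apply: filterS => n.
rewrite !sub0r !normrN !ger0_norm ?powR_ge0// => h.
rewrite -[e](powRVK (p := a)) ?gt_eqF // ?(ltW e0)//.
by rewrite gt0_ltr_powR// ?nnegrE// powR_ge0.
Qed.

(** Mollification does not increase the energy and Fatou's lemma bounds it
    from below, so the energies converge, and [energy_scheffe] makes the
    convergence strong. *)
Lemma approx_mollification p sigma w (A : set V) delta : 
  1 < p -> 0 < sigma -> 0 < delta -> bounded_set A ->
  measurable_fun setT w -> (forall x, ~ A x -> w x = 0) ->
  (power_int p w < +oo)%E -> (gagliardo_energy sigma p w < +oo)%E ->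
  exists phi : nat -> V -> R,
    [/\ forall n, smooth_on setT (phi n),
        forall n x, phi n x != 0 -> exists2 y, A y & `|x - y| < delta,
        power_int p (phi n \- w)%R @[n --> \oo] --> 0%E &
        gagliardo_energy sigma p (phi n \- w)%R @[n --> \oo] --> 0%E].
Proof.
move=> p1 s0 d0 /bounded_set_cube[r [r0 Ar]] mw wA wp we.
have p0 : 0 < p by lra.
have iw : mu.-integrable setT (EFin \o w).
  by apply: (integrable_of_power_int (r := r) p1 mw) => // x xr; apply: wA => /Ar.
have [beta beta0 hb] := @exists_bump_family R.
pose e n : R := delta * n.+1%:R^-1.
have e0 n : 0 < e n by rewrite mulr_gt0.
have [b hb1] := choice (fun n => hb (e n) (e0 n)).
have [M hb2] := choice hb1.
pose phi n := moll (b n) w.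
have mphi n : measurable_fun setT (phi n).
  by have [M1 fam] := hb2 n; exact: (measurable_moll M1 fam iw).
have mphiB n : measurable_fun setT (phi n \- w) by exact: measurable_funB.
have [Ew [Ew0 EwE]] := ge0_lty_EFin (gagliardo_energy_ge0 sigma p w) we.
have phip : power_int p (phi n \- w)%R @[n --> \oo] --> 0%E.
  apply/ge0_cvge0P => [n|a a0]; first exact: power_int_ge0.
  have sp0 : 0 < sigma * p by rewrite mulr_gt0.
  set K := beta ^- N * Num.sqrt N%:R `^ (N%:R + sigma * p).
  have ce : (K * e n `^ (sigma * p) * Ew) @[n --> \oo] --> 0.
    rewrite -[X in _ --> X](mul0r Ew); apply: cvgMl.
    rewrite -[X in _ --> X](mulr0 K); apply: cvgMr.
    apply: powR_cvg0 => //; last by move=> n; exact: ltW.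
    by rewrite -[X in _ --> X](mulr0 delta); apply: cvgMr; exact: cvg_harmonic.
  move/cvgrPdist_lt : ce => /(_ a a0); apply: filterS => n.
  rewrite sub0r normrN => h.
  have [M1 fam] := hb2 n.
  apply: (le_lt_trans (power_int_moll_error_le (e0 n) M1 fam beta0 iw p1 s0)).
  by rewrite EwE -EFinM lte_fin (le_lt_trans (ler_norm _) h).
have [f [hf fc]] := cvg0_int_subseq_ae (fun n => measurable_norm_powR p (mphiB n)) (fun n x => powR_ge0 _ _) phip.
exists (phi \o f); split.
- by move=> n /=; have [M1 fam] := hb2 (f n); exact: (smooth_moll M1 fam iw).
- move=> n x /= /eqP phix; apply: contrapT => hA; apply: phix.
  have [M1 fam] := hb2 (f n).
  apply: (conv_out (e0 (f n)) fam (A := A)).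
    by move=> y /wA ->; rewrite mul0r.
  move=> y Ay; rewrite leNgt; apply/negP => xy; apply: hA; exists y => //.
  apply: (lt_le_trans xy); rewrite /e ler_piMr ?(ltW d0)// invf_le1 ?ltr0n//.
  by rewrite ler1n.
- exact: (cvge_subseq hf phip).
apply: (@energy_scheffe _ _ p (fun=> sigma) sigma (fun n => phi (f n)) w) => //=.
- exact: cvg_cst.
- apply: filterS fc => x /= hx; apply/subr_cvg0.
  by apply: (cvg_norm_powR0 _ p0); exact: hx.
- rewrite EwE; apply: cvge_fin_lt => a a0.
    apply: nearW => n; have [M1 fam] := hb2 (f n).
    apply: (le_lt_trans (energy_moll_le (e0 (f n)) M1 fam beta0 iw sigma p1)).
    by rewrite EwE lte_fin ltrDl.
  apply: (energy_fatou_lt p0 (cvg_cst sigma) (fun n => mphi (f n)) mw).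
    apply: filterS fc => x /= hx; apply/subr_cvg0.
    by apply: (cvg_norm_powR0 _ p0); exact: hx.
  by rewrite EwE lte_fin gtrDl oppr_lt0.
- exact: cvg_cst.
Qed.

(** The margin is halved because the support is a closure. *)
Lemma smooth_compact_near (Omega A : set V) delta phi : 0 < delta -> bounded_set A ->
  (forall x y, A y -> `|x - y| < delta -> Omega x) -> smooth_on setT phi ->
  (forall x, phi x != 0 -> exists2 y, A y & `|x - y| < delta / 2) ->
  smooth_compact Omega phi.
Proof.
move=> d0 /bounded_set_cube[r [r0 Ar]] AO sphi hphi.
have d20 : 0 < delta / 2 by rewrite divr_gt0.
have supp x : support_fun phi x -> exists2 y, A y & `|x - y| < delta.
  move=> /(_ (ball x (delta / 2)) (nbhsx_ballx x _ d20)) [z [/hphi[y Ay zy] xz]].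
  exists y => //; rewrite -(subrKA z) (splitr delta).
  apply: (le_lt_trans (ler_normD _ _)); apply: ltrD => //.
  by move: xz; rewrite -ball_normE.
split => //.
- apply: bounded_closed_compact; last exact: closed_closure.
  exists (r + delta); split; first by rewrite num_real.
  move=> M rM x /supp[y /Ar yr xy]; rewrite -(subrK y x).
  apply: (le_trans (ler_normD _ _)); apply: (le_trans _ (ltW rM)).
  by rewrite addrC lerD// ltW.
- by move=> x /supp[y Ay xy]; exact: AO xy.
Qed.

End approximation.

(** * Seminorms versus integrals, and locality of smoothness *)

Section norms_and_integrals.
Context {R : realType}.

Lemma poweR_lt (a e : R) (x : \bar R) : 0 < a -> 0 < e -> (0 <= x)%E ->
  (x `^ a < e%:E)%E = (x < (e `^ a^-1)%:E)%E.
Proof.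
move=> a0 e0; case: x => [r||]//; last first.
  by rewrite poweRyr ?gt_eqF// !ltNge !leey.
rewrite lee_fin poweR_EFin !lte_fin => r0.
apply/idP/idP => h.
  rewrite -[r](powRK (p := a)) ?gt_eqF//.
  by rewrite gt0_ltr_powR ?nnegrE ?invr_gt0 ?powR_ge0// ltW.
rewrite -[e](powRVK (p := a)) ?gt_eqF ?(ltW e0)//.
by rewrite gt0_ltr_powR ?nnegrE// powR_ge0.
Qed.

Lemma poweR_cvg0P (a : R) (f : nat -> \bar R) : 0 < a -> (forall n, 0 <= f n)%E ->
  (f n `^ a)%E @[n --> \oo] --> 0%E <-> f n @[n --> \oo] --> 0%E.
Proof.
move=> a0 f0.
rewrite !ge0_cvge0P//; last by move=> n; exact: poweR_ge0.
split => h e e0.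
  have := h _ (powR_gt0 a e0); apply: filterS => n.
  by rewrite poweR_lt// ?powRK ?gt_eqF ?powR_gt0// ltW.
have := h _ (powR_gt0 a^-1 e0); apply: filterS => n.
by rewrite poweR_lt.
Qed.

Context {N : nat}.
Local Notation V := 'rV[R]_N.
Local Notation mu := (lebesgue_rV R N).

Lemma gagliardo_cvg0P p (sg : nat -> R) (w : nat -> V -> R) : 0 < p ->
  gagliardo (sg n) p (w n) @[n --> \oo] --> 0%E <->
  gagliardo_energy (sg n) p (w n) @[n --> \oo] --> 0%E.
Proof.
move=> p0; apply: poweR_cvg0P; first by rewrite invr_gt0.
by move=> n; exact: gagliardo_energy_ge0.
Qed.

Lemma gagliardo_powR sigma p (u : V -> R) : 0 < p ->
  (gagliardo sigma p u `^ p = gagliardo_energy sigma p u)%E.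
Proof.
move=> p0; rewrite /gagliardo -poweRrM mulVf ?gt_eqF// poweRe1//.
exact: gagliardo_energy_ge0.
Qed.

Lemma Lp_norm_powR p D (u : V -> R) : 0 < p ->
  (Lp_norm p D u `^ p = \int[mu]_x (`|(u \_ D) x| `^ p)%:E)%E.
Proof.
move=> p0; rewrite /Lp_norm powR_Lnorm ?gt_eqF//.
by apply: eq_integral => x _; rewrite !patchE; case: ifPn => //= _; rewrite poweR_EFin.
Qed.

Lemma Lp_norm_setT p (u : V -> R) : 0 < p ->
  (Lp_norm p setT u `^ p = power_int p u)%E.
Proof.
move=> p0; apply: (etrans (Lp_norm_powR _ _ p0)); apply: eq_integral => x _.
by rewrite patchE in_setT.
Qed.

Lemma Lp_norm_restrict p D (u : V -> R) : 0 < p ->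
  measurable D -> measurable_fun setT u ->
  {ae mu, forall x, ~ D x -> u x = 0} -> (Lp_norm p D u `^ p = power_int p u)%E.
Proof.
move=> p0 mD mu0 uD; apply: (etrans (Lp_norm_powR _ _ p0)); apply: int_ae_eq => //.
- apply: measurable_norm_powR; apply/(measurable_restrictT _ _).1 => //.
  exact: measurable_funTS.
- exact: measurable_norm_powR.
apply: filterS uD => x ux; rewrite patchE; case: ifPn => //.
by rewrite notin_setE => /ux ->.
Qed.

Lemma Lp_norm_eq1 p D (u : V -> R) : 0 < p ->
  measurable D -> measurable_fun setT u ->
  {ae mu, forall x, ~ D x -> u x = 0} -> (Lp_norm p D u = 1%E <-> power_int p u = 1%E).
Proof.
move=> p0 mD mu0 uD; rewrite -(Lp_norm_restrict p0 mD mu0 uD); split => [->|h].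
  exact: poweR1r.
transitivity ((Lp_norm p D u `^ p) `^ p^-1)%E; last by rewrite h poweR1r.
by rewrite -poweRrM mulfV ?gt_eqF// poweRe1//; exact: Lnorm_ge0.
Qed.

Lemma sobolev_norm_powR sigma p (u : V -> R) : 0 < p ->
  sobolev_norm sigma p u = ((power_int p u + gagliardo_energy sigma p u) `^ p^-1)%E.
Proof. by move=> p0; rewrite /sobolev_norm Lp_norm_setT. Qed.

End norms_and_integrals.

Section smoothness.
Context {R : realType} {N : nat}.
Local Notation V := 'rV[R]_N.

Lemma partials_local l (D : set V) (f g : V -> R) : open D ->
  (forall x, D x -> f x = g x) -> forall x, D x -> partials l f x = partials l g x.
Proof.
move=> oD; elim: l => [//|i l IH] fg x Dx /=; apply: near_eq_derive.
by have := open_nbhs_nbhs (conj oD Dx); apply: filterS => y; exact: IH.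
Qed.

(** Partial derivatives only see the germ of a function; a locally finite sum
    of smooth functions is smooth by this criterion. *)
Lemma smooth_on_local (D : set V) (f : V -> R) :
  (forall x, D x -> exists U g, [/\ open U, U x, smooth_on setT g &
     forall y, U y -> f y = g y]) -> smooth_on D f.
Proof.
move=> h l x /h[U [g [oU Ux sg fg]]].
have nU : nbhs x U by exact: open_nbhs_nbhs.
have [cg dg] := sg l x Logic.I.
have E y : U y -> partials l f y = partials l g y by exact: partials_local.
have nE : \forall y \near x, partials l g y = partials l f y.
  by apply: filterS nU => y /E.
split; last by move=> i; exact: near_eq_derivable (dg i).
rewrite /prop_for /continuous_at (E x Ux).
exact: (cvg_trans (near_eq_cvg (F := nbhs x) nE) cg).
Qed.

Lemma partials0 l : partials l (fun _ : V => 0 : R) = fun=> 0.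
Proof.
by elim: l => [//|i l IH] /=; rewrite IH; apply/funext => x; exact: derive_cst.
Qed.

Lemma smooth_on0 D : smooth_on D (fun _ : V => 0 : R).
Proof.
move=> l x _; rewrite partials0; split; first exact: cst_continuous.
by move=> i; exact: derivable_cst.
Qed.

Lemma partialsD l (f g : V -> R) : smooth_on setT f -> smooth_on setT g ->
  partials l (f \+ g) = partials l f \+ partials l g.
Proof.
move=> sf sg; elim: l => [//|i l IH] /=; rewrite IH; apply/funext => x.
apply: deriveD; first exact: (sf l x Logic.I).2.
exact: (sg l x Logic.I).2.
Qed.

Lemma smooth_onD (f g : V -> R) : smooth_on setT f -> smooth_on setT g ->
  smooth_on setT (f \+ g).
Proof.
move=> sf sg l x _; rewrite partialsD//.
have [cf df] := sf l x Logic.I; have [cg dg] := sg l x Logic.I; split.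
  exact: (continuousD cf cg).
by move=> i; exact: (derivableD (df i) (dg i)).
Qed.

Lemma smooth_on_sum n (f : nat -> V -> R) : (forall i, smooth_on setT (f i)) ->
  smooth_on setT (fun x => \sum_(i < n) f i x).
Proof.
move=> sf; elim: n => [|n IH].
  by under eq_fun do rewrite big_ord0; exact: smooth_on0.
under eq_fun do rewrite big_ord_recr/=.
exact: (smooth_onD IH (sf n)).
Qed.

End smoothness.

(** * Distance to the complement and cutoff layers *)

Section cutoffs.
Context {R : realType} {N : nat}.
Local Notation V := 'rV[R]_N.
Local Notation mu := (lebesgue_rV R N).

(** Only a point outside [Omega] makes the infimum that defines the distance
    meaningful; in dimension 0 there may be none. *)
Lemma exists_not_bounded (Omega : set V) : (0 < N)%N -> bounded_set Omega ->
  exists y, ~ Omega y.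
Proof.
case: N Omega => // n Omega _ /bounded_set_cube[r [r0 Or]].
exists (const_mx (r + 1)) => /Or; rewrite /cube/= => /rV_norm_leP.
have r00 : 0 <= r by exact: ltW.
by move=> /(_ r00 ord0); rewrite mxE ger0_norm; lra.
Qed.

Section cutoff.
Context (Omega : set V) (Ox : exists y, ~ Omega y).

Definition dist_compl (x : V) : R := inf [set `|x - y| | y in ~` Omega].

Let dist_set_lb x : has_lbound [set `|x - y| | y in ~` Omega].
Proof. by exists 0 => _ [y _ <-]. Qed.

Lemma dist_compl_le x y : ~ Omega y -> dist_compl x <= `|x - y|.
Proof. by move=> Oy; apply: ge_inf => //; exists y. Qed.

Lemma le_dist_compl x r : (forall y, ~ Omega y -> r <= `|x - y|) -> r <= dist_compl x.
Proof.
move=> h; apply: lb_le_inf; first by have [y Oy] := Ox; exists `|x - y|; exists y.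
by move=> _ [y Oy <-]; exact: h.
Qed.

Lemma dist_compl_ge0 x : 0 <= dist_compl x.
Proof. exact: le_dist_compl. Qed.

Lemma dist_compl_out x : ~ Omega x -> dist_compl x = 0.
Proof.
move=> Ox'; apply/eqP; rewrite eq_le dist_compl_ge0 andbT.
by have := dist_compl_le x Ox'; rewrite subrr normr0.
Qed.

Lemma dist_compl_gt0 x : open Omega -> Omega x -> 0 < dist_compl x.
Proof.
move=> oO Ox'; have := open_nbhs_nbhs (conj oO Ox').
move=> /nbhs_ballP[r /= r0 rO]; apply: (lt_le_trans r0).
apply: le_dist_compl => y Oy; rewrite leNgt; apply/negP => xy; apply: Oy.
by apply: rO; rewrite -ball_normE.
Qed.

Lemma dist_compl_lip x y : dist_compl x <= dist_compl y + `|x - y|.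
Proof.
rewrite -lerBlDr; apply: le_dist_compl => z Oz; rewrite lerBlDr.
apply: (le_trans (dist_compl_le x Oz)).
rewrite [leRHS]addrC.
have -> : x - z = (x - y) + (y - z) by rewrite addrA subrK.
exact: ler_normD.
Qed.

Lemma dist_compl_lipN x y : `|dist_compl x - dist_compl y| <= `|x - y|.
Proof.
have h1 := dist_compl_lip x y; have h2 := dist_compl_lip y x.
by rewrite distrC in h2; rewrite ler_norml; apply/andP; split; lra.
Qed.


Definition clip (t : R) : R := Num.min 1 (Num.max 0 t).

Lemma clip_lip a b : `|clip a - clip b| <= `|a - b|.
Proof.
rewrite /clip /Num.min /Num.max.
by have [ab|ab] := ler0P (a - b); do 4!case: ifPn; rewrite -?leNgt => *;
  rewrite ler_norml; apply/andP; split; lra.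
Qed.

Lemma clip_itv t : 0 <= clip t <= 1.
Proof. by rewrite /clip ge_min lexx le_min ler01 le_max lexx. Qed.

Lemma clip0 t : t <= 0 -> clip t = 0.
Proof. by move=> t0; rewrite /clip max_l// min_r. Qed.

Lemma clip1 t : 1 <= t -> clip t = 1.
Proof. by move=> t1; rewrite /clip min_l// le_max t1 orbT. Qed.

Lemma clip_mono a b : a <= b -> clip a <= clip b.
Proof.
move=> ab; rewrite /clip /Num.min /Num.max.
by do 4!case: ifPn; rewrite -?leNgt => *; lra.
Qed.

(** A Lipschitz ramp from 0 at distance [1 / m] to 1 at distance [2 / m] from
    the complement. *)
Definition cutoff (m : nat) (x : V) : R := clip (m%:R * dist_compl x - 1).

Lemma cutoff_lip m x y : `|cutoff m x - cutoff m y| <= m%:R * `|x - y|.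
Proof.
apply: (le_trans (clip_lip _ _)).
rewrite opprB addrA subrK -mulrBr normrM ger0_norm ?ler0n//.
by apply: ler_wpM2l; [exact: ler0n|exact: dist_compl_lipN].
Qed.

Lemma cutoff_in m x : 2 <= m%:R * dist_compl x -> cutoff m x = 1.
Proof. by move=> h; apply: clip1; lra. Qed.

Lemma cutoff_out m x : m%:R * dist_compl x <= 1 -> cutoff m x = 0.
Proof. by move=> h; apply: clip0; lra. Qed.

Lemma cutoff0 x : cutoff 0 x = 0.
Proof. by apply: cutoff_out; rewrite mul0r. Qed.

(** A partition of unity adapted to the distance from the complement: the
    layers add up to the cutoffs, hence to 1 inside [Omega], and only finitely
    many are nonzero near a given point. *)
Definition layer (m : nat) (x : V) : R := cutoff m.+1 x - cutoff m x.

Lemma layer_itv m x : 0 <= layer m x <= 1.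
Proof.
have /andP[a0 a1] := clip_itv (m.+1%:R * dist_compl x - 1).
have /andP[b0 b1] := clip_itv (m%:R * dist_compl x - 1).
rewrite /layer /cutoff subr_ge0 clip_mono; last first.
  by rewrite lerB// ler_wpM2r ?dist_compl_ge0// ler_nat.
by rewrite lerBlDr; lra.
Qed.

Lemma layer_supp m x : layer m x != 0 ->
  1 < m.+1%:R * dist_compl x /\ m%:R * dist_compl x < 2.
Proof.
move=> h; have mm : m%:R * dist_compl x <= m.+1%:R * dist_compl x.
  by rewrite ler_wpM2r ?dist_compl_ge0// ler_nat.
split; rewrite ltNge; apply/negP => h'; move/eqP : h; apply; rewrite /layer.
  by rewrite !cutoff_out ?subrr// (le_trans mm).
by rewrite !cutoff_in ?subrr// (le_trans _ mm).
Qed.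

Lemma layer_lip m x y : `|layer m x - layer m y| <= (m.+1%:R + m%:R) * `|x - y|.
Proof.
have -> : layer m x - layer m y =
    (cutoff m.+1 x - cutoff m.+1 y) - (cutoff m x - cutoff m y).
  by rewrite /layer; ring.
apply: (le_trans (ler_normB _ _)); rewrite mulrDl.
by apply: lerD; exact: cutoff_lip.
Qed.

Lemma layer_sum n x : \sum_(m < n) layer m x = cutoff n x.
Proof.
by rewrite -(big_mkord xpredT (fun m => layer m x)) telescope_sumr// cutoff0 subr0.
Qed.

End cutoff.

(** A function with values in the unit interval is both bounded and Lipschitz,
    and the smaller of the two bounds applies to every increment. *)
Lemma lip_cutoff_of_lip p (eta : V -> R) (K : R) : 0 < p -> 1 <= K ->
  (forall x, 0 <= eta x <= 1) ->
  (forall x y, `|eta x - eta y| <= K * `|x - y|) -> lip_cutoff p eta (K `^ p).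
Proof.
move=> p0 K1 eta1 etaK x y; have K0 : 0 <= K by lra.
have h1 : `|eta x - eta y| <= 1.
  have := eta1 x; have := eta1 y.
  by rewrite ler_norml => /andP[? ?] /andP[? ?]; apply/andP; split; lra.
have h2 : `|eta x - eta y| <= K * enorm (x - y).
  by apply: (le_trans (etaK x y)); apply: ler_wpM2l => //; exact: norm_le_enorm.
have [e1|e1] := leP (enorm (x - y) `^ p) 1.
  rewrite -powRM ?enorm_ge0//.
  by apply: ge0_ler_powR; rewrite ?nnegrE ?mulr_ge0 ?enorm_ge0// ltW.
rewrite mulr1; apply: ge0_ler_powR; rewrite ?nnegrE// ?(ltW p0)//.
exact: (le_trans h1).
Qed.

Lemma measurable_of_lip (eta : V -> R) (K : R) :
  (forall x y, `|eta x - eta y| <= K * `|x - y|) -> measurable_fun setT eta.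
Proof.
by move=> h; apply: continuous_measurable_rV; exact: lipschitz_bound_continuous h.
Qed.

End cutoffs.

(** * The Meyers-Serrin theorem up to an arbitrary boundary *)

Section quasi_sums.
Context {R : realType} {N : nat}.
Local Notation V := 'rV[R]_N.
Local Notation mu := (lebesgue_rV R N).
Implicit Types (u v w : V -> R).

(** The p-th power of a norm only satisfies a triangle inequality with a
    factor [C]. Peeling terms off one by one multiplies the [i]-th term by
    [C^(i+1)], which the geometric smallness of the terms absorbs. *)
Lemma geometric_quasi_sum (F : (V -> R) -> \bar R) (C : R) : 0 < C ->
  F (fun=> 0) = 0%E ->
  (forall u v, measurable_fun setT u -> measurable_fun setT v ->
     (F (u \+ v)%R <= C%:E * (F u + F v))%E) ->
  forall n (a : nat -> V -> R) (c : R), 0 <= c ->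
  (forall i, measurable_fun setT (a i)) ->
  (forall i, (F (a i) <= (c * (2 * C)^-1 ^+ i.+1)%:E)%E) ->
  (F (fun x => (\sum_(i < n) a i x)%R) <= c%:E)%E.
Proof.
move=> C0 F0 FD; have q0 : 0 < (2 * C)^-1 by rewrite invr_gt0 mulr_gt0.
elim=> [|n IH] a c c0 ma ha.
  by rewrite [X in F X](_ : _ = fun=> 0) ?F0 ?lee_fin//; apply/funext => x; rewrite big_ord0.
rewrite [X in F X](_ : _ = (a 0%N \+ (fun x => \sum_(i < n) a i.+1 x))%R); last first.
  by apply/funext => x; rewrite big_ord_recl.
have h : (F (fun x => (\sum_(i < n) a i.+1 x)%R) <= (c * (2 * C)^-1)%:E)%E.
  apply: (IH (fun i => a i.+1)) => //; first by rewrite mulr_ge0// ltW.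
  by move=> i; rewrite -mulrA -exprS; exact: ha.
apply: (le_trans (FD _ _ (ma 0%N) _)).
  by apply: measurable_sum => i; exact: ma.
apply: (@le_trans _ _ (C%:E * ((c * (2 * C)^-1)%:E + (c * (2 * C)^-1)%:E))%E).
  by apply: lee_wpmul2l; [rewrite lee_fin ltW|apply: leeD => //; exact: ha].
by rewrite -EFinD -EFinM lee_fin le_eqVlt; apply/orP; left; apply/eqP; field; rewrite gt_eqF.
Qed.

Lemma power_int_fatou p (u_ : nat -> V -> R) u (c : \bar R) : 0 < p ->
  (forall n, measurable_fun setT (u_ n)) -> measurable_fun setT u ->
  {ae mu, forall x, u_ n x @[n --> \oo] --> u x} ->
  (\forall n \near \oo, power_int p (u_ n) <= c)%E -> (power_int p u <= c)%E.
Proof.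
move=> p0 mu_ mu0 uc h.
apply: (fatou_ae_le (f := fun n x => `|u_ n x| `^ p)) => //.
- by move=> n; exact: measurable_norm_powR.
- exact: measurable_norm_powR.
- by apply: filterS uc => x; exact: cvg_norm_powR.
Qed.

Lemma power_int0 p : 0 < p -> power_int p (fun _ : V => 0) = 0%E.
Proof.
move=> p0; rewrite /power_int; under eq_integral do rewrite normr0 powR0 ?gt_eqF//.
exact: integral0.
Qed.

Lemma gagliardo_energy0 sigma p : 0 < p -> gagliardo_energy sigma p (fun _ : V => 0) = 0%E.
Proof.
move=> p0.
have m0 : measurable_fun setT (fun _ : V => 0 : R) by exact: measurable_cst.
rewrite (gagliardo_energyE sigma p m0).
by apply: integral0_eq => z _; rewrite /gkern subrr normr0 powR0 ?gt_eqF// mul0r.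
Qed.

(** Two truncations of a sum agree as soon as both are past the last nonzero
    term. *)
Lemma sum_vanishing (f : nat -> R) m n :
  (forall i, (m <= i)%N -> f i = 0) -> (forall i, (n <= i)%N -> f i = 0) ->
  \sum_(i < m) f i = \sum_(i < n) f i.
Proof.
wlog mn : m n / (m <= n)%N.
  by move=> h hm hn; case/orP: (leq_total m n) => ?; [|symmetry]; exact: h.
move=> hm _; rewrite -(subnKC mn) big_split_ord/= [X in _ + X]big1 ?addr0// => i _.
by rewrite hm// leq_addr.
Qed.

Lemma smooth_measurable (phi : V -> R) : smooth_on setT phi -> measurable_fun setT phi.
Proof.
move=> sphi; apply: continuous_measurable_rV => x.
by have [] := sphi [::] x Logic.I.
Qed.

End quasi_sums.

Section meyers_serrin.
Context {R : realType} {N : nat}.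
Local Notation V := 'rV[R]_N.
Local Notation mu := (lebesgue_rV R N).
Context (p s : R) (Omega : set V) (u : V -> R).
Context (N0 : (0 < N)%N) (p1 : 1 < p) (s01 : 0 < s < 1) (oO : open Omega)
  (bO : bounded_set Omega) (mu0 : measurable_fun setT u)
  (uO : forall x, ~ Omega x -> u x = 0) (up : (power_int p u < +oo)%E)
  (us : (gagliardo_energy s p u < +oo)%E).

Let p0 : 0 < p. Proof. exact: lt_trans p1. Qed.
Let Ox : exists y, ~ Omega y. Proof. exact: exists_not_bounded. Qed.
Let d := dist_compl Omega.
Let w i := (layer Omega i \* u)%R.

Let mlayer i : measurable_fun setT (layer Omega i).
Proof. exact: measurable_of_lip (layer_lip Ox i). Qed.

Let mw i : measurable_fun setT (w i).
Proof. exact: measurable_funM. Qed.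

Lemma layer_out i x : layer Omega i x != 0 -> Omega x.
Proof.
move=> /(layer_supp Ox)[h _]; apply: contrapT => /(dist_compl_out Ox) h0.
by move: h; rewrite h0 mulr0; lra.
Qed.

(** The mollification scale [1 / (i + 1)] is below the distance from the
    support of the layer to the complement, so the approximation stays inside
    [Omega]; the bound [i * d x < 3] is what makes the sum over [i] locally
    finite. *)
Lemma approx_layer i (eps : R) : 0 < eps -> exists phi,
  [/\ smooth_on setT phi, forall x, phi x != 0 -> 0 < d x /\ i%:R * d x < 3,
      (power_int p (phi \- w i)%R <= eps%:E)%E &
      (gagliardo_energy s p (phi \- w i)%R <= eps%:E)%E].
Proof.
move=> e0.
have [s0 s1] := andP s01.
have l1 x : `|layer Omega i x| <= 1.
  by have /andP[? ?] := layer_itv Ox i x; rewrite ger0_norm.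
have wp : (power_int p (w i) < +oo)%E.
  apply: le_lt_trans up; apply: int_le.
  - by move=> x; exact: powR_ge0.
  - exact: measurable_norm_powR.
  - exact: measurable_norm_powR.
  move=> x; apply: ge0_ler_powR; rewrite ?nnegrE ?(ltW p0)//.
  by rewrite /w/= normrM ler_piMl.
have ws : (gagliardo_energy s p (w i) < +oo)%E.
  apply: (energy_cutoff_lty (L := (i.+1%:R + i%:R) `^ p) p0 s01) => //.
  apply: (lip_cutoff_of_lip p0) => //.
  - by rewrite -natrD ler1n.
  - by move=> x; exact: layer_itv.
  - exact: layer_lip.
have d0 : 0 < i.+1%:R^-1 :> R by rewrite invr_gt0.
have bA : bounded_set [set x | layer Omega i x != 0].
  have [M [Mr MO]] := bO; exists M; split => // a aM x /layer_out Ox'.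
  exact: (MO a aM).
have wA x : ~ layer Omega i x != 0 -> w i x = 0.
  by move=> /negP; rewrite negbK /w/= => /eqP ->; rewrite mul0r.
have [phi [sphi suppphi phip phis]] := approx_mollification p1 s0 d0 bA (mw i) wA wp ws.
have /ge0_cvge0P h1 := phip; have /ge0_cvge0P h2 := phis.
have [n [n1 n2]] : exists n, (power_int p (phi n \- w i)%R < eps%:E)%E /\
    (gagliardo_energy s p (phi n \- w i)%R < eps%:E)%E.
  have H1 := h1 (fun n => power_int_ge0 _ _) eps e0.
  have H2 := h2 (fun n => gagliardo_energy_ge0 _ _ _) eps e0.
  have [n _ Hn] := filterI H1 H2; exists n; exact: (Hn n (leqnn n)).
exists (phi n); split => //; try exact: ltW.
move=> x /suppphi[y /= /(layer_supp Ox)[y1 y2] xy].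
have i0 : 0 < i.+1%:R :> R by rewrite ltr0n.
rewrite -(ltr_pM2l i0) mulfV ?gt_eqF// in xy.
have h3 := dist_compl_lip Ox x y; have h4 := dist_compl_lip Ox y x; rewrite distrC in h4.
have i00 : 0 <= i%:R :> R by [].
have ii : i.+1%:R = i%:R + 1 :> R by rewrite -natr1.
have n0 := normr_ge0 (x - y).
rewrite ii in xy y1 i0; split.
  by rewrite -(pmulr_rgt0 _ i0); nra.
by nra.
Qed.

(** The mollified layers are added up. Near each point of [Omega] the sum is
    finite, hence smooth; the total error is the limit of the partial errors,
    each controlled by [geometric_quasi_sum]. *)
Lemma meyers_serrin_eps (eps : R) : 0 < eps -> exists phi,
  [/\ measurable_fun setT phi, smooth_zero_outside Omega phi,
      (power_int p (phi \- u)%R <= eps%:E)%E &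
      (gagliardo_energy s p (phi \- u)%R <= eps%:E)%E].
Proof.
move=> e0; have C0 : 0 < 2 `^ p :> R by rewrite powR_gt0.
pose eta i := eps * (2 * 2 `^ p)^-1 ^+ i.+1.
have eta0 i : 0 < eta i by rewrite mulr_gt0// exprn_gt0// invr_gt0 mulr_gt0.
have [f hf] := choice (fun i => approx_layer i (eta0 i)).
have sf i : smooth_on setT (f i) by have [] := hf i.
have mf i : measurable_fun setT (f i) by exact: smooth_measurable.
have supp i x : f i x != 0 -> 0 < d x /\ i%:R * d x < 3 by have [_ + _ _] := hf i; exact.
have supp0 i x r : 0 < r -> r <= d x -> 3 / r <= i%:R -> f i x = 0.
  move=> r0 rd ri; apply/eqP; apply: contraT => /supp[dx idx].
  move: ri; rewrite ler_pdivrMr// => ri.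
  have : i%:R * r <= i%:R * d x by rewrite ler_wpM2l.
  by move=> ?; exfalso; lra.
pose bnd (r : R) := (Num.trunc (3 / r)).+1.
have bndP r i : (bnd r <= i)%N -> 3 / r <= i%:R :> R.
  move=> ri; apply: (@le_trans _ _ (bnd r)%:R); last by rewrite ler_nat.
  by apply: ltW; exact: truncnS_gt.
have vanish x i : (bnd (d x) <= i)%N -> f i x = 0.
  move=> bi; have [dx|dx] := ltP 0 (d x); first exact: (supp0 i x (d x) dx (lexx _) (bndP _ _ bi)).
  apply/eqP; apply: contraT => /supp[dx' _].
  by have := le_lt_trans dx dx'; rewrite ltxx.
pose phi x := \sum_(i < bnd (d x)) f i x.
have phiE x n : (bnd (d x) <= n)%N -> \sum_(i < n) f i x = phi x.
  by move=> bn; apply: (sum_vanishing (f := fun i => f i x)) => i; [move/(leq_trans bn)|]; exact: vanish.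
have dc : continuous d.
  apply: (lipschitz_bound_continuous (L := 1)) => x y; rewrite mul1r.
  exact: dist_compl_lipN.
have phicvg x : (\sum_(i < n) (f i \- w i) x) @[n --> \oo] --> (phi \- u) x.
  have [K hK] : exists K, forall n, (K <= n)%N -> (cutoff Omega n x) * u x = u x.
    have [Oxx|Oxx] := pselect (Omega x); last by exists 0%N => n _; rewrite uO ?mulr0.
    have dx : 0 < d x by exact: dist_compl_gt0.
    exists (Num.trunc (2 / d x)).+1 => n hn.
    rewrite (cutoff_in (Omega := Omega)) ?mul1r// -ler_pdivrMr//.
    apply: (@le_trans _ _ (Num.trunc (2 / d x)).+1%:R); last by rewrite ler_nat.
    by apply: ltW; exact: truncnS_gt.
  apply: cvg_near_cst; exists (maxn (bnd (d x)) K) => // n /=.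
  rewrite geq_max => /andP[bn Kn].
  under eq_bigr do rewrite /=.
  by rewrite sumrB phiE//= -big_distrl/= layer_sum hK.
have mS n : measurable_fun setT (fun x => \sum_(i < n) (f i \- w i) x).
  by apply: measurable_sum => i; exact: measurable_funB.
have mphi : measurable_fun setT phi.
  have -> : phi = (phi \- u) \+ u by apply/funext => x /=; rewrite subrK.
  apply: measurable_funD => //.
  by apply: (measurable_fun_cvg mS) => x _; exact: phicvg.
exists phi; split => //.
- split; last first.
    move=> x Oxx; rewrite /phi big1// => i _; apply/eqP; apply: contraT => /supp[+ _].
    by rewrite /d dist_compl_out// ltxx.
  apply: smooth_on_local => x Oxx.
  have dx : 0 < d x by exact: dist_compl_gt0.
  have dx2 : 0 < d x / 2 by rewrite divr_gt0.
  exists [set y | d x / 2 < d y], (fun y => \sum_(i < bnd (d x / 2)) f i y); split.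
  + by apply: (open_comp (f := d) (D := [set r | d x / 2 < r])); [move=> y _; exact: dc|exact: open_gt].
  + by rewrite /= ltr_pdivrMr// ltr_pMr// ltr1n.
  + exact: smooth_on_sum.
  + move=> y /= xy; apply: (sum_vanishing (f := fun i => f i y)); first by move=> i; exact: vanish.
    by move=> i /bndP; apply: (supp0 _ _ _ dx2); exact: ltW.
- apply: (power_int_fatou p0 mS); first exact: measurable_funB.
    exact: aeW phicvg.
  apply: nearW => n.
  apply: (geometric_quasi_sum C0 (power_int0 p0) _ n (a := fun i => f i \- w i)) => //.
  + by move=> v v' mv mv'; apply: power_intD_le => //; exact: ltW.
  + exact: ltW.
  + by move=> i; exact: measurable_funB.
  + by move=> i; have [] := hf i.
- apply: (energy_fatou p0 (cvg_cst s) mS); first exact: measurable_funB.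
    exact: aeW phicvg.
  apply: nearW => n.
  apply: (geometric_quasi_sum C0 (gagliardo_energy0 s p0) _ n (a := fun i => f i \- w i)) => //.
  + by move=> v v' mv mv'; apply: gagliardo_energyD_le => //; exact: ltW.
  + exact: ltW.
  + by move=> i; exact: measurable_funB.
  + by move=> i; have [] := hf i.
Qed.

(** Density, for the Sobolev norm, of the functions that are smooth inside
    [Omega]. *)
Lemma meyers_serrin : Wtilde s p Omega u.
Proof.
split=> //.
have e0 n : 0 < n.+1%:R^-1 :> R by rewrite invr_gt0.
have [phi hphi] := choice (fun n => meyers_serrin_eps (e0 n)).
have mphi n : measurable_fun setT (phi n) by have [] := hphi n.
exists phi; split => [n|].
  have [_ sphi h1 h2] := hphi n; split => //; rewrite sobolev_norm_powR//.
  apply: poweR_lty.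
  have E : phi n = (phi n \- u) \+ u by apply/funext => x /=; rewrite subrK.
  have mB : measurable_fun setT (phi n \- u)%R by exact: measurable_funB.
  have hlt (a : R) (x y : \bar R) : (x <= a%:E)%E -> (y < +oo)%E ->
      ((2 `^ p)%:E * (x + y) < +oo)%E.
    move=> xa yoo; apply: lte_mul_pinfty; [by rewrite lee_fin powR_ge0|by []|].
    by apply: lte_add_pinfty => //; exact: le_lt_trans xa (ltry _).
  rewrite E; apply: lte_add_pinfty.
    apply: (le_lt_trans (power_intD_le (ltW p0) mB mu0)).
    exact: hlt h1 up.
  apply: (le_lt_trans (gagliardo_energyD_le s (ltW p0) mB mu0)).
  exact: hlt h2 us.
under eq_fun do rewrite sobolev_norm_powR//.
apply/poweR_cvg0P; first by rewrite invr_gt0.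
  by move=> n; rewrite adde_ge0 ?power_int_ge0 ?gagliardo_energy_ge0.
apply/ge0_cvge0P => [n|e e1].
  by rewrite adde_ge0 ?power_int_ge0 ?gagliardo_energy_ge0.
have e2 : 0 < e / 2 by rewrite divr_gt0.
have /cvgrPdist_lt/(_ _ e2) := @cvg_harmonic R; apply: filterS => n.
rewrite sub0r normrN ger0_norm ?(ltW (e0 n))// => h.
have [_ _ h1 h2] := hphi n.
apply: (le_lt_trans (leeD h1 h2)); rewrite -EFinD lte_fin (splitr e).
exact: ltrD.
Qed.

End meyers_serrin.

(** * The space W0 and finiteness of the eigenvalue *)

Lemma ae_eq0_of_int d (T : measurableType d) (R : realType) (mu : {measure set T -> \bar R})
  (f : T -> R) : measurable_fun setT f -> (forall x, 0 <= f x) ->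
  (\int[mu]_x (f x)%:E = 0)%E -> {ae mu, forall x, f x = 0}.
Proof.
move=> mf f0 If; have mfE : measurable_fun setT (EFin \o f) by exact/measurable_EFinP.
have [h _] := ae_eq_integral_abs mu measurableT mfE.
have : ae_eq mu setT (EFin \o f) (cst 0%E).
  apply: h; rewrite -[RHS]If; apply: eq_integral => x _ /=.
  by rewrite ger0_norm.
by apply: filterS => x /(_ Logic.I) [].
Qed.

Section closures.
Context {R : realType} {N : nat}.
Local Notation V := 'rV[R]_N.
Local Notation mu := (lebesgue_rV R N).
Implicit Types (u v w : V -> R).

Lemma power_intZ p (c : R) u : 0 < p -> measurable_fun setT u ->
  (power_int p (fun x => (c * u x)%R) = (`|c| `^ p)%:E * power_int p u)%E.
Proof.
move=> p0 mu0; rewrite /power_int -intZ ?powR_ge0//.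
- by apply: eq_integral => x _; rewrite normrM powRM.
- exact: measurable_norm_powR.
Qed.

Lemma gagliardo_energyZ sigma p (c : R) u : 0 < p -> measurable_fun setT u ->
  (gagliardo_energy sigma p (fun x => (c * u x)%R) =
   (`|c| `^ p)%:E * gagliardo_energy sigma p u)%E.
Proof.
move=> p0 mu0; rewrite !gagliardo_energyE//; last exact: measurable_funM.
rewrite -(intZ _ (powR_ge0 _ _) (gkern_ge0 sigma p u) (measurable_gkern sigma p mu0)).
apply: eq_integral => z _; congr EFin.
by rewrite /gkern -mulrBr normrM powRM// mulrA.
Qed.

(** Mollification at a scale below the margin [delta] keeps the support a
    compact subset of [Omega]. *)
Lemma W0_of_compact p sigma (Omega A : set V) delta w :
  1 < p -> 0 < sigma -> 0 < delta -> bounded_set A ->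
  (forall x y, A y -> `|x - y| < delta -> Omega x) ->
  measurable_fun setT w -> (forall x, ~ A x -> w x = 0) ->
  (power_int p w < +oo)%E -> (gagliardo_energy sigma p w < +oo)%E ->
  W0 sigma p Omega w.
Proof.
move=> p1 s0 d0 bA AO mw wA wp ws; have p0 : 0 < p by lra.
have d20 : 0 < delta / 2 by rewrite divr_gt0.
have [phi [sphi supp _ phis]] := approx_mollification p1 s0 d20 bA mw wA wp ws.
split => //.
  apply: aeW => x Ox; apply: wA => Ax; apply: Ox; apply: (AO x x Ax).
  by rewrite subrr normr0.
exists phi; split => [n|].
  exact: (smooth_compact_near d0 bA AO (sphi n) (supp n)).
exact/(gagliardo_cvg0P _ _ p0).
Qed.

(** The case [d = 1] of the splitting; the constant depends on the lower
    exponent only, which gives bounds uniform in [k]. *)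
Lemma energy_le_add p sigma : 0 < p -> 0 < sigma < 1 -> exists C : R, 0 <= C /\
  forall k w, sigma <= k -> measurable_fun setT w ->
  (gagliardo_energy sigma p w <= gagliardo_energy k p w + C%:E * power_int p w)%E.
Proof.
move=> p0 s01.
have km0 : (0 <= kern_mass (R:=R) (N:=N) sigma p)%E by apply: int_ge0 => z; exact: kern_ge0.
have [K [K0 KE]] := ge0_lty_EFin km0 (integral_kern_lty s01 p0).
exists (2 `^ p * 2 * K); split; first by rewrite !mulr_ge0 ?powR_ge0.
move=> k w sk mw; have /andP[s0 _] := s01.
have sk' : 0 < sigma <= k by rewrite s0.
apply: (le_trans (energy_split p0 ltr01 sk' mw)).
rewrite !powR1 mul1e minxx divr1 KE.
by apply: leeD => //; rewrite !EFinM -!muleA [(power_int p w * _)%E]muleC.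
Qed.

(** The Poincare inequality absorbs the L^p term, so the seminorms are ordered
    on functions vanishing off a bounded set. *)
Lemma energy_le_of_le p sigma k (Omega : set V) : (0 < N)%N -> 0 < p ->
  0 < sigma < 1 -> sigma <= k -> bounded_set Omega -> exists C : R, 0 <= C /\
  forall w, measurable_fun setT w -> {ae mu, forall x, ~ Omega x -> w x = 0} ->
  (gagliardo_energy sigma p w <= C%:E * gagliardo_energy k p w)%E.
Proof.
move=> N0 p0 s01 sk bO; have [C [C0 hC]] := energy_le_add p0 s01.
have k0 : 0 < k by case/andP: s01 => ? _; exact: lt_le_trans sk.
have [D [D0 hD]] := poincare N0 p0 k0 bO.
exists (1 + C * D); split; first by rewrite addr_ge0// mulr_ge0.
move=> w mw wO; apply: (le_trans (hC k w sk mw)).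
rewrite EFinD ge0_muleDl ?lee_fin ?mulr_ge0// mul1e EFinM -muleA.
by apply: leeD => //; apply: lee_wpmul2l; [rewrite lee_fin|exact: hD].
Qed.

Lemma smooth_compact_out (Omega : set V) phi : smooth_compact Omega phi ->
  forall x, ~ Omega x -> phi x = 0.
Proof.
move=> [_ _ sO] x Ox; apply/eqP; apply: contraT => phix; exfalso; apply: Ox.
by apply: sO; exact: subset_closure.
Qed.

(** Closure by arbitrarily good single approximations, the form suited to
    closure arguments. *)
Lemma W0P p sigma (Omega : set V) u : 0 < p -> W0 sigma p Omega u <->
  [/\ measurable_fun setT u, {ae mu, forall x, ~ Omega x -> u x = 0} &
    forall e : R, 0 < e -> exists phi, smooth_compact Omega phi /\
      (gagliardo_energy sigma p (phi \- u)%R < e%:E)%E].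
Proof.
move=> p0; split=> [[mu0 uO [phi [sphi phiu]]]|[mu0 uO h]]; split => //.
  move=> e e0; have /ge0_cvge0P h : gagliardo_energy sigma p (phi n \- u)%R @[n --> \oo] --> 0%E.
    exact/(gagliardo_cvg0P (fun=> sigma) (fun n => phi n \- u)%R p0).
  have [n _ hn] := h (fun n => gagliardo_energy_ge0 _ _ _) e e0.
  by exists (phi n); split => //; exact: (hn n (leqnn n)).
have e0 n : 0 < n.+1%:R^-1 :> R by rewrite invr_gt0.
have [phi hphi] := choice (fun n => h _ (e0 n)).
exists phi; split => [n|]; first by have [] := hphi n.
apply/(gagliardo_cvg0P (fun=> sigma) (fun n => phi n \- u)%R p0).
apply/ge0_cvge0P => [n|e e1]; first exact: gagliardo_energy_ge0.
have /cvgrPdist_lt/(_ _ e1) := @cvg_harmonic R; apply: filterS => n.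
rewrite sub0r normrN ger0_norm ?(ltW (e0 n))// => he.
by have [_ hn] := hphi n; apply: (lt_trans hn); rewrite lte_fin.
Qed.

Lemma W0_measurable p sigma (Omega : set V) u : W0 sigma p Omega u -> measurable_fun setT u.
Proof. by case. Qed.

Lemma smooth_compact_measurable (Omega : set V) phi :
  smooth_compact Omega phi -> measurable_fun setT phi.
Proof. by case => sphi _ _; exact: smooth_measurable. Qed.

Lemma W0_mono p sigma k (Omega : set V) u : (0 < N)%N -> 0 < p ->
  0 < sigma < 1 -> sigma <= k -> bounded_set Omega ->
  W0 k p Omega u -> W0 sigma p Omega u.
Proof.
move=> N0 p0 s01 sk bO Wu; have [mu0 uO h] := (W0P k Omega u p0).1 Wu.
refine ((W0P sigma Omega u p0).2 _).
split; [exact: mu0|exact: uO|move=> e e0].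
have [C [C0 hC]] := energy_le_of_le N0 p0 s01 sk bO.
have C1 : 0 < C + 1 by lra.
have [phi [sphi hphi]] := h (e / (C + 1)) (divr_gt0 e0 C1).
exists phi; split => //.
have mphi := smooth_compact_measurable sphi.
apply: (@le_lt_trans _ _ (C%:E * gagliardo_energy k p (phi \- u)%R)%E).
  apply: hC; first exact: measurable_funB.
  by apply: filterS uO => x ux Ox /=; rewrite ux// (smooth_compact_out sphi)// subr0.
have [r [r0 rE]] := ge0_lty_EFin (gagliardo_energy_ge0 k p (phi \- u)%R) (lt_trans hphi (ltry _)).
move: hphi; rewrite rE -EFinM !lte_fin ltr_pdivlMr// => hr.
by apply: le_lt_trans hr; rewrite mulrC ler_wpM2l//; lra.
Qed.

Lemma W0_closed p sigma (Omega : set V) u : 0 < p -> measurable_fun setT u ->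
  {ae mu, forall x, ~ Omega x -> u x = 0} ->
  (forall e : R, 0 < e -> exists2 v, W0 sigma p Omega v &
    (gagliardo_energy sigma p (v \- u)%R < e%:E)%E) -> W0 sigma p Omega u.
Proof.
move=> p0 mu0 uO h; refine ((W0P sigma Omega u p0).2 _).
split; [exact: mu0|exact: uO|move=> e e0].
have q0 : 0 < 2 `^ p :> R by rewrite powR_gt0.
have e1 : 0 < e / (2 * 2 `^ p) by rewrite divr_gt0// mulr_gt0.
have [v Wv vu] := h _ e1; have [mv vO hv] := (W0P sigma Omega v p0).1 Wv.
have [phi [sphi hphi]] := hv _ e1.
have mphi := smooth_compact_measurable sphi.
exists phi; split => //.
have -> : (phi \- u)%R = ((phi \- v) \+ (v \- u))%R.
  by apply/funext => x /=; rewrite addrA subrK.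
apply: (le_lt_trans (gagliardo_energyD_le sigma (ltW p0) _ _)); try exact: measurable_funB.
apply: (@lt_le_trans _ _ ((2 `^ p)%:E * ((e / (2 * 2 `^ p))%:E + (e / (2 * 2 `^ p))%:E))%E).
  by rewrite lte_pmul2l; [exact: (lteD hphi vu)|by []|rewrite lte_fin].
rewrite -EFinD -EFinM lee_fin le_eqVlt; apply/orP; left; apply/eqP.
by field; rewrite gt_eqF.
Qed.

Lemma cutoff_W0 p sigma (Omega : set V) m (c : R) : (0 < N)%N -> 1 < p ->
  0 < sigma < 1 -> bounded_set Omega ->
  W0 sigma p Omega (fun x => c * cutoff Omega m.+1 x) /\
  (power_int p (cutoff Omega m.+1) < +oo)%E /\
  (gagliardo_energy sigma p (cutoff Omega m.+1) < +oo)%E.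
Proof.
move=> N0 p1 s01 bO; have p0 : 0 < p by lra.
have Ox := exists_not_bounded N0 bO.
have [r [r0 Or]] := bounded_set_cube bO.
have ci x : 0 <= cutoff Omega m.+1 x <= 1 by exact: clip_itv.
have mc : measurable_fun setT (cutoff Omega m.+1) := measurable_of_lip (cutoff_lip Ox m.+1).
have m0 : 0 < m.+1%:R :> R by rewrite ltr0n.
pose A := [set x | cutoff Omega m.+1 x != 0].
have Ad x : A x -> m.+1%:R^-1 < dist_compl Omega x.
  move=> Ax; rewrite ltNge; apply/negP => h; move/eqP: Ax; apply.
  by apply: cutoff_out; rewrite mulrC -ler_pdivlMr// div1r.
have AO x : 0 < dist_compl Omega x -> Omega x.
  by move=> dx; apply: contrapT => /(dist_compl_out Ox) h; rewrite h ltxx in dx.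
have cO x : ~ cube r x -> cutoff Omega m.+1 x = 0.
  move=> xr; apply/eqP; apply: contraT => /Ad h; exfalso; apply: xr; apply: Or.
  by apply: AO; apply: lt_trans h; rewrite invr_gt0.
have cp : (power_int p (cutoff Omega m.+1) < +oo)%E.
  apply: le_lt_trans (cube_measure_lty (R := R) (N := N) r).
  rewrite -[cube r]setIT -integral_indic//; last exact: measurable_cube.
  apply: int_le.
  - by move=> x; exact: powR_ge0.
  - exact: measurable_norm_powR.
  - exact: measurable_indic (measurable_cube r).
  move=> x; rewrite indicE; have [_|/negP xr] := boolP (x \in cube r).
    have /andP[a0 a1] := ci x.
    have -> : true%:R = 1 `^ p :> R by rewrite powR1.
    rewrite ger0_norm//.
    by apply: ge0_ler_powR; rewrite ?nnegrE ?(ltW p0).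
  by rewrite cO ?normr0 ?powR0 ?gt_eqF// => /mem_set.
have cs : (gagliardo_energy sigma p (cutoff Omega m.+1) < +oo)%E.
  apply: (energy_bump_lty (L := m.+1%:R `^ p) p0 s01 (powR_ge0 _ _) mc
    (measurable_cube r) (cube_measure_lty r) cO).
  by apply: (lip_cutoff_of_lip p0); [rewrite ler1n|exact: ci|exact: cutoff_lip].
split => //; have [s0 s1] := andP s01.
have d0 : 0 < m.+1%:R^-1 :> R by rewrite invr_gt0.
have bA : bounded_set A.
  have [M [Mr MO]] := bO; exists M; split => // a aM x /Ad Ax.
  by apply: (MO a aM); apply: AO; exact: lt_trans Ax.
have mcc : measurable_fun setT (fun x => c * cutoff Omega m.+1 x).
  exact: measurable_funM.
have cc0 : (0 <= (`|c| `^ p)%:E)%E by rewrite lee_fin powR_ge0.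
apply: (W0_of_compact p1 s0 d0 bA _ mcc).
- move=> x y /Ad Ay xy; apply: AO; have := dist_compl_lip Ox y x; rewrite distrC.
  by move=> h; rewrite -(ltrD2r `|x - y|) add0r; exact: lt_le_trans (lt_trans xy Ay) h.
- by move=> x /negP; rewrite negbK => /eqP ->; rewrite mulr0.
- by rewrite (power_intZ c p0 mc); exact: lte_mul_pinfty.
- by rewrite (gagliardo_energyZ sigma c p0 mc); exact: lte_mul_pinfty.
Qed.

(** A normalised cutoff is an admissible function of finite energy. Some
    cutoff is not null: otherwise [Omega] would be null, and no function
    vanishing outside it could have norm 1. *)
Lemma lambda1_lty p sigma (Omega : set V) u : (0 < N)%N -> 1 < p ->
  0 < sigma < 1 -> open Omega -> bounded_set Omega ->
  admissible sigma p Omega u -> (lambda1 sigma p Omega < +oo)%E.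
Proof.
move=> N0 p1 s01 oO bO [[mu0 uO _] u1 _]; have p0 : 0 < p by lra.
have mO : measurable Omega by exact: open_measurable_rV.
have Ox := exists_not_bounded N0 bO.
have {}u1 : power_int p u = 1%E by apply/(Lp_norm_eq1 p0 mO mu0 uO).
have mc m : measurable_fun setT (cutoff Omega m) := measurable_of_lip (cutoff_lip Ox m).
have [m cm] : exists m, power_int p (cutoff Omega m.+1) <> 0%E.
  apply: contrapT => h.
  have h0 m : {ae mu, forall x, `|cutoff Omega m.+1 x| `^ p = 0}.
    apply: ae_eq0_of_int => //; first exact: measurable_norm_powR.
    by apply: contrapT => h'; apply: h; exists m.
  have u0 : {ae mu, forall x, `|u x| `^ p = (fun=> 0) x}.
    apply: filterS2 uO (ae_foralln h0) => x ux hx.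
    rewrite ux ?normr0 ?powR0 ?gt_eqF// => Oxx.
    have dx : 0 < dist_compl Omega x by exact: dist_compl_gt0.
    have := hx (Num.trunc (2 / dist_compl Omega x)).
    rewrite cutoff_in ?normr1 ?powR1; first by move=> /eqP; rewrite oner_eq0.
    by rewrite -ler_pdivrMr//; apply: ltW; exact: truncnS_gt.
  have : power_int p u = 0%E.
    transitivity (\int[mu]_x ((fun=> 0 : R) x)%:E)%E; last exact: integral0.
    by apply: int_ae_eq => //; [exact: measurable_norm_powR].
  by rewrite u1 => /eqP; rewrite onee_eq0.
have [_ [cp cs]] := cutoff_W0 m 1 N0 p1 s01 bO.
have [r [r0 rE]] := ge0_lty_EFin (power_int_ge0 p (cutoff Omega m.+1)) cp.
have {}r0 : 0 < r by rewrite lt_neqAle r0 andbT eq_sym; apply/eqP => r00; apply: cm; rewrite rE r00.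
pose c := r `^ (- p^-1).
have c0 : 0 <= c by exact: powR_ge0.
have [cW _] := cutoff_W0 m c N0 p1 s01 bO.
have mcc : measurable_fun setT (fun x => c * cutoff Omega m.+1 x) by case: cW.
apply: (@le_lt_trans _ _ (gagliardo_energy sigma p (fun x => c * cutoff Omega m.+1 x)%R)).
  apply: ereal_inf_lbound; exists (fun x => c * cutoff Omega m.+1 x); last exact: gagliardo_powR.
  split => //; last first.
    by apply: aeW => x; rewrite mulr_ge0//; have /andP[] := clip_itv (m.+1%:R * dist_compl Omega x - 1).
  apply/(Lp_norm_eq1 p0 mO mcc); first by case: cW.
  rewrite power_intZ// rE -EFinM; congr EFin.
  rewrite ger0_norm// /c -powRrM mulNr mulVf ?gt_eqF// powRN powRr1 ?(ltW r0)//.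
  by rewrite mulVf// gt_eqF.
by rewrite gagliardo_energyZ// lte_mul_pinfty// lee_fin powR_ge0.
Qed.

End closures.

(** * Dependence of the energy on the exponent *)

Section limits_of_energies.
Context {R : realType} {N : nat}.
Local Notation V := 'rV[R]_N.
Local Notation mu := (lebesgue_rV R N).
Local Notation mm := (mu \x mu)%E.
Implicit Types (u v w : V -> R).

(** For [|x - y| <= 1] the largest exponent dominates, for [|x - y| >= 1] the
    smallest. *)
Lemma gkern_exponent_le p sigma0 k s u z : 0 < p -> 0 < sigma0 -> sigma0 <= k <= s ->
  gkern k p u z <= gkern sigma0 p u z + gkern s p u z.
Proof.
move=> p0 s0 /andP[sk ks].
have [z12|z12] := eqVneq z.1 z.2.
  by rewrite /gkern z12 subrr normr0 powR0 ?gt_eqF// !mul0r addr0.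
have e0 : 0 < enorm (z.1 - z.2) by rewrite enorm_gt0// subr_eq0.
have [e1|e1] := leP (enorm (z.1 - z.2)) 1.
  apply: (@le_trans _ _ (gkern s p u z)); last by rewrite lerDr gkern_ge0.
  apply: ler_wpM2l; first exact: powR_ge0.
  rewrite lef_pV2 ?posrE ?powR_gt0//; apply: ger_powR; first by rewrite e0.
  by rewrite lerD2l ler_pM2r.
apply: (@le_trans _ _ (gkern sigma0 p u z)); last by rewrite lerDl gkern_ge0.
apply: ler_wpM2l; first exact: powR_ge0.
rewrite lef_pV2 ?posrE ?powR_gt0//; apply: ler_powR; first exact: ltW.
by rewrite lerD2l ler_pM2r.
Qed.

Lemma energy_cvg_exponent p sigma0 s (k : nat -> R) u : 0 < p -> 0 < sigma0 ->
  (forall n, sigma0 <= k n <= s) -> k @ \oo --> s -> measurable_fun setT u ->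
  (gagliardo_energy sigma0 p u < +oo)%E -> (gagliardo_energy s p u < +oo)%E ->
  gagliardo_energy (k n) p u @[n --> \oo] --> gagliardo_energy s p u.
Proof.
move=> p0 s0 hk ks mu0 h0 hs; rewrite gagliardo_energyE//.
under eq_fun do rewrite gagliardo_energyE//.
have mg sg := measurable_gkern sg p mu0.
pose g z := ((gkern sigma0 p u z + gkern s p u z)%:E : \bar R).
have mgE sg : measurable_fun setT (fun z => (gkern sg p u z)%:E) by exact/measurable_EFinP.
have ig : mm.-integrable setT g.
  apply/integrableP; split.
    by apply/measurable_EFinP; apply: measurable_funD; exact: mg.
  have -> : (\int[mm]_z `|g z| = gagliardo_energy sigma0 p u + gagliardo_energy s p u)%E.
    rewrite !gagliardo_energyE// -(intD mm (gkern_ge0 _ _ _) (gkern_ge0 _ _ _) (mg _) (mg _)).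
    by apply: eq_integral => z _ /=; rewrite ger0_norm// addr_ge0 ?gkern_ge0.
  exact: (lte_add_pinfty h0 hs).
have cv : {ae mm, forall z, setT z -> (gkern (k n) p u z)%:E @[n --> \oo] --> (gkern s p u z)%:E}.
  apply: aeW => z _; apply: cvg_EFin; first exact: nearW.
  by apply: (gkern_cvg (u_ := fun=> u) p0 ks); exact: cvg_cst.
have dom : {ae mm, forall z n, setT z -> (`|(gkern (k n) p u z)%:E| <= g z)%E}.
  apply: aeW => z n _ /=; rewrite lee_fin ger0_norm ?gkern_ge0//.
  exact: gkern_exponent_le.
by have [] := dominated_convergence measurableT (fun n => mgE (k n)) (mgE s) cv ig dom.
Qed.

(** In [energy_split] the distance [d] is chosen first, to make the term with
    the bounded energy small, and then the L^p convergence handles the other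
    term. *)
Lemma energy_interpolation_cvg0 p sigma sigma' (w : nat -> V -> R) (B : R) :
  0 < p -> 0 < sigma < 1 -> sigma < sigma' -> 0 <= B ->
  (forall n, measurable_fun setT (w n)) ->
  (\forall n \near \oo, gagliardo_energy sigma' p (w n) <= B%:E)%E ->
  power_int p (w n) @[n --> \oo] --> 0%E ->
  gagliardo_energy sigma p (w n) @[n --> \oo] --> 0%E.
Proof.
move=> p0 s01 ss B0 mw hB hw; have /andP[s0 _] := s01.
have km0 : (0 <= kern_mass (R:=R) (N:=N) sigma p)%E by apply: int_ge0 => z; exact: kern_ge0.
have [K [K0 KE]] := ge0_lty_EFin km0 (integral_kern_lty s01 p0).
apply/ge0_cvge0P => [n|e e0]; first exact: gagliardo_energy_ge0.
set a := (sigma' - sigma) * p.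
have a0 : 0 < a by rewrite mulr_gt0// subr_gt0.
have B1 : 0 < 2 * (B + 1) by rewrite mulr_gt0// ltr_wpDl.
pose d := (e / (2 * (B + 1))) `^ a^-1.
have eB0 : 0 < e / (2 * (B + 1)) by rewrite divr_gt0.
have d0 : 0 < d by rewrite powR_gt0.
have da : d `^ a = e / (2 * (B + 1)) by rewrite /d powRVK ?gt_eqF// ltW.
pose L := 2 `^ p / Num.min 1 (d `^ p) * 2 * K.
have L0 : 0 <= L.
  by rewrite !mulr_ge0 ?powR_ge0// invr_ge0 le_min ler01 powR_ge0.
have L1 : 0 < 2 * (L + 1) by rewrite mulr_gt0// ltr_wpDl.
have /ge0_cvge0P/(_ _ (divr_gt0 e0 L1)) h2 := hw.
have := h2 (fun n => power_int_ge0 _ _); apply: filterS2 hB => n hB hn.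
have sk : 0 < sigma <= sigma' by rewrite s0 ltW.
apply: (le_lt_trans (energy_split p0 d0 sk (mw n))).
have [P [P0 PE]] := ge0_lty_EFin (power_int_ge0 p (w n)) (lt_trans hn (ltry _)).
have [G [G0 GE]] := ge0_lty_EFin (gagliardo_energy_ge0 sigma' p (w n)) (le_lt_trans hB (ltry _)).
move: hB hn; rewrite KE PE GE -[2%E]/(2%:E) -!EFinM -EFinD !lte_fin !lee_fin => hB hn.
rewrite -/a da ltr_pdivlMr// in hn *.
rewrite (splitr e); apply: ltr_leD.
  rewrite mulrAC ltr_pdivrMr// [ltRHS]mulrAC ltr_pdivlMr//.
  have : e * G <= e * B by rewrite ler_pM2l.
  by move=> ?; nra.
have -> : 2 `^ p / Num.min 1 (d `^ p) * (2 * (P * K)) = L * P by rewrite /L; ring.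
have : L * P <= (L + 1) * P by rewrite ler_wpM2r// lerDl.
by move=> ?; nra.
Qed.

(** Continuity of the norm, by Minkowski's inequality. *)
Lemma power_int_cvg p (v : nat -> V -> R) u : 1 < p ->
  (forall n, measurable_fun setT (v n)) -> measurable_fun setT u ->
  (forall n, power_int p (v n) = 1%E) -> power_int p (v n \- u)%R @[n --> \oo] --> 0%E ->
  power_int p u = 1%E.
Proof.
move=> p1 mv mu0 hv hu; have p0 : 0 < p by lra.
pose nr (w : V -> R) := ('N[mu]_(p%:E)[EFin \o w])%E.
have nrE w : (nr w `^ p = power_int p w)%E by rewrite /nr powR_Lnorm ?gt_eqF//; apply: eq_integral => x _; rewrite poweR_EFin.
have nrV w : nr w = (power_int p w `^ p^-1)%E.
  by rewrite -nrE -poweRrM mulfV ?gt_eqF// poweRe1//; exact: Lnorm_ge0.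
have tri w w' : measurable_fun setT w -> measurable_fun setT w' ->
    (nr (w \+ w')%R <= nr w + nr w')%E.
  by move=> mw mw'; exact: (minkowski_EFin mu mw mw' (ltW p1)).
have v1 n : nr (v n) = 1%E by rewrite nrV hv poweR1r.
have mB n : measurable_fun setT (v n \- u)%R by exact: measurable_funB.
have dn : nr (v n \- u)%R @[n --> \oo] --> 0%E.
  under eq_fun do rewrite nrV.
  by apply/poweR_cvg0P => //; [rewrite invr_gt0|move=> n; exact: power_int_ge0].
have nN w : nr (fun x => - w x) = nr w.
  have E : power_int p (fun x => - w x) = power_int p w.
    by apply: eq_integral => x _; rewrite normrN.
  by rewrite (nrV (fun x => - w x)) (nrV w) E.
have small (e : R) : 0 < e -> exists n, (nr (v n \- u)%R <= e%:E)%E.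
  move=> e0; have /ge0_cvge0P/(_ _ e0) h := dn.
  by have [n _ hn] := h (fun n => Lnorm_ge0 _ _ _); exists n; exact: ltW (hn n (leqnn n)).
have : nr u = 1%E.
  apply/eqP; rewrite eq_le; apply/andP; split; apply/lee_addgt0Pr => e e0; have [n hn] := small e e0.
    have -> : u = ((v n) \+ (fun x => - (v n \- u) x))%R by apply/funext => x /=; rewrite opprB addrC subrK.
    apply: (le_trans (tri _ _ (mv n) _)); last by rewrite v1 nN leeD2l.
    exact: measurableT_comp.
  rewrite -(v1 n) {1}(_ : v n = ((v n \- u) \+ u)%R); last by apply/funext => x /=; rewrite subrK.
  by apply: (le_trans (tri _ _ (mB n) mu0)); rewrite addeC leeD2l.
by rewrite -nrE => ->; rewrite poweR1r.
Qed.

End limits_of_energies.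

(** * The limit of the eigenfunctions *)

Lemma cvg_at_left_seq (R : realType) (f : R -> \bar R) (s : R) (l : \bar R) (k : nat -> R) :
  f x @[x --> s^'-] --> l -> (forall n, k n < s) -> k @ \oo --> s ->
  f (k n) @[n --> \oo] --> l.
Proof.
move=> fl ks kc; have kl : k @ \oo --> s^'-.
  move=> A hA; have : \forall n \near \oo, k n < s -> A (k n) by exact: kc hA.
  by apply: filterS => n; exact.
by move=> A hA; exact: (kl _ (fl A hA)).
Qed.

Section limit_eigenfunction.
Context {R : realType} {N : nat}.
Local Notation V := 'rV[R]_N.
Local Notation mu := (lebesgue_rV R N).
Context (p s : R) (Omega : set V) (u_ : R -> V -> R).
Context (N0 : (0 < N)%N) (p1 : 1 < p) (s01 : 0 < s < 1)
  (oO : open Omega) (bO : bounded_set Omega)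
  (hu : forall sigma : R, 0 < sigma < 1 -> first_eigenfunction sigma p Omega (u_ sigma))
  (lc : lambda1 k p Omega @[k --> s^'-] --> lambda1 s p Omega).

Let p0 : 0 < p. Proof. exact: lt_trans p1. Qed.
Let mO : measurable Omega. Proof. exact: open_measurable_rV. Qed.

Lemma admissibleP sigma u : 0 < sigma < 1 -> admissible sigma p Omega u <->
  [/\ W0 sigma p Omega u, power_int p u = 1%E & {ae mu, forall x, 0 <= u x}].
Proof.
move=> sg; split=> [[Wu u1 u0]|[Wu u1 u0]]; have [mu0 uO _] := Wu; split => //.
  exact/(Lp_norm_eq1 p0 mO mu0 uO).
exact/(Lp_norm_eq1 p0 mO mu0 uO).
Qed.

Lemma lambda1_ge0 sigma : (0 <= lambda1 sigma p Omega)%E.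
Proof. by apply: le_ereal_inf_tmp => _ [u _ <-]; exact: poweR_ge0. Qed.

Lemma lambda1_le sigma u : 0 < sigma < 1 -> W0 sigma p Omega u ->
  power_int p u = 1%E -> {ae mu, forall x, 0 <= u x} ->
  (lambda1 sigma p Omega <= gagliardo_energy sigma p u)%E.
Proof.
move=> sg Wu u1 u0; rewrite -(gagliardo_powR sigma u p0).
apply: ereal_inf_lbound; exists u => //.
exact: ((admissibleP u sg).2 (And3 Wu u1 u0)).
Qed.

Lemma eigenfunctionP sigma : 0 < sigma < 1 ->
  [/\ W0 sigma p Omega (u_ sigma), power_int p (u_ sigma) = 1%E,
    {ae mu, forall x, 0 <= u_ sigma x},
    gagliardo_energy sigma p (u_ sigma) = lambda1 sigma p Omega &
    (lambda1 sigma p Omega < +oo)%E].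
Proof.
move=> sg; have [au eu] := hu sg; have [Wu u1 u0] := (admissibleP _ sg).1 au.
split => //; first by rewrite -(gagliardo_powR sigma (u_ sigma) p0).
exact: (lambda1_lty N0 p1 sg oO bO au).
Qed.

(** The subsequence of [rellich_kolmogorov] after dropping the finitely many
    indices with a small exponent or a large energy. The limit has energy at
    most [lambda_s] by Fatou's lemma and at least [lambda_s] because it
    competes at every lower exponent. *)
Lemma limit_eigenfunction (k : nat -> R) : (forall n, 0 < k n < s) -> k @ \oo --> s ->
  exists phi : nat -> nat, {homo phi : m n / (m < n)%N} /\ exists u : V -> R,
  [/\ measurable_fun setT u, forall x, ~ Omega x -> u x = 0,
    {ae mu, forall x, 0 <= u x}, power_int p u = 1%E &
    gagliardo_energy s p u = lambda1 s p Omega /\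
    gagliardo_energy (k (phi j)) p (u_ (k (phi j)) \- u)%R @[j --> \oo] --> 0%E].
Proof.
move=> hk kc.
have [s0 s1] := andP s01.
have k01 n : 0 < k n < 1 by case/andP: (hk n) => -> /lt_trans ->.
have kls n : k n < s by case/andP: (hk n).
have mu_ n : measurable_fun setT (u_ (k n)) by have [[]] := eigenfunctionP (k01 n).
have lk := cvg_at_left_seq lc kls kc.
have [_ _ _ _ ls] := eigenfunctionP s01.
have [L [L0 LE]] := ge0_lty_EFin (lambda1_ge0 s) ls.
pose sg := s / 2.
have sg01 : 0 < sg < 1 by rewrite /sg; apply/andP; split; lra.
have [sg0 sg1] := andP sg01.
have sgs : sg < s by rewrite /sg; lra.
(* [lambda_k] converges to the finite value [lambda_s], so the energies at one
   fixed exponent below [s] are eventually bounded *)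
have nearE (e : R) : 0 < e -> \forall n \near \oo,
    (gagliardo_energy (k n) p (u_ (k n)) <= (L + e)%:E)%E.
  move=> e0; have := lk; rewrite LE => /fine_cvgP[fk /cvgrPdist_lt/(_ _ e0)].
  apply: filterS2 fk => n fn; have [_ _ _ -> _] := eigenfunctionP (k01 n).
  rewrite -[leLHS]fineK// lee_fin /= distrC ltr_distl => /andP[_ h].
  by apply: ltW.
have nears (r : R) : r < s -> \forall n \near \oo, r <= k n.
  move=> rs; have rs0 : 0 < s - r by rewrite subr_gt0.
  move/cvgrPdist_lt : kc => /(_ _ rs0); apply: filterS => n.
  by rewrite ltr_norml => /andP[_ h]; lra.
have [n0 _ hn0] := filterI (nearE 1 ltr01) (nears sg sgs).
have [C [C0 hC]] := energy_le_add (N := N) p0 sg01.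
pose v n := u_ (k (n + n0)%N).
have vE n : (gagliardo_energy sg p (v n) <= (L + 1 + C)%:E)%E.
  have [h1 h2] := hn0 (n + n0)%N (leq_addl _ _).
  apply: (le_trans (hC _ _ h2 (mu_ _))).
  have [_ -> _ _ _] := eigenfunctionP (k01 (n + n0)%N).
  by rewrite mule1 EFinD; exact: leeD.
have vO n : {ae mu, forall x, ~ Omega x -> v n x = 0}.
  by have [[]] := eigenfunctionP (k01 (n + n0)%N).
have E0 : 0 <= Num.max 1 (L + 1 + C) by rewrite le_max ler01.
have vE' n : (gagliardo_energy sg p (v n) <= (Num.max 1 (L + 1 + C))%:E)%E.
  by apply: (le_trans (vE n)); rewrite lee_fin le_max lexx orbT.
have vP n : (power_int p (v n) <= (Num.max 1 (L + 1 + C))%:E)%E.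
  have [_ -> _ _ _] := eigenfunctionP (k01 (n + n0)%N).
  by rewrite lee_fin le_max lexx.
have [phi [phii [u [mu0 uO vu pvu]]]] := rellich_kolmogorov N0 p0 sg0 E0 mO bO
  (fun n => mu_ (n + n0)%N) vO vE' vP.
pose psi j := (phi j + n0)%N.
exists psi; split; first by move=> m n /phii; rewrite /psi ltn_add2r.
pose w j := u_ (k (psi j)).
have psii : {homo psi : m n / (m < n)%N} by move=> m n /phii; rewrite /psi ltn_add2r.
have psic := cvg_extraction psii.
have nearpsi (P : set nat) : (\forall n \near \oo, P n) -> \forall j \near \oo, P (psi j).
  by move=> hP; exact: psic P hP.
have kpsi : k (psi j) @[j --> \oo] --> s by move=> A hA; exact: (psic _ (kc A hA)).
have nearEw (e : R) : 0 < e -> \forall j \near \oo,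
    (gagliardo_energy (k (psi j)) p (w j) <= (L + e)%:E)%E.
  by move=> e0; have := nearpsi _ (nearE e e0).
have nearsw (r : R) : r < s -> \forall j \near \oo, r <= k (psi j).
  by move=> rs; have := nearpsi _ (nears r rs).
have mw j : measurable_fun setT (w j) := mu_ (psi j).
have w1 j : power_int p (w j) = 1%E by have [] := eigenfunctionP (k01 (psi j)).
have u1 : power_int p u = 1%E := power_int_cvg p1 mw mu0 w1 pvu.
have u0 : {ae mu, forall x, 0 <= u x}.
  have w0 : {ae mu, forall x, forall j, 0 <= w j x}.
    by apply: ae_foralln => j; have [] := eigenfunctionP (k01 (psi j)).
  apply: filterS2 vu w0 => x ux w0; apply: (cvgr_to_ge ux); exact: nearW.
(* the exponent moves with the sequence, which [energy_fatou] allows *)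
have uL : (gagliardo_energy s p u <= L%:E)%E.
  apply/lee_addgt0Pr => e e0; rewrite -EFinD.
  exact: (energy_fatou p0 kpsi mw mu0 vu (nearEw e e0)).
have us : (gagliardo_energy s p u < +oo)%E := le_lt_trans uL (ltry _).
have ub sigma : 0 < sigma < 1 -> sigma <= s -> exists B : R,
    (gagliardo_energy sigma p u <= B%:E)%E /\ 0 <= B /\
    \forall j \near \oo, sigma <= k (psi j) -> (gagliardo_energy sigma p (w j) <= B%:E)%E.
  move=> sg' ss; have [D [D0 hD]] := energy_le_add (N := N) p0 sg'.
  exists (L + 1 + D); split; [|split].
  - apply: (le_trans (hD s u ss mu0)); rewrite u1 mule1 EFinD; apply: leeD => //.
    by apply: (le_trans uL); rewrite lee_fin; lra.
  - by rewrite !addr_ge0.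
  - apply: filterS (nearEw 1 ltr01) => j hj sk.
    by apply: (le_trans (hD _ _ sk (mw j))); rewrite w1 mule1 EFinD; exact: leeD.
(* interpolation needs a bound at an exponent strictly above [sigma]; the
   midpoint with [s] is one at which [u] and the sequence are both bounded *)
have strong sigma : 0 < sigma -> sigma < s ->
    gagliardo_energy sigma p (w j \- u)%R @[j --> \oo] --> 0%E.
  move=> sig0 sigs; pose si := (sigma + s) / 2.
  have [ssi sis] : sigma < si /\ si < s by rewrite /si !midf_lt.
  have si01 : 0 < si < 1 by rewrite (lt_trans sig0 ssi) (lt_trans sis s1).
  have [B [uB [B0 wB]]] := ub si si01 (ltW sis).
  have sig01 : 0 < sigma < 1 by rewrite sig0 (lt_trans sigs).
  have BB0 : 0 <= 2 `^ p * (B + B) by rewrite mulr_ge0 ?powR_ge0// addr_ge0.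
  apply: (energy_interpolation_cvg0 p0 sig01 ssi BB0) pvu.
    by move=> j; exact: measurable_funB.
  apply: filterS2 wB (nearsw si sis) => j hw /hw hj.
  apply: (le_trans (gagliardo_energyB_le si (ltW p0) (mw j) mu0)).
  rewrite EFinM EFinD; apply: lee_wpmul2l; first by rewrite lee_fin powR_ge0.
  exact: (leeD hj uB).
have uO' : {ae mu, forall x, ~ Omega x -> u x = 0} by exact: aeW.
have W0u sigma : 0 < sigma -> sigma < s -> W0 sigma p Omega u.
  move=> sig0 sigs; apply: (W0_closed p0 mu0 uO') => e e0.
  have /ge0_cvge0P/(_ _ e0) h := strong sigma sig0 sigs.
  have [j _ hj] := filterI (h (fun j => gagliardo_energy_ge0 _ _ _)) (nearsw sigma sigs).
  have [hj1 hj2] := hj j (leqnn j).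
  exists (w j) => //; have [Ww _ _ _ _] := eigenfunctionP (k01 (psi j)).
  have sig01 : 0 < sigma < 1 by rewrite sig0 (lt_trans sigs).
  exact: (W0_mono N0 p0 sig01 hj2 bO Ww).
(* here the energy of [u] at [s] itself has to be finite: it dominates the
   integrands near the diagonal *)
have [B [uB _]] := ub sg sg01 (ltW sgs).
have cu : gagliardo_energy (k (psi j)) p u @[j --> \oo] --> gagliardo_energy s p u.
  apply: (energy_cvg_exponent p0 sg0 _ kpsi mu0 (le_lt_trans uB (ltry _)) us) => j.
  have [_ h2] := hn0 (psi j) (leq_addl _ _).
  by rewrite h2 ltW.
have lw : lambda1 (k (psi j)) p Omega @[j --> \oo] --> lambda1 s p Omega.
  exact: cvge_subseq psii lk.
have us_eq : gagliardo_energy s p u = lambda1 s p Omega.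
  apply/eqP; rewrite eq_le; apply/andP; split; first by rewrite LE.
  apply: (lee_cvg_to lw cu); apply: nearW => j.
  have [kj0 kjs] := andP (hk (psi j)).
  by apply: lambda1_le => //; exact: W0u.
exists u; split => //; split => //.
have cw : gagliardo_energy (k (psi j)) p (w j) @[j --> \oo] --> gagliardo_energy s p u.
  rewrite us_eq [X in X @ _ --> _](_ : _ = fun j => lambda1 (k (psi j)) p Omega)//.
  by apply/funext => j; have [] := eigenfunctionP (k01 (psi j)).
exact: (energy_scheffe p0 kpsi mw mu0 vu us cw cu).
Qed.

End limit_eigenfunction.

(** * Hidden convexity *)

Section hidden_convexity.
Context {R : realType}.
Implicit Types (a b c d m t x y p theta : R).

(** With [t = e^y] this is [e^((p-1) y) + (p-1) e^(-y) > p], which follows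
    from [e^z > 1 + z] applied to both exponentials. *)
Lemma bernoulli_powR p t : 1 < p -> 0 <= t -> t != 1 -> 1 + p * (t - 1) < t `^ p.
Proof.
move=> p1; rewrite le_eqVlt => /predU1P[<- _|t0 t1].
  by rewrite powR0 ?gt_eqF; lra.
have lt0 : ln t != 0 by apply: contra t1 => /eqP h; rewrite -(lnK t0) h expR0.
have h1 : 1 + (p - 1) * ln t < expR ((p - 1) * ln t).
  by apply: expR_gt1Dx; rewrite mulf_neq0// subr_eq0 gt_eqF.
have h2 : 1 + - ln t < expR (- ln t) by apply: expR_gt1Dx; rewrite oppr_eq0.
have E1 : t `^ p = t * expR ((p - 1) * ln t).
  by rewrite /powR gt_eqF// -{2}(lnK t0) -expRD; congr expR; ring.
have E2 : t * expR (- ln t) = 1 by rewrite expRN lnK// mulfV// gt_eqF.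
have pm0 : 0 < p - 1 by lra.
have h3 : (p - 1) * (1 - ln t) < (p - 1) * expR (- ln t) by rewrite ltr_pM2l.
have h4 : p < expR ((p - 1) * ln t) + (p - 1) * expR (- ln t) by lra.
have : t * p < t * (expR ((p - 1) * ln t) + (p - 1) * expR (- ln t)) by rewrite ltr_pM2l.
rewrite mulrDr -E1 mulrCA E2; lra.
Qed.

(** Bernoulli's inequality after scaling by [m]; the degenerate tangent at [m
    = 0] is covered by [0^(p-1) = 0]. *)
Lemma powR_tangent p m t : 1 < p -> 0 <= m -> 0 <= t ->
  m `^ p + p * m `^ (p - 1) * (t - m) <= t `^ p ?= iff (t == m).
Proof.
move=> p1 m0 t0; apply/leifP; have [->|tm] := eqVneq t m.
  by rewrite subrr mulr0 addr0.
have [m00|m00] := eqVneq m 0.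
  rewrite m00 in tm *; have t00 : 0 < t by rewrite lt_neqAle eq_sym tm.
  by rewrite !powR0 ?gt_eqF//; [rewrite mulr0 mul0r addr0 powR_gt0|lra|lra].
have {m00}m0 : 0 < m by rewrite lt_neqAle eq_sym m00.
have tm1 : t / m != 1 by apply: contra tm => /eqP h; rewrite -(divfK (lt0r_neq0 m0) t) h mul1r.
have h := bernoulli_powR p1 (divr_ge0 t0 (ltW m0)) tm1.
have E : t `^ p = (t / m) `^ p * m `^ p.
  by rewrite -powRM ?divr_ge0 ?(ltW m0)// divfK ?gt_eqF.
have E2 : m `^ p = m `^ (p - 1) * m.
  rewrite -{3}(powRr1 (ltW m0)) -powRD; first by congr (_ `^ _); ring.
  by rewrite (gt_eqF m0) implybT.
have mp0 : 0 < m `^ p by rewrite powR_gt0.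
rewrite E; apply: (@le_lt_trans _ _ ((1 + p * (t / m - 1)) * m `^ p)); last by rewrite ltr_pM2r.
rewrite le_eqVlt; apply/orP; left; apply/eqP; rewrite E2.
by field; rewrite gt_eqF.
Qed.

(** The tangent at [m = |theta x + (1 - theta) y|] lies below the power at
    [|x|] and at [y]. Equality puts both on the tangent point, and the
    absolute value then excludes opposite signs. *)
Lemma powR_strictly_convex p theta x y : 1 < p -> 0 < theta < 1 -> 0 <= y ->
  `|theta * x + (1 - theta) * y| `^ p <= theta * `|x| `^ p + (1 - theta) * y `^ p /\
  (`|theta * x + (1 - theta) * y| `^ p = theta * `|x| `^ p + (1 - theta) * y `^ p -> x = y).
Proof.
move=> p1 /andP[h0 h1] y0; have h10 : 0 < 1 - theta by lra.
set m := `|_ + _|.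
have mle : m <= theta * `|x| + (1 - theta) * y.
  apply: (le_trans (ler_normD _ _)); rewrite !normrM (gtr0_norm h0) (gtr0_norm h10).
  by rewrite (ger0_norm y0).
have m0 : 0 <= m by exact: normr_ge0.
have [t1 e1] := powR_tangent p1 m0 (normr_ge0 x).
have [t2 e2] := powR_tangent p1 m0 y0.
set q := p * m `^ (p - 1) in t1 t2 e1 e2.
have q0 : 0 <= q by rewrite mulr_ge0 ?powR_ge0//; lra.
have T1 : theta * (m `^ p + q * (`|x| - m)) <= theta * `|x| `^ p by rewrite ler_pM2l.
have T2 : (1 - theta) * (m `^ p + q * (y - m)) <= (1 - theta) * y `^ p by rewrite ler_pM2l.
have T3 : 0 <= q * (theta * `|x| + (1 - theta) * y - m) by rewrite mulr_ge0// subr_ge0.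
have S : theta * (m `^ p + q * (`|x| - m)) + (1 - theta) * (m `^ p + q * (y - m)) =
  m `^ p + q * (theta * `|x| + (1 - theta) * y - m) by ring.
split; first lra.
move=> E.
have E1 : theta * (m `^ p + q * (`|x| - m)) = theta * `|x| `^ p by lra.
have E2 : (1 - theta) * (m `^ p + q * (y - m)) = (1 - theta) * y `^ p by lra.
have /eqP xm : `|x| == m by rewrite -e1; apply/eqP; exact: (mulfI (lt0r_neq0 h0)).
have /eqP ym : y == m by rewrite -e2; apply/eqP; exact: (mulfI (lt0r_neq0 h10)).
have [x0|x0] := leP 0 x; first by rewrite -(ger0_norm x0) xm ym.
have xy : x = - y by rewrite ym -xm ltr0_norm// opprK.
have : m = `|1 - 2 * theta| * y.
  transitivity `|(1 - 2 * theta) * y|; last by rewrite normrM (ger0_norm y0).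
  by rewrite /m xy; congr `|_|; ring.
rewrite -ym => yE; have : `|1 - 2 * theta| < 1 by rewrite ltr_norml; apply/andP; split; lra.
move=> lt1; have : y = 0.
  have [//|y00] := eqVneq y 0.
  have yp : 0 < y by rewrite lt_neqAle eq_sym y00.
  by move: lt1; rewrite -(ltr_pM2r yp) -yE mul1r ltxx.
by move=> y00; rewrite xy y00 oppr0.
Qed.

Definition pmean p a b : R := ((`|a| `^ p + `|b| `^ p) / 2) `^ p^-1.

Lemma pmean_ge0 p a b : 0 <= pmean p a b. Proof. exact: powR_ge0. Qed.

Lemma pmean_powR p a b : 0 < p -> pmean p a b `^ p = (`|a| `^ p + `|b| `^ p) / 2.
Proof.
move=> p0; rewrite /pmean powRVK ?gt_eqF//.
Qed.

Lemma pmean_eq0 p a b : 0 < p -> pmean p a b = 0 -> a = 0 /\ b = 0.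
Proof.
move=> p0 h; have := pmean_powR a b p0; rewrite h powR0 ?gt_eqF// => /esym/eqP.
rewrite mulf_eq0 invr_eq0 pnatr_eq0 orbF paddr_eq0 ?powR_ge0//.
by rewrite !powR_eq0 !normr_eq0 => /andP[/andP[/eqP -> _] /andP[/eqP -> _]].
Qed.

Lemma pmean00 p : 0 < p -> pmean p 0 0 = 0.
Proof. by move=> p0; rewrite /pmean normr0 powR0 ?gt_eqF// addr0 mul0r powR0// invr_eq0 gt_eqF. Qed.

(** The reverse triangle inequality for the norm of exponent p on pairs. For
    [P > Q > 0] one writes [a / P] as the convex combination, with weight
    [theta = (P - Q) / P], of [(a - c) / (P - Q)] and [c / Q]; adding the
    convexity inequalities for both entries gives the claim, and equality
    gives [a Q = c P] and [b Q = d P]. *)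
Lemma pmean_diff p a b c d : 1 < p -> 0 <= a -> 0 <= b -> 0 <= c -> 0 <= d ->
  `|pmean p a b - pmean p c d| `^ p <= (`|a - c| `^ p + `|b - d| `^ p) / 2 /\
  (`|pmean p a b - pmean p c d| `^ p = (`|a - c| `^ p + `|b - d| `^ p) / 2 ->
   a * d = b * c).
Proof.
move=> p1; have p0 : 0 < p by lra.
wlog PQ : a b c d / pmean p c d <= pmean p a b.
  move=> h a0 b0 c0 d0; case/orP: (le_total (pmean p c d) (pmean p a b)) => PQ; first exact: h.
  have [h1 h2] := h c d a b PQ c0 d0 a0 b0.
  rewrite distrC (distrC a) (distrC b); split => // E.
  by have := h2 E; rewrite [c * b]mulrC [d * a]mulrC => ->.
move=> a0 b0 c0 d0; set P := pmean p a b in PQ *; set Q := pmean p c d in PQ *.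
have Pp : P `^ p = (a `^ p + b `^ p) / 2 by rewrite pmean_powR// (ger0_norm a0) (ger0_norm b0).
have Qp : Q `^ p = (c `^ p + d `^ p) / 2 by rewrite pmean_powR// (ger0_norm c0) (ger0_norm d0).
have Pge : 0 <= P by exact: pmean_ge0.
have Qge : 0 <= Q by exact: pmean_ge0.
have Qz : Q = 0 -> c = 0 /\ d = 0 by exact: pmean_eq0.
clearbody P Q.
have s0 : 0 <= (`|a - c| `^ p + `|b - d| `^ p) / 2.
  by rewrite divr_ge0// addr_ge0 ?powR_ge0.
have [PQe|PQn] := eqVneq P Q.
  rewrite PQe subrr normr0 powR0 ?gt_eqF//; split => // /esym/eqP.
  rewrite mulf_eq0 invr_eq0 pnatr_eq0 orbF paddr_eq0 ?powR_ge0//.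
  rewrite !powR_eq0 !normr_eq0 => /andP[/andP[/eqP ac _] /andP[/eqP bd _]].
  by rewrite (subr0_eq ac) (subr0_eq bd) mulrC.
have PQlt : 0 < P - Q by rewrite subr_gt0 lt_neqAle eq_sym PQn.
have [Q00|Q00] := eqVneq Q 0.
  have [c00 d00] := Qz Q00; rewrite c00 d00 !subr0 Q00 subr0.
  by rewrite (ger0_norm Pge) (ger0_norm a0) (ger0_norm b0) Pp !mulr0.
have Q0 : 0 < Q by rewrite lt_neqAle eq_sym Q00.
have P0 : 0 < P by exact: lt_le_trans PQ.
pose theta := (P - Q) / P.
have th1 : 1 - theta = Q / P by rewrite /theta; field; rewrite gt_eqF.
have th : 0 < theta < 1.
  rewrite divr_gt0//=; have : 0 < 1 - theta by rewrite th1 divr_gt0.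
  by rewrite subr_gt0.
have dec t t' : t / P = theta * ((t - t') / (P - Q)) + (1 - theta) * (t' / Q).
  by rewrite th1 /theta; field; rewrite !gt_eqF.
have [ca ea] := powR_strictly_convex ((a - c) / (P - Q)) p1 th (divr_ge0 c0 (ltW Q0)).
have [cb eb] := powR_strictly_convex ((b - d) / (P - Q)) p1 th (divr_ge0 d0 (ltW Q0)).
have pw t r : 0 < r -> `|t / r| `^ p = `|t| `^ p / r `^ p.
  move=> r0; rewrite normrM normfV (gtr0_norm r0) powRM ?invr_ge0 ?(ltW r0)//.
  by rewrite -(powR_inv1 (ltW r0)) -powRrM mulN1r powRN.
have pw0 t r : 0 <= t -> 0 < r -> (t / r) `^ p = t `^ p / r `^ p.
  by move=> t0 r0; have := pw t r r0; rewrite (ger0_norm t0) ger0_norm ?divr_ge0 ?(ltW r0).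
rewrite -dec pw// pw// pw0// in ca ea; rewrite -dec pw// pw// pw0// in cb eb.
rewrite (ger0_norm a0) in ca ea; rewrite (ger0_norm b0) in cb eb.
rewrite (gtr0_norm PQlt).
have Pp0 : 0 < P `^ p by rewrite powR_gt0.
have Qp0 : 0 < Q `^ p by rewrite powR_gt0.
have D0 : 0 < (P - Q) `^ p by rewrite powR_gt0.
set A := `|a - c| `^ p in ca ea s0 *; set B := `|b - d| `^ p in cb eb s0 *.
set D := (P - Q) `^ p in ca ea cb eb D0 *.
have SP : a `^ p / P `^ p + b `^ p / P `^ p = 2.
  by rewrite -mulrDl; apply/(canLR (mulfK (lt0r_neq0 Pp0))); rewrite Pp; field.
have SQ : c `^ p / Q `^ p + d `^ p / Q `^ p = 2.
  by rewrite -mulrDl; apply/(canLR (mulfK (lt0r_neq0 Qp0))); rewrite Qp; field.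
have /andP[th0 _] := th.
have AB : theta * (A / D) + theta * (B / D) = theta * ((A + B) / D) by rewrite -mulrDr -mulrDl.
have CD : (1 - theta) * (c `^ p / Q `^ p) + (1 - theta) * (d `^ p / Q `^ p) = (1 - theta) * 2.
  by rewrite -mulrDr SQ.
split.
  have : theta * 2 <= theta * ((A + B) / D) by lra.
  rewrite ler_pM2l// ler_pdivlMr// => h; lra.
move=> E; have ABD : theta * ((A + B) / D) = theta * 2.
  have ABE : A + B = 2 * D by lra.
  by rewrite ABE mulfK ?gt_eqF.
have Ea : a `^ p / P `^ p = theta * (A / D) + (1 - theta) * (c `^ p / Q `^ p) by lra.
have Eb : b `^ p / P `^ p = theta * (B / D) + (1 - theta) * (d `^ p / Q `^ p) by lra.
have {}ea := ea Ea; have {}eb := eb Eb.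
have aQ : (a - c) * Q = c * (P - Q).
  by move/eqP : ea; rewrite (eqr_div _ _ (lt0r_neq0 PQlt) (lt0r_neq0 Q0)) => /eqP.
have bQ : (b - d) * Q = d * (P - Q).
  by move/eqP : eb; rewrite (eqr_div _ _ (lt0r_neq0 PQlt) (lt0r_neq0 Q0)) => /eqP.
apply: (mulfI (lt0r_neq0 Q0)).
have aQ' : a * Q = c * P by lra.
have bQ' : b * Q = d * P by lra.
by rewrite mulrA [Q * a]mulrC aQ' mulrA [Q * b]mulrC bQ'; ring.
Qed.

Lemma pmean_diff_le p a b c d : 1 < p ->
  `|pmean p a b - pmean p c d| `^ p <= (`|a - c| `^ p + `|b - d| `^ p) / 2.
Proof.
move=> p1; have N x y : pmean p x y = pmean p `|x| `|y| by rewrite /pmean !normr_id.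
have [h _] := pmean_diff p1 (normr_ge0 a) (normr_ge0 b) (normr_ge0 c) (normr_ge0 d).
rewrite (N a) (N c); apply: (le_trans h); rewrite ler_pM2r ?invr_gt0//.
by apply: lerD; apply: ge0_ler_powR; rewrite ?nnegrE ?ler_dist_dist//; lra.
Qed.

End hidden_convexity.

(** * Uniqueness of the first eigenfunction *)

Section uniqueness.
Context {R : realType} {N : nat}.
Local Notation V := 'rV[R]_N.
Local Notation mu := (lebesgue_rV R N).
Local Notation mm := (mu \x mu)%E.
Implicit Types (u v w : V -> R) (Omega K : set V).

(** The distance to the complement is continuous and positive on the compact
    set. *)
Lemma compact_in_open Omega K : (0 < N)%N -> open Omega -> bounded_set Omega ->
  compact K -> K `<=` Omega ->
  exists2 delta : R, 0 < delta & forall x y, K y -> `|x - y| < delta -> Omega x.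
Proof.
move=> N0 oO bO cK KO; have Ox := exists_not_bounded N0 bO.
have dc : continuous (dist_compl Omega).
  apply: (lipschitz_bound_continuous (L := 1)) => x y; rewrite mul1r.
  exact: dist_compl_lipN.
have cdK : compact (dist_compl Omega @` K).
  by apply: continuous_compact => //; exact: continuous_subspaceT.
have /closed_openC oC := compact_closed (@Rhausdorff R) cdK.
have h0 : (~` (dist_compl Omega @` K)) 0.
  by move=> [y Ky y0]; have := dist_compl_gt0 Ox oO (KO y Ky); rewrite y0 ltxx.
have := open_nbhs_nbhs (conj oC h0); move=> /nbhs_ballP[r /= r0 hr].
exists r => // x y Ky xy; apply: contrapT => /(dist_compl_out Ox) dx.
have := dist_compl_lip Ox y x; rewrite dx add0r distrC => dy.
have : ball (0 : R) r (dist_compl Omega y).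
  by rewrite -ball_normE /= sub0r normrN ger0_norm ?dist_compl_ge0// (le_lt_trans dy).
by move=> /hr; apply; exists y.
Qed.

Lemma measurable_pmean p u v : 0 < p -> measurable_fun setT u -> measurable_fun setT v ->
  measurable_fun setT (fun x => pmean p (u x) (v x)).
Proof.
move=> p0 mu0 mv.
have E : (fun x => pmean p (u x) (v x)) =
    (fun x => `|(`|u x| `^ p + `|v x| `^ p) / 2| `^ p^-1).
  by apply/funext => x; rewrite /pmean [in RHS]ger0_norm// divr_ge0// addr_ge0 ?powR_ge0.
rewrite E; apply: measurable_norm_powR; apply: measurable_funM => //.
by apply: measurable_funD; exact: measurable_norm_powR.
Qed.

Lemma gkern_pmean_le sigma p u v z : 1 < p ->
  gkern sigma p (fun x => pmean p (u x) (v x)) z <=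
    2^-1 * (gkern sigma p u z + gkern sigma p v z).
Proof.
move=> p1; rewrite /gkern -mulrDl mulrA; apply: ler_wpM2r.
  by rewrite invr_ge0 powR_ge0.
by rewrite mulrC; exact: pmean_diff_le.
Qed.

Lemma power_int_pmean p u v : 0 < p -> measurable_fun setT u -> measurable_fun setT v ->
  power_int p (fun x => pmean p (u x) (v x)) =
    ((2^-1)%:E * (power_int p u + power_int p v))%E.
Proof.
move=> p0 mu0 mv.
have mp w : measurable_fun setT w -> measurable_fun setT (fun x => `|w x| `^ p).
  exact: measurable_norm_powR.
have g0 w x : 0 <= `|w x| `^ p by exact: powR_ge0.
rewrite /power_int -(intD mu (g0 u) (g0 v) (mp _ mu0) (mp _ mv)).
have h0 : 0 <= (2^-1 : R) by rewrite invr_ge0.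
rewrite -(intZ mu h0 (fun x => addr_ge0 (g0 u x) (g0 v x)) (measurable_funD (mp _ mu0) (mp _ mv))).
apply: eq_integral => x _; congr EFin.
by rewrite ger0_norm ?pmean_ge0// pmean_powR// mulrC.
Qed.

Lemma energy_pmean_lty sigma p u v : 1 < p -> measurable_fun setT u -> measurable_fun setT v ->
  (gagliardo_energy sigma p u < +oo)%E -> (gagliardo_energy sigma p v < +oo)%E ->
  (gagliardo_energy sigma p (fun x => pmean p (u x) (v x)) < +oo)%E.
Proof.
move=> p1 mu0 mv fu fv; have p0 : 0 < p by lra.
have mgu := measurable_gkern sigma p mu0; have mgv := measurable_gkern sigma p mv.
have mD := measurable_funD mgu mgv.
have h0 : 0 <= (2^-1 : R) by rewrite invr_ge0.
apply: (le_lt_trans (energy_le_of_gkern (measurable_pmean p0 mu0 mv)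
  (measurable_funM (measurable_cst (2^-1 : R)) mD) (fun z => gkern_pmean_le sigma u v z p1))).
rewrite (intZ mm h0 (fun z => addr_ge0 (gkern_ge0 _ _ _ z) (gkern_ge0 _ _ _ z)) mD).
rewrite (intD mm (gkern_ge0 _ _ _) (gkern_ge0 _ _ _) mgu mgv) -!gagliardo_energyE//.
by apply: lte_mul_pinfty => //; exact: (lte_add_pinfty fu fv).
Qed.

(** The Poincare inequality turns convergence in energy into convergence in
    L^p, hence almost everywhere along a subsequence. *)
Lemma W0_ae_approx sigma p Omega u : (0 < N)%N -> 0 < p -> 0 < sigma -> bounded_set Omega ->
  W0 sigma p Omega u -> exists phi : nat -> V -> R,
  [/\ forall n, smooth_compact Omega (phi n),
      gagliardo_energy sigma p (phi n \- u)%R @[n --> \oo] --> 0%E,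
      forall n, (gagliardo_energy sigma p (phi n \- u)%R < +oo)%E,
      forall n, (power_int p (phi n \- u)%R < +oo)%E &
      {ae mu, forall x, phi n x @[n --> \oo] --> u x}].
Proof.
move=> N0 p0 s0 bO Wu; have [mu0 uO h] := (W0P sigma Omega u p0).1 Wu.
have e0 n : 0 < n.+1%:R^-1 :> R by rewrite invr_gt0.
have [phi hphi] := choice (fun n => h _ (e0 n)).
have sphi n : smooth_compact Omega (phi n) by have [] := hphi n.
have mphi n : measurable_fun setT (phi n) := smooth_compact_measurable (sphi n).
have mB n : measurable_fun setT (phi n \- u)%R by exact: measurable_funB.
have hE n : (gagliardo_energy sigma p (phi n \- u)%R < n.+1%:R^-1%:E)%E by have [] := hphi n.
have fE n : (gagliardo_energy sigma p (phi n \- u)%R < +oo)%E := lt_trans (hE n) (ltry _).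
have [C [C0 hC]] := poincare N0 p0 s0 bO.
have BO n : {ae mu, forall x, ~ Omega x -> (phi n \- u)%R x = 0}.
  by apply: filterS uO => x ux Ox /=; rewrite ux// (smooth_compact_out (sphi n))// subr0.
have hP n : (power_int p (phi n \- u)%R <= C%:E * gagliardo_energy sigma p (phi n \- u)%R)%E.
  exact: hC.
have C0E : (0 <= C%:E)%E by rewrite lee_fin.
have fP n : (power_int p (phi n \- u)%R < +oo)%E.
  apply: (le_lt_trans (hP n)); exact: (lte_mul_pinfty C0E _ (fE n)).
have cE : gagliardo_energy sigma p (phi n \- u)%R @[n --> \oo] --> 0%E.
  apply/ge0_cvge0P => [n|e e1]; first exact: gagliardo_energy_ge0.
  have /cvgrPdist_lt/(_ _ e1) := @cvg_harmonic R; apply: filterS => n.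
  rewrite sub0r normrN ger0_norm ?(ltW (e0 n))// => he.
  by apply: (lt_trans (hE n)); rewrite lte_fin.
have cP : power_int p (phi n \- u)%R @[n --> \oo] --> 0%E.
  apply/ge0_cvge0P => [n|e e1]; first exact: power_int_ge0.
  have C1 : 0 < C + 1 by rewrite ltr_wpDl.
  have /ge0_cvge0P/(_ _ (divr_gt0 e1 C1)) h1 := cE.
  have := h1 (fun n => gagliardo_energy_ge0 _ _ _); apply: filterS => n.
  have [r [r0 rE]] := ge0_lty_EFin (gagliardo_energy_ge0 sigma p (phi n \- u)%R) (fE n).
  have := hP n; rewrite rE => hr hr2; apply: (le_lt_trans hr).
  move: hr2; rewrite -EFinM !lte_fin ltr_pdivlMr// => hr2.
  by apply: le_lt_trans hr2; rewrite mulrC ler_wpM2l// lerDl.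
have [f [hf fc]] := cvg0_int_subseq_ae (fun n => measurable_norm_powR p (mB n))
  (fun n x => powR_ge0 _ _) cP.
exists (fun n => phi (f n)); split.
- by move=> n; exact: sphi.
- exact: (cvge_subseq hf cE).
- by move=> n; exact: fE.
- by move=> n; exact: fP.
apply: filterS fc => x /= hx; apply/subr_cvg0.
by apply: (cvg_norm_powR0 _ p0); exact: hx.
Qed.

Lemma cvg_pmean p (a b : nat -> R) (x y : R) : 0 < p -> a @ \oo --> x -> b @ \oo --> y ->
  pmean p (a n) (b n) @[n --> \oo] --> pmean p x y.
Proof.
move=> p0 ax bY.
have E a' b' : pmean p a' b' = `|(`|a'| `^ p + `|b'| `^ p) / 2| `^ p^-1.
  by rewrite /pmean [in RHS]ger0_norm// divr_ge0// addr_ge0 ?powR_ge0.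
under eq_fun do rewrite E.
rewrite E; apply: cvg_norm_powR; first by rewrite invr_gt0.
by apply: cvgMl; apply: cvgD; apply: cvg_norm_powR.
Qed.

Section pmean_W0.
Context (p s : R) (Omega : set V) (u v : V -> R).
Context (N0 : (0 < N)%N) (p1 : 1 < p) (s01 : 0 < s < 1)
  (oO : open Omega) (bO : bounded_set Omega)
  (Wu : W0 s p Omega u) (Wv : W0 s p Omega v)
  (fu : (gagliardo_energy s p u < +oo)%E) (fv : (gagliardo_energy s p v < +oo)%E)
  (pu : (power_int p u < +oo)%E) (pv : (power_int p v < +oo)%E).

Let p0 : 0 < p. Proof. exact: lt_trans p1. Qed.
Let s0 : 0 < s. Proof. by case/andP: s01. Qed.
Let mu0 : measurable_fun setT u. Proof. by case: Wu. Qed.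
Let mv0 : measurable_fun setT v. Proof. by case: Wv. Qed.

Lemma finite_of_diff (F : (V -> R) -> \bar R) (phi w : V -> R) :
  (forall a b : V -> R, measurable_fun setT a -> measurable_fun setT b ->
    (F (a \+ b)%R <= (2 `^ p)%:E * (F a + F b))%E) ->
  measurable_fun setT phi -> measurable_fun setT w ->
  (F (phi \- w)%R < +oo)%E -> (F w < +oo)%E -> (F phi < +oo)%E.
Proof.
move=> FD mphi mw h1 h2.
have E : phi = ((phi \- w) \+ w)%R by apply/funext => x /=; rewrite subrK.
rewrite {}E; have mB : measurable_fun setT (phi \- w)%R by exact: measurable_funB.
apply: (le_lt_trans (FD _ _ mB mw)).
by apply: lte_mul_pinfty; [rewrite lee_fin powR_ge0|by []|exact: lte_add_pinfty].
Qed.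

Lemma pmean_compact_W0 (phi psi : V -> R) : smooth_compact Omega phi -> smooth_compact Omega psi ->
  (gagliardo_energy s p phi < +oo)%E -> (gagliardo_energy s p psi < +oo)%E ->
  (power_int p phi < +oo)%E -> (power_int p psi < +oo)%E ->
  W0 s p Omega (fun x => pmean p (phi x) (psi x)).
Proof.
move=> sphi spsi f1 f2 f3 f4.
have mphi := smooth_compact_measurable sphi; have mpsi := smooth_compact_measurable spsi.
have [_ c1 o1] := sphi; have [_ c2 o2] := spsi.
pose K := support_fun phi `|` support_fun psi.
have cK : compact K by exact: compactU.
have KO : K `<=` Omega by move=> x [/o1|/o2].
have [delta d0 hd] := compact_in_open N0 oO bO cK KO.
have bK : bounded_set K.
  by have [M [Mr MO]] := bO; exists M; split => // a aM x /KO Ox; exact: (MO a aM).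
have h0 : (0 <= (2^-1 : R)%:E)%E by rewrite lee_fin invr_ge0.
apply: (W0_of_compact p1 s0 d0 bK hd (measurable_pmean p0 mphi mpsi)).
- move=> x Kx; have [-> ->] : phi x = 0 /\ psi x = 0.
    by split; apply/eqP; apply: contraT => h; exfalso; apply: Kx; [left|right]; exact: subset_closure.
  exact: pmean00.
- rewrite (power_int_pmean p0 mphi mpsi).
  by apply: (lte_mul_pinfty h0) => //; exact: (lte_add_pinfty f3 f4).
- exact: (energy_pmean_lty p1 mphi mpsi f1 f2).
Qed.

(** The means of the approximations have compact support, so lie in [W0].
    Their energy distance to the mean of the limits tends to 0 by
    [pratt_cvg0]: the integrand is dominated by that of the errors, whose
    integral tends to 0, plus a fixed integrable function. *)
Lemma pmean_W0 : W0 s p Omega (fun x => pmean p (u x) (v x)).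
Proof.
have [phi [sphi phiE phif phip phic]] := W0_ae_approx N0 p0 s0 bO Wu.
have [psi [spsi psiE psif psip psic]] := W0_ae_approx N0 p0 s0 bO Wv.
have mphi n := smooth_compact_measurable (sphi n).
have mpsi n := smooth_compact_measurable (spsi n).
pose G x := pmean p (u x) (v x).
pose Gn n x := pmean p (phi n x) (psi n x).
have mG : measurable_fun setT G := measurable_pmean p0 mu0 mv0.
have mGn n : measurable_fun setT (Gn n) := measurable_pmean p0 (mphi n) (mpsi n).
have mGB n : measurable_fun setT (Gn n \- G)%R := measurable_funB (mGn n) mG.
have mB1 n : measurable_fun setT (phi n \- u)%R by exact: measurable_funB.
have mB2 n : measurable_fun setT (psi n \- v)%R by exact: measurable_funB.
have ED (a b : V -> R) : measurable_fun setT a -> measurable_fun setT b ->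
    (gagliardo_energy s p (a \+ b)%R <= (2 `^ p)%:E * (gagliardo_energy s p a + gagliardo_energy s p b))%E.
  by move=> ma mb; exact: (gagliardo_energyD_le s (ltW p0) ma mb).
have PD (a b : V -> R) : measurable_fun setT a -> measurable_fun setT b ->
    (power_int p (a \+ b)%R <= (2 `^ p)%:E * (power_int p a + power_int p b))%E.
  by move=> ma mb; exact: (power_intD_le (ltW p0) ma mb).
have WGn n : W0 s p Omega (Gn n).
  exact: (pmean_compact_W0 (sphi n) (spsi n)
    (finite_of_diff ED (mphi n) mu0 (phif n) fu) (finite_of_diff ED (mpsi n) mv0 (psif n) fv)
    (finite_of_diff PD (mphi n) mu0 (phip n) pu) (finite_of_diff PD (mpsi n) mv0 (psip n) pv)).
have fG : (gagliardo_energy s p G < +oo)%E := energy_pmean_lty p1 mu0 mv0 fu fv.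
have q0 : 0 <= 2 `^ p :> R by exact: powR_ge0.
have mk w : measurable_fun setT w -> measurable_fun setT (gkern s p w) by exact: measurable_gkern.
have k0 w z : 0 <= gkern s p w z by exact: gkern_ge0.
pose C : R := 2 `^ p * 2 `^ p.
have C0 : 0 <= C by exact: mulr_ge0.
pose D n z := gkern s p (phi n \- u) z + gkern s p (psi n \- v) z.
pose H z := C * (gkern s p u z + gkern s p v z) + 2 `^ p * gkern s p G z.
have D0 n z : 0 <= D n z by exact: addr_ge0.
have mD n : measurable_fun setT (D n) by apply: measurable_funD; exact: mk.
have H0 z : 0 <= H z by rewrite addr_ge0// mulr_ge0// addr_ge0.
have mH : measurable_fun setT H.
  by apply: measurable_funD; apply: measurable_funM => //; [apply: measurable_funD; exact: mk|exact: mk].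
have IH : (\int[mm]_z (H z)%:E < +oo)%E.
  rewrite /H (intD mm (fun z => mulr_ge0 C0 (addr_ge0 (k0 u z) (k0 v z))) (fun z => mulr_ge0 q0 (k0 G z))).
  - rewrite (intZ mm C0 (fun z => addr_ge0 (k0 u z) (k0 v z)) (measurable_funD (mk _ mu0) (mk _ mv0))).
    rewrite (intZ mm q0 (k0 G) (mk _ mG)) (intD mm (k0 u) (k0 v) (mk _ mu0) (mk _ mv0)).
    rewrite -(gagliardo_energyE s p mu0) -(gagliardo_energyE s p mv0) -(gagliardo_energyE s p mG).
    have hC : (0 <= C%:E)%E by rewrite lee_fin.
    have hq : (0 <= (2 `^ p)%:E)%E by rewrite lee_fin.
    have hCf : C%:E \is a fin_num by [].
    have hqf : (2 `^ p)%:E \is a fin_num by [].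
    have i1 := lte_mul_pinfty hC hCf (lte_add_pinfty fu fv).
    have i2 := lte_mul_pinfty hq hqf fG.
    exact: (lte_add_pinfty i1 i2).
  - by apply: measurable_funM => //; apply: measurable_funD; exact: mk.
  - by apply: measurable_funM => //; exact: mk.
have [h [h0 hE]] := ge0_lty_EFin (int_ge0 mm H0) IH.
have ID n : (\int[mm]_z (D n z)%:E = gagliardo_energy s p (phi n \- u)%R + gagliardo_energy s p (psi n \- v)%R)%E.
  rewrite (gagliardo_energyE s p (mB1 n)) (gagliardo_energyE s p (mB2 n)).
  exact: (intD mm (k0 _) (k0 _) (mk _ (mB1 n)) (mk _ (mB2 n))).
have cD : (\int[mm]_z (D n z)%:E)%E @[n --> \oo] --> 0%E.
  under eq_fun do rewrite ID.
  have hd : ((0 : \bar R) +? 0)%E by [].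
  have h1 : (gagliardo_energy s p (phi n \- u)%R + gagliardo_energy s p (psi n \- v)%R)%E @[n --> \oo]
      --> (0 + 0)%E by exact: (cvgeD hd phiE psiE).
  by move: h1; rewrite add0e.
have cGE : gagliardo_energy s p (Gn n \- G)%R @[n --> \oo] --> 0%E.
  under eq_fun do rewrite (gagliardo_energyE s p (mGB _)).
  apply: (pratt_cvg0 (G := fun n z => C * D n z + H z) (g := H)) => //.
  - by move=> n; exact: mk.
  - by move=> n; apply: measurable_funD => //; exact: measurable_funM.
  - move=> n z; rewrite k0/=.
    apply: (le_trans (gkernB_le s (Gn n) G z (ltW p0))).
    have g1 := gkern_pmean_le s (phi n) (psi n) z p1.
    have split1 (a b : V -> R) : gkern s p a z <= 2 `^ p * (gkern s p (a \- b) z + gkern s p b z).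
      have {1}-> : a = ((a \- b) \+ b)%R by apply/funext => x /=; rewrite subrK.
      exact: (gkernD_le s _ _ z (ltW p0)).
    have g2 := split1 (phi n) u; have g3 := split1 (psi n) v.
    have g4 : gkern s p (Gn n) z <= gkern s p (phi n) z + gkern s p (psi n) z.
      apply: (le_trans g1); have := addr_ge0 (k0 (phi n) z) (k0 (psi n) z).
      by move: (_ + _) => t t0; lra.
    have g5 : gkern s p (Gn n) z <= 2 `^ p * (gkern s p (phi n \- u) z + gkern s p u z) +
        2 `^ p * (gkern s p (psi n \- v) z + gkern s p v z).
      by apply: (le_trans g4); exact: lerD.
    have -> : C * D n z + H z = 2 `^ p * ((2 `^ p * (gkern s p (phi n \- u) z + gkern s p u z) +
        2 `^ p * (gkern s p (psi n \- v) z + gkern s p v z)) + gkern s p G z).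
      by rewrite /D /H /C; ring.
    by rewrite ler_wpM2l// lerD2r.
  - have ac : {ae mu, forall x, (Gn n \- G)%R x @[n --> \oo] --> (fun=> 0) x}.
      apply: filterS2 phic psic => x h1 h2 /=; rewrite -(subrr (G x)).
      apply: cvgB; last exact: cvg_cst.
      exact: cvg_pmean.
    apply: filterS (ae_gkern_cvg p0 (cvg_cst s) ac) => z.
    by rewrite [X in _ --> X]/gkern subrr normr0 powR0 ?mul0r// gt_eqF.
  - have zero (w : nat -> V -> R) (w0 : V -> R) : {ae mu, forall x, w n x @[n --> \oo] --> w0 x} ->
       {ae mm, forall z, gkern s p (w n \- w0)%R z @[n --> \oo] --> 0}.
      move=> hw; have ac : {ae mu, forall x, (w n \- w0)%R x @[n --> \oo] --> (fun=> 0) x}.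
        by apply: filterS hw => x hx /=; rewrite -(subrr (w0 x)); apply: cvgB => //; exact: cvg_cst.
      apply: filterS (ae_gkern_cvg p0 (cvg_cst s) ac) => z.
      by rewrite [X in _ --> X]/gkern subrr normr0 powR0 ?mul0r// gt_eqF.
    apply: filterS2 (zero _ _ phic) (zero _ _ psic) => z h1 h2.
    rewrite -[X in _ --> X]add0r; apply: cvgD; last exact: cvg_cst.
    rewrite -[X in _ --> X](mulr0 C) -[X in C * X](addr0 0).
    by apply: cvgMr; exact: cvgD.
  - have CD0 n z : 0 <= C * D n z by exact: mulr_ge0.
    have mCD n : measurable_fun setT (fun z => C * D n z) by exact: measurable_funM.
    have E n : (\int[mm]_z (C * D n z + H z)%:E = C%:E * \int[mm]_z (D n z)%:E + \int[mm]_z (H z)%:E)%E.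
      by rewrite (intD mm (CD0 n) H0 (mCD n) mH) (intZ mm C0 (D0 n) (mD n)).
    under eq_fun do rewrite E.
    have hC : C%:E \is a fin_num by [].
    have hd : ((0 : \bar R) +? h%:E)%E by [].
    have c1 : (C%:E * \int[mm]_z (D n z)%:E)%E @[n --> \oo] --> 0%E.
      have h1 : (C%:E * \int[mm]_z (D n z)%:E)%E @[n --> \oo] --> (C%:E * 0)%E by exact: (cvgeZl hC cD).
      by move: h1; rewrite mule0.
    have h1 : (C%:E * \int[mm]_z (D n z)%:E + h%:E)%E @[n --> \oo] --> (0 + h%:E)%E.
      by exact: (cvgeD hd c1 (cvg_cst h%:E)).
    by move: h1; rewrite add0e hE.
apply: (W0_closed p0 mG) => [|e e0].
  have [_ uO _] := Wu; have [_ vO _] := Wv.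
  apply: filterS2 uO vO => x h1 h2 Ox; rewrite /G h1// h2//; exact: pmean00.
have /ge0_cvge0P/(_ _ e0) h1 := cGE.
have [n _ hn] := h1 (fun n => gagliardo_energy_ge0 _ _ _).
exists (Gn n); first exact: WGn.
exact: (hn n (leqnn n)).
Qed.

End pmean_W0.

(** Tonelli's theorem for null functions. *)
Lemma ae_ae_of_prod (f : V * V -> R) : measurable_fun setT f -> (forall z, 0 <= f z) ->
  {ae mm, forall z, f z = 0} -> {ae mu, forall x, (\int[mu]_y (f (x, y))%:E = 0)%E}.
Proof.
move=> mf f0 fz; have mfE : measurable_fun setT (fun z => (f z)%:E) by exact/measurable_EFinP.
have f0E z : (0 <= (f z)%:E)%E by rewrite lee_fin.
have If : (\int[mm]_z (f z)%:E = 0)%E.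
  transitivity (\int[mm]_z ((fun=> 0 : R) z)%:E)%E; last exact: integral0.
  exact: (int_ae_eq f0 (fun=> lexx _) mf (measurable_cst _) fz).
have mF : measurable_fun setT (fubini_F mu (fun z => (f z)%:E)).
  exact: (measurable_fun_fubini_tonelli_F _ mfE f0E).
have [h _] := ae_eq_integral_abs mu measurableT mF.
have : ae_eq mu setT (fubini_F mu (fun z => (f z)%:E)) (cst 0%E).
  apply: h; rewrite -[RHS]If (fubini_tonelli1 _ mfE f0E).
  apply: eq_integral => x _; rewrite gee0_abs//.
  by apply: integral_ge0 => y _.
by apply: filterS => x /(_ Logic.I).
Qed.

(** Raising proportionality to the power p and integrating in the second
    variable removes that variable, because both norms are 1. *)
Lemma proportional_ae_eq p u v : 0 < p -> measurable_fun setT u -> measurable_fun setT v ->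
  {ae mu, forall x, 0 <= u x} -> {ae mu, forall x, 0 <= v x} ->
  power_int p u = 1%E -> power_int p v = 1%E ->
  {ae mm, forall z, u z.1 * v z.2 = v z.1 * u z.2} -> {ae mu, forall x, u x = v x}.
Proof.
move=> p0 mu0 mv0 u0 v0 u1 v1 uv.
have mp w : measurable_fun setT w -> measurable_fun setT (fun x => `|w x| `^ p).
  exact: measurable_norm_powR.
have g0 w x : 0 <= `|w x| `^ p by exact: powR_ge0.
pose f (z : V * V) := `| `|u z.1| `^ p * `|v z.2| `^ p - `|v z.1| `^ p * `|u z.2| `^ p|.
have mf : measurable_fun setT f.
  apply: measurableT_comp => //; apply: measurable_funB; apply: measurable_funM.
  - exact: (measurable_fst_comp (mp _ mu0)).
  - exact: (measurable_snd_comp (mp _ mv0)).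
  - exact: (measurable_fst_comp (mp _ mv0)).
  - exact: (measurable_snd_comp (mp _ mu0)).
have fz : {ae mm, forall z, f z = 0}.
  apply: filterS uv => z uv; rewrite /f -!powRM// -!normrM uv.
  by rewrite subrr normr0.
have h := ae_ae_of_prod mf (fun z => normr_ge0 _) fz.
apply: filterS3 u0 v0 h => x ux vx hx.
have mfx : measurable_fun setT (fun y => f (x, y)).
  exact: (measurableT_comp mf (pair1_measurable x)).
have fy := ae_eq0_of_int mfx (fun y => normr_ge0 _) hx.
have E : (\int[mu]_y (`|u x| `^ p * `|v y| `^ p)%:E = \int[mu]_y (`|v x| `^ p * `|u y| `^ p)%:E)%E.
  apply: int_ae_eq.
  - by move=> y; exact: mulr_ge0.
  - by move=> y; exact: mulr_ge0.
  - exact: (measurable_funM (measurable_cst _) (mp _ mv0)).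
  - exact: (measurable_funM (measurable_cst _) (mp _ mu0)).
  by apply: filterS fy => y /eqP; rewrite normr_eq0 subr_eq0 => /eqP.
move: E; rewrite (intZ mu (g0 u x) (g0 v) (mp _ mv0)) (intZ mu (g0 v x) (g0 u) (mp _ mu0)).
rewrite -/(power_int p u) -/(power_int p v) u1 v1 !mule1 => -[].
rewrite (ger0_norm ux) (ger0_norm vx) => E.
by rewrite -(powRK (p := p) (a := u x)) ?gt_eqF// E powRK ?gt_eqF.
Qed.

(** The mean of two minimisers is a competitor, so the pointwise convexity
    defect has integral at most 0 and vanishes almost everywhere. *)
Lemma first_eigenfunction_unique p s Omega u v : (0 < N)%N -> 1 < p -> 0 < s < 1 ->
  open Omega -> bounded_set Omega ->
  W0 s p Omega u -> W0 s p Omega v -> power_int p u = 1%E -> power_int p v = 1%E ->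
  {ae mu, forall x, 0 <= u x} -> {ae mu, forall x, 0 <= v x} ->
  gagliardo_energy s p u = lambda1 s p Omega ->
  gagliardo_energy s p v = lambda1 s p Omega ->
  (lambda1 s p Omega < +oo)%E -> {ae mu, forall x, u x = v x}.
Proof.
move=> N0 p1 s01 oO bO Wu Wv u1 v1 u0 v0 Eu Ev ls; have p0 : 0 < p by lra.
have mu0 := W0_measurable Wu; have mv0 := W0_measurable Wv.
have fu : (gagliardo_energy s p u < +oo)%E by rewrite Eu.
have fv : (gagliardo_energy s p v < +oo)%E by rewrite Ev.
have pu : (power_int p u < +oo)%E by rewrite u1 ltry.
have pv : (power_int p v < +oo)%E by rewrite v1 ltry.
have WG := pmean_W0 N0 p1 s01 oO bO Wu Wv fu fv pu pv.
have mG := measurable_pmean p0 mu0 mv0.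
have G1 := power_int_pmean p0 mu0 mv0.
move: WG mG G1; set G := (fun x => pmean p (u x) (v x)) => WG mG G1.
have {}G1 : power_int p G = 1%E.
  by rewrite G1 u1 v1 -EFinD -EFinM; congr EFin; field.
have G0 : {ae mu, forall x, 0 <= G x} by apply: aeW => x; exact: pmean_ge0.
have lG := lambda1_le p1 oO s01 WG G1 G0.
have k0 w z : 0 <= gkern s p w z by exact: gkern_ge0.
have mk w : measurable_fun setT w -> measurable_fun setT (gkern s p w) by exact: measurable_gkern.
have mkG := mk _ mG.
pose S z := 2^-1 * (gkern s p u z + gkern s p v z).
pose defect z := S z - gkern s p G z.
have d0 z : 0 <= defect z by rewrite subr_ge0; exact: gkern_pmean_le.
have mS : measurable_fun setT S.
  exact: (measurable_funM (measurable_cst _) (measurable_funD (mk _ mu0) (mk _ mv0))).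
have md : measurable_fun setT defect := measurable_funB mS mkG.
have h0 : 0 <= (2^-1 : R) by rewrite invr_ge0.
have [L [L0 LE]] := ge0_lty_EFin (gagliardo_energy_ge0 s p u) fu.
have IS : (\int[mm]_z (S z)%:E = L%:E)%E.
  rewrite (intZ mm h0 (fun z => addr_ge0 (k0 u z) (k0 v z)) (measurable_funD (mk _ mu0) (mk _ mv0))).
  rewrite (intD mm (k0 u) (k0 v) (mk _ mu0) (mk _ mv0)).
  rewrite -(gagliardo_energyE s p mu0) -(gagliardo_energyE s p mv0) Ev -Eu LE.
  by rewrite -EFinD -EFinM; congr EFin; field.
have ID : (\int[mm]_z (S z)%:E = gagliardo_energy s p G + \int[mm]_z (defect z)%:E)%E.
  rewrite (gagliardo_energyE s p mG) -(intD mm (k0 G) d0 mkG md).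
  by apply: eq_integral => z _; rewrite /defect addrC subrK.
have dI : (\int[mm]_z (defect z)%:E = 0)%E.
  apply/eqP; rewrite eq_le (int_ge0 mm d0) andbT.
  have : (L%:E + \int[mm]_z (defect z)%:E <= L%:E + 0)%E.
    rewrite adde0 -[leRHS]IS ID; apply: leeD; last exact: lexx.
    by rewrite -LE Eu.
  by rewrite leeD2lE.
have uv := ae_eq0_of_int md d0 dI.
apply: (proportional_ae_eq p0 mu0 mv0 u0 v0 u1 v1).
apply: filterS3 uv (filterI (ae_fst u0) (ae_fst v0)) (filterI (ae_snd u0) (ae_snd v0)).
move=> z dz [a0 b0] [c0 d0'].
have [->|zz] := eqVneq z.1 z.2; first by rewrite mulrC.
have [_ h] := pmean_diff p1 a0 b0 c0 d0'.
apply: h; have e0 : 0 < enorm (z.1 - z.2) `^ (N%:R + s * p).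
  by rewrite powR_gt0// enorm_gt0// subr_eq0.
apply: (mulIf (lt0r_neq0 (_ : 0 < (enorm (z.1 - z.2) `^ (N%:R + s * p))^-1))).
  by rewrite invr_gt0.
by rewrite -[LHS]/(gkern s p G z) -(subr0_eq dz) /S /gkern -mulrDl mulrA [2^-1 * _]mulrC.
Qed.


End uniqueness.

(** * Strong convergence of the eigenfunctions *)

Theorem theorem5p2 (R : realType) (N : nat) (p s : R) (Omega : set 'rV[R]_N)
    (u_ : R -> 'rV[R]_N -> R) :
  (1 <= N)%N -> 1 < p -> 0 < s < 1 ->
  open Omega -> bounded_set Omega ->
  (forall sigma : R, 0 < sigma < 1 -> first_eigenfunction sigma p Omega (u_ sigma)) ->
  lambda1 k p Omega @[k --> s^'-] --> lambda1 s p Omega ->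
  forall k_ : nat -> R,
    (forall n, 0 < k_ n < s) -> k_ n @[n --> \oo] --> s ->
  exists phi : nat -> nat, {homo phi : m n / (m < n)%N} /\
  exists u : 'rV[R]_N -> R,
    [/\ Wtilde s p Omega u,
        gagliardo (k_ (phi j)) p (u_ (k_ (phi j)) \- u) @[j --> \oo] --> 0%E,
        W0 s p Omega u -> u = u_ s %[ae lebesgue_rV R N],
        Lp_norm p Omega u = 1%E &
        lambda1 s p Omega =
          (\int[lebesgue_rV R N]_x \int[lebesgue_rV R N]_y
            (`|u x - u y| `^ p / enorm (x - y) `^ (N%:R + s * p))%:E)%E].
Proof.
move=> N0 p1 s01 oO bO hu lc k_ hk kc.
have p0 : 0 < p by exact: lt_trans p1.
have mO : measurable Omega by exact: open_measurable_rV.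
have [phi [hphi [u [mu0 uO u0 u1 [Eu cu]]]]] :=
  limit_eigenfunction N0 p1 s01 oO bO hu lc hk kc.
have [Ws us1 us0 Es ls] := eigenfunctionP N0 p1 oO bO hu s01.
have fu : (gagliardo_energy s p u < +oo)%E by rewrite Eu.
exists phi; split=> //; exists u; split.
- by apply: (meyers_serrin N0 p1 s01 oO bO mu0 uO _ fu); rewrite u1 ltry.
- exact/(gagliardo_cvg0P (fun j => k_ (phi j)) (fun j => u_ (k_ (phi j)) \- u)%R p0).
- move=> Wu; have := first_eigenfunction_unique N0 p1 s01 oO bO Wu Ws u1 us1 u0 us0 Eu Es ls.
  by apply: filterS => x h _.
- apply/(Lp_norm_eq1 p0 mO mu0) => //; exact: aeW.
- by rewrite -Eu.
Qed.
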